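(* Let $k$ be an algebraically closed field of characteristic $p=2$, and let $\mathfrak g$ be the $2$-dimensional abelian restricted Lie algebra over $k$ with trivial restriction, i.e. $\mathfrak g^{[p]}=0$. Then $\mathfrak g$ satisfies Property PC.
   Context: **Hopf structures.** $k$ is an algebraically closed field of characteristic $p>0$. For a finite-dimensional restricted Lie algebra $\mathfrak g$ over $k$, let $A=u(\mathfrak g)$ be its restricted enveloping algebra, with the augmentation $A\to k$ killing $\mathfrak g$. $\widetilde\Delta$ denotes the comultiplication on $A$ for which all elements of $\mathfrak g$ are primitive, and $\widetilde\otimes$ the resulting tensor product of $A$-modules. We consider all cocommutative Hopf algebra structures $\Delta$ on the algebra $A$ whose counit is this fixed augmentation. Each one makes $A$ the group algebra $kG=k[G]^*$ of a finite group scheme $G$; the resulting tensor product of $A$-modules is denoted $\otimes$. **Points and support.** $\mathscr X(A)=\operatorname{Proj}H^*(A,k)$, where $H^*(A,k)=\operatorname{Ext}^*_A(k,k)$, is the space of homogeneous primes of the reduction of this graded-commutative ring; it does not depend on $\Delta$. A $\pi$-point of $G$ over a field extension $K/k$ is a flat map of $K$-algebras $\alpha_K:K[t]/t^p\to KG_K$ factoring through the group algebra of a unipotent abelian subgroup scheme of $G_K$. The point $\mathfrak p(\alpha_K)\in\mathscr X(A)$ is the radical of the kernel of $H^*(A,k)\to H^*(A_K,K)\to H^*(K[t]/t^p,K)$. Every point of $\mathscr X(A)$ arises this way, and two $\pi$-points are called equivalent if they give the same point. For a finite-dimensional $A$-module $M$, its support $\mathscr X(A,M)\subseteq\mathscr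 X(A)$ is the closed set of those $\mathfrak p(\alpha_K)$ for which $\alpha_K^*(M_K)$ is not projective; it does not depend on $\Delta$. For a closed point $\mathfrak p$, $\mathcal C(\mathfrak p)$ is the full subcategory of finite-dimensional $A$-modules $M$ with $\mathscr X(A,M)\subseteq\{\mathfrak p\}$. **Noble points.** $\mathfrak p\in\mathscr X(A)$ is noble for $G$ if $\mathfrak p=\mathfrak p(\alpha_K)$ for some $\pi$-point $\alpha_K$ of $G$ whose image is a Hopf subalgebra of $KG_K$; otherwise it is ignoble for $G$. **Properties.** - Property PA: for every finite group scheme $G$ with group algebra $kG=A$ arising from a cocommutative Hopf algebra structure $\Delta$ on $A=u(\mathfrak g)$ whose counit is the fixed augmentation $A\to k$ (with resulting tensor product $\otimes$), and every closed $\mathfrak p$ noble for $G$, $V\otimes W\cong V\widetilde\otimes W$ for all $V,W\in\mathcal C(\mathfrak p)$. - Property PB: for every finite group scheme $G$ with group algebra $kG=A$ arising from a cocommutative Hopf algebra structure $\Delta$ on $A=u(\mathfrak g)$ whose counit is the fixed augmentation $A\to k$ (with resulting tensor product $\otimes$), and every closed $\mathfrak p$ ignoble for $G$, there exist $V,W\in\mathcal C(\mathfrak p)$ with $V\otimes W\not\cong V\widetilde\otimes W$. - Property PC: both PA and PB. *)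

(* Defs.v *)
From HB Require Import structures.
From mathcomp Require Import all_boot all_order all_algebra all_field.
From mathcomp Require Import mxtens.

Set Implicit Arguments.
Unset Strict Implicit.
Unset Printing Implicit Defensive.

Import GRing.Theory.
Local Open Scope ring_scope.

Section StandardBasis.
Variables (k : fieldType) (V : vectType k).

Definition sbasis (i : 'I_(\dim {:V})) : V := (vbasis {:V})`_i.

Definition crd (v : V) (i : 'I_(\dim {:V})) : k := coord (vbasis {:V}) i v.

Lemma sbasisE (v : V) : v = \sum_i crd v i *: sbasis i.
Proof. exact/coord_vbasis/memvf. Qed.

Lemma crd_sbasis i j : crd (sbasis i) j = (i == j)%:R.
Proof. exact/coord_free/basis_free/vbasisP. Qed.

Lemma crdP c (u v : V) i : crd (c *: u + v) i = c * crd u i + crd v i.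
Proof. by rewrite /crd linearP. Qed.

Lemma crd_inj (u v : V) : (forall i, crd u i = crd v i) -> u = v.
Proof.
by move=> E; rewrite [u]sbasisE [v]sbasisE; apply: eq_bigr => i _; rewrite E.
Qed.

End StandardBasis.

(* The tensor product A (x)_k B; the (i, j) entry of a matrix is the          *)
(* coordinate on sbasis i (x) sbasis j. Its product is the one of the tensor  *)
(* product of algebras, not a product of matrices.                            *)
Definition tprod (k : fieldType) (A B : vectType k) : Type :=
  'M[k]_(\dim {:A}, \dim {:B}).

HB.instance Definition _ (k : fieldType) (A B : vectType k) :=
  Vector.copy (tprod A B) 'M[k]_(\dim {:A}, \dim {:B}).

Notation "A ⊗ B" := (tprod A B) (at level 40, left associativity) : type_scope.

Definition tens (k : fieldType) (A B : vectType k) (a : A) (b : B) : A ⊗ B :=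
  \matrix_(i, j) (crd a i * crd b j).

(* the map induced on A (x) B by a bilinear map A x B -> V *)
Definition tlift (k : fieldType) (A B : vectType k) (V : lmodType k)
    (beta : A -> B -> V) (t : A ⊗ B) : V :=
  \sum_i \sum_j t i j *: beta (sbasis i) (sbasis j).

Definition bilinear_map (k : fieldType) (A B V : lmodType k)
    (beta : A -> B -> V) : Prop :=
  (forall b, linear (beta^~ b)) /\ (forall a, linear (beta a)).

Section TensorProductTheory.
Variables (k : fieldType) (A B : vectType k).

Lemma tens_bilin : bilinear_map (@tens k A B).
Proof.
split=> [b|a] c x y; apply/matrixP => i j; rewrite !mxE crdP.
  by rewrite mulrDl mulrA.
by rewrite mulrDr mulrCA.
Qed.

Lemma tlift_is_linear (V : lmodType k) (beta : A -> B -> V) :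
  linear (tlift beta).
Proof.
move=> c s t; rewrite /tlift scaler_sumr -big_split; apply: eq_bigr => i _ /=.
rewrite scaler_sumr -big_split; apply: eq_bigr => j _ /=.
by rewrite !mxE scalerDl scalerA.
Qed.

HB.instance Definition _ (V : lmodType k) (beta : A -> B -> V) :=
  GRing.isLinear.Build k (A ⊗ B) V *:%R (tlift beta) (tlift_is_linear beta).

Lemma tlift_funP (V : lmodType k) (f g h : A -> B -> V) c t :
  (forall a b, h a b = c *: f a b + g a b) ->
  tlift h t = c *: tlift f t + tlift g t.
Proof.
move=> E; rewrite /tlift scaler_sumr -big_split; apply: eq_bigr => i _ /=.
rewrite scaler_sumr -big_split; apply: eq_bigr => j _ /=.
by rewrite E scalerDr !scalerA mulrC.
Qed.

Lemma bilin_suml (V : lmodType k) (beta : A -> B -> V) I (r : seq I)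
    (c : I -> k) (f : I -> A) b :
  bilinear_map beta ->
  beta (\sum_(i <- r) c i *: f i) b = \sum_(i <- r) c i *: beta (f i) b.
Proof.
case=> lin _; have b0 : beta 0 b = 0.
  by have /= := lin b (-1) 0 0; rewrite scaler0 addr0 scaleN1r addNr.
by elim/big_rec2: _ => // i x y _ <-; rewrite lin.
Qed.

Lemma bilin_sumr (V : lmodType k) (beta : A -> B -> V) I (r : seq I)
    (c : I -> k) (f : I -> B) a :
  bilinear_map beta ->
  beta a (\sum_(i <- r) c i *: f i) = \sum_(i <- r) c i *: beta a (f i).
Proof.
case=> _ lin; have b0 : beta a 0 = 0.
  by have /= := lin a (-1) 0 0; rewrite scaler0 addr0 scaleN1r addNr.
by elim/big_rec2: _ => // i x y _ <-; rewrite lin.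
Qed.

Lemma tlift_tens (V : lmodType k) (beta : A -> B -> V) a b :
  bilinear_map beta -> tlift beta (tens a b) = beta a b.
Proof.
move=> bil; rewrite {2}[a]sbasisE (bilin_suml _ _ _ _ bil).
apply: eq_bigr => i _; rewrite {2}[b]sbasisE (bilin_sumr _ _ _ _ bil).
rewrite scaler_sumr; apply: eq_bigr => j _.
by rewrite /tens mxE scalerA.
Qed.

Lemma tprod_ind (P : A ⊗ B -> Prop) :
  P 0 -> (forall s t, P s -> P t -> P (s + t)) ->
  (forall a b, P (tens a b)) -> forall t, P t.
Proof.
move=> P0 PD Pt t.
have -> : t = \sum_i \sum_j tens (t i j *: sbasis i) (sbasis j) :> (A ⊗ B).
  apply: etrans (matrix_sum_delta t) _.
  apply: eq_bigr => i _; apply: eq_bigr => j _.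
  apply/matrixP => i' j'; rewrite !mxE -[t i j *: _]addr0 crdP.
  have -> : crd (0 : A) i' = 0 by rewrite /crd linear0.
  by rewrite addr0 !crd_sbasis -mulrA -natrM mulnb ![_ == i']eq_sym ![_ == j']eq_sym.
by do 2![apply: big_ind => // ? _].
Qed.

End TensorProductTheory.

Section TensorAlgebra.
Variables (k : fieldType) (A B : falgType k).
Implicit Types s t u : A ⊗ B.

Definition tprod_mul s t : A ⊗ B :=
  tlift (fun a b => tlift (fun c d => tens (a * c) (b * d)) t) s.

Definition tprod_one : A ⊗ B := tens 1 1.

Lemma tprod_mul_bil (a : A) (b : B) :
  bilinear_map (fun c d => tens (a * c) (b * d)).
Proof.
have [tl tr] := tens_bilin A B.
by split=> [d|c] x y z; rewrite mulrDr -scalerAr (tl, tr).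
Qed.


Lemma tprod_mul_bil2 t :
  bilinear_map (fun a b => tlift (fun c d => tens (a * c) (b * d)) t).
Proof.
have [tl tr] := tens_bilin A B.
by split=> [b|a] x y z; apply: tlift_funP => c d;
  rewrite mulrDl -scalerAl (tl, tr).
Qed.

Lemma tprod_mul_tens a b c d :
  tprod_mul (tens a b) (tens c d) = tens (a * c) (b * d).
Proof.
by rewrite /tprod_mul tlift_tens ?tlift_tens //;
  [apply: tprod_mul_bil | apply: tprod_mul_bil2].
Qed.

Lemma tprod_mulDl : left_distributive tprod_mul +%R.
Proof. by move=> s t u; rewrite /tprod_mul linearD. Qed.

Lemma tprod_mulZl c s t : tprod_mul (c *: s) t = c *: tprod_mul s t.
Proof. by rewrite /tprod_mul linearZ. Qed.

Lemma tprod_mulP c s t u :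
  tprod_mul s (c *: t + u) = c *: tprod_mul s t + tprod_mul s u.
Proof.
by apply: tlift_funP => a b; rewrite linearP.
Qed.

Lemma tprod_mulDr : right_distributive tprod_mul +%R.
Proof. by move=> s t u; rewrite -[t]scale1r tprod_mulP !scale1r. Qed.

Lemma tprod_mul0l t : tprod_mul 0 t = 0.
Proof. by rewrite /tprod_mul linear0. Qed.

Lemma tprod_mul0r t : tprod_mul t 0 = 0.
Proof. by apply: (addrI (tprod_mul t 0)); rewrite -tprod_mulDr !addr0. Qed.

Lemma tprod_mulZr c s t : tprod_mul s (c *: t) = c *: tprod_mul s t.
Proof. by rewrite -[c *: t]addr0 tprod_mulP tprod_mul0r addr0. Qed.

Lemma tprod_mulA : associative tprod_mul.
Proof.
move=> s t u; elim/tprod_ind: s => [|s s' IH IH'|a b].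
- by rewrite !tprod_mul0l.
- by rewrite !tprod_mulDl IH IH'.
elim/tprod_ind: t => [|t t' IH IH'|c d].
- by rewrite !(tprod_mul0l, tprod_mul0r).
- by rewrite !(tprod_mulDl, tprod_mulDr) IH IH'.
elim/tprod_ind: u => [|u u' IH IH'|e f].
- by rewrite !tprod_mul0r.
- by rewrite !tprod_mulDr IH IH'.
by rewrite !tprod_mul_tens !mulrA.
Qed.

Lemma tprod_mul1l : left_id tprod_one tprod_mul.
Proof.
move=> t; elim/tprod_ind: t => [|t t' IH IH'|c d].
- by rewrite tprod_mul0r.
- by rewrite tprod_mulDr IH IH'.
by rewrite tprod_mul_tens !mul1r.
Qed.

Lemma tprod_mul1r : right_id tprod_one tprod_mul.
Proof.
move=> t; elim/tprod_ind: t => [|t t' IH IH'|c d].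
- by rewrite tprod_mul0l.
- by rewrite tprod_mulDl IH IH'.
by rewrite tprod_mul_tens !mulr1.
Qed.

Lemma tprod_one_neq0 : tprod_one != 0.
Proof.
have nz (C : falgType k) : exists i, crd (1 : C) i != 0.
  apply/existsP; rewrite -[X in is_true X]negbK negb_exists.
  apply: contra (oner_neq0 C) => /forallP z; apply/eqP/crd_inj => i.
  by rewrite [RHS]linear0; apply/eqP; have := z i; rewrite negbK.
have [[i ui] [j vj]] := (nz A, nz B).
apply/eqP => /matrixP/(_ i j); rewrite !mxE => /eqP.
by rewrite mulf_eq0 (negPf ui) (negPf vj).
Qed.

HB.instance Definition _ := GRing.Zmodule_isNzRing.Build (A ⊗ B)
  tprod_mulA tprod_mul1l tprod_mul1r tprod_mulDl tprod_mulDr tprod_one_neq0.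

Lemma tprod_scaleAl c s t : c *: (s * t) = (c *: s) * t.
Proof. by rewrite -[RHS]/(tprod_mul _ _) tprod_mulZl. Qed.

HB.instance Definition _ := GRing.Lmodule_isLalgebra.Build k (A ⊗ B)
  tprod_scaleAl.

Lemma tprod_scaleAr c s t : c *: (s * t) = s * (c *: t).
Proof. by rewrite -[RHS]/(tprod_mul _ _) tprod_mulZr. Qed.

HB.instance Definition _ := GRing.Lalgebra_isAlgebra.Build k (A ⊗ B)
  tprod_scaleAr.

HB.instance Definition _ := Algebra_isFalgebra.Build k (A ⊗ B).

Lemma tensM (a c : A) (b d : B) : tens a b * tens c d = tens (a * c) (b * d).
Proof. exact: tprod_mul_tens. Qed.

End TensorAlgebra.

(* A as a left module over itself is A^o, and (restr alpha A^o) is A seen as  *)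
(* a module along a ring morphism alpha into A.                               *)
Definition restr (R S : pzRingType) (f : {rmorphism R -> S}) (M : lmodType S) :
  Type := M.

Section RestrictionOfScalars.
Variables (R S : pzRingType) (f : {rmorphism R -> S}) (M : lmodType S).

HB.instance Definition _ := GRing.Zmodule.copy (restr f M) M.

Definition restr_scale (r : R) (m : restr f M) : restr f M := f r *: (m : M).

Fact restr_scaleA a b m :
  restr_scale a (restr_scale b m) = restr_scale (a * b) m.
Proof. by rewrite /restr_scale scalerA rmorphM. Qed.
Fact restr_scale1 : left_id 1 restr_scale.
Proof. by move=> m; rewrite /restr_scale rmorph1 scale1r. Qed.
Fact restr_scaleDr : right_distributive restr_scale +%R.
Proof. by move=> r m n; rewrite /restr_scale scalerDr. Qed.
Fact restr_scaleDl m : {morph restr_scale^~ m : a b / a + b}.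
Proof. by move=> r s; rewrite /restr_scale rmorphD scalerDl. Qed.

HB.instance Definition _ := GRing.Zmodule_isLmodule.Build R (restr f M)
  restr_scaleA restr_scale1 restr_scaleDr restr_scaleDl.

End RestrictionOfScalars.

Definition projective (R : pzRingType) (P : lmodType R) : Prop :=
  forall (E F : lmodType R) (g : {linear E -> F}) (f : {linear P -> F}),
    (forall y, exists x, g x = y) -> exists h : {linear P -> E}, g \o h =1 f.

Definition balanced (R : comPzRingType) (N M : lmodType R) (Z : zmodType)
    (beta : N -> M -> Z) : Prop :=
  [/\ forall m, zmod_morphism (beta^~ m), forall n, zmod_morphism (beta n)
    & forall r n m, beta (r *: n) m = beta n (r *: m)].

(* \sum n_i (x) m_i = 0 in N (x)_R M, by the universal property of N (x)_R M *)
Definition tensor_null (R : comPzRingType) (N M : lmodType R)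
    (s : seq (N * M)) : Prop :=
  forall (Z : zmodType) (beta : N -> M -> Z),
    balanced beta -> \sum_(x <- s) beta x.1 x.2 = 0.

(* - (x)_R M preserves injectivity *)
Definition flat (R : comPzRingType) (M : lmodType R) : Prop :=
  forall (N N' : lmodType R) (f : {linear N -> N'}), injective f ->
  forall s : seq (N * M),
    tensor_null [seq (f x.1, x.2) | x <- s] -> tensor_null s.

(* A finite-dimensional left A-module, with underlying space 'cV_rdim. *)
Record rep (k : fieldType) (A : algType k) := Rep {
  rdim : nat;
  rmx :> A -> 'M[k]_rdim;
  rmx_linear : linear rmx;
  rmx_monoid : monoid_morphism rmx
}.

HB.instance Definition _ (k : fieldType) (A : algType k) (M : rep A) :=
  GRing.isLinear.Build k A 'M[k]_(rdim M) *:%R (rmx M) (rmx_linear M).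
HB.instance Definition _ (k : fieldType) (A : algType k) (M : rep A) :=
  GRing.isMonoidMorphism.Build A 'M[k]_(rdim M) (rmx M) (rmx_monoid M).

Definition rep_iso (k : fieldType) (A : algType k) (M N : rep A) : Prop :=
  exists (P : 'M[k]_(rdim N, rdim M)) (Q : 'M[k]_(rdim M, rdim N)),
    [/\ P *m Q = 1%:M, Q *m P = 1%:M & forall a, P *m M a = N a *m P].

Definition rep_mod (k : fieldType) (A : algType k) (M : rep A) : Type :=
  'cV[k]_(rdim M).

Section RepModule.
Variables (k : fieldType) (A : algType k) (M : rep A).

HB.instance Definition _ := GRing.Zmodule.copy (rep_mod M) 'cV[k]_(rdim M).

Definition rep_scale (a : A) (v : rep_mod M) : rep_mod M := M a *m v.

Fact rep_scaleA a b v : rep_scale a (rep_scale b v) = rep_scale (a * b) v.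
Proof. by rewrite /rep_scale mulmxA rmorphM. Qed.
Fact rep_scale1 : left_id 1 rep_scale.
Proof. by move=> v; rewrite /rep_scale rmorph1 mul1mx. Qed.
Fact rep_scaleDr : right_distributive rep_scale +%R.
Proof. by move=> a u v; rewrite /rep_scale mulmxDr. Qed.
Fact rep_scaleDl v : {morph rep_scale^~ v : a b / a + b}.
Proof. by move=> a b; rewrite /rep_scale raddfD mulmxDl. Qed.

HB.instance Definition _ := GRing.Zmodule_isLmodule.Build A (rep_mod M)
  rep_scaleA rep_scale1 rep_scaleDr rep_scaleDl.

End RepModule.

(* The algebra K (x)_k A for a field extension iota : k -> K, in coordinates  *)
(* on the basis 1 (x) sbasis i. Here bc a is 1 (x) a, and bc_lift f is the    *)
(* K-linear extension of an iota-semilinear map f.                            *)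
Definition bchange (k K : fieldType) (iota : {rmorphism k -> K})
  (A : falgType k) : Type := 'rV[K]_(\dim {:A}).

HB.instance Definition _ (k K : fieldType) (iota : {rmorphism k -> K})
    (A : falgType k) :=
  Vector.copy (bchange iota A) 'rV[K]_(\dim {:A}).

Definition bc (k K : fieldType) (iota : {rmorphism k -> K}) (A : falgType k)
    (a : A) : bchange iota A :=
  \row_i iota (crd a i).

Definition bc_lift (k K : fieldType) (iota : {rmorphism k -> K})
    (A : falgType k) (V : lmodType K) (f : A -> V) (u : bchange iota A) : V :=
  \sum_i u 0 i *: f (sbasis i).

Definition semilin (k K : fieldType) (iota : {rmorphism k -> K})
    (V : lmodType k) (W : lmodType K) (f : V -> W) : Prop :=
  forall c x y, f (c *: x + y) = iota c *: f x + f y.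

Section SemilinearTheory.
Variables (k K : fieldType) (iota : {rmorphism k -> K}).

Section One.
Variables (V : lmodType k) (W : lmodType K) (f : V -> W).
Hypothesis sf : semilin iota f.

Lemma semilin0 : f 0 = 0.
Proof.
by have := sf (-1) 0 0; rewrite scaler0 addr0 rmorphN1 scaleN1r addNr.
Qed.

Lemma semilinD x y : f (x + y) = f x + f y.
Proof. by have := sf 1 x y; rewrite rmorph1 !scale1r. Qed.

Lemma semilinZ c x : f (c *: x) = iota c *: f x.
Proof. by have := sf c x 0; rewrite semilin0 !addr0. Qed.

Lemma semilin_sum I (r : seq I) (F : I -> V) :
  f (\sum_(i <- r) F i) = \sum_(i <- r) f (F i).
Proof.
by elim/big_rec2: _ => [|i x y _ <-]; rewrite (semilin0, semilinD).
Qed.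

End One.

(* f (x) g : B (x)_k C -> B' (x)_K C' for semilinear f and g *)
Definition stens (B C : vectType k) (B' C' : vectType K) (f : B -> B')
    (g : C -> C') (t : B ⊗ C) : B' ⊗ C' :=
  \sum_i \sum_j iota (t i j) *: tens (f (sbasis i)) (g (sbasis j)).

Lemma stens_semilin (B C : vectType k) (B' C' : vectType K) (f : B -> B')
    (g : C -> C') : semilin iota (stens f g).
Proof.
move=> c s t; rewrite /stens scaler_sumr -big_split; apply: eq_bigr => i _ /=.
rewrite scaler_sumr -big_split; apply: eq_bigr => j _ /=.
by rewrite !mxE rmorphD rmorphM scalerDl scalerA.
Qed.

Lemma stens_tens (B C : vectType k) (B' C' : vectType K) (f : B -> B')
    (g : C -> C') b c :
  semilin iota f -> semilin iota g ->
  stens f g (tens b c) = tens (f b) (g c).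
Proof.
move=> sf sg; have bil := tens_bilin B' C'.
rewrite {2}[b]sbasisE semilin_sum //.
under [in RHS]eq_bigr => i _ do rewrite semilinZ //.
rewrite bilin_suml //; apply: eq_bigr => i _.
rewrite {2}[c]sbasisE semilin_sum //.
under [in RHS]eq_bigr => j _ do rewrite semilinZ //.
rewrite bilin_sumr // scaler_sumr; apply: eq_bigr => j _.
by rewrite mxE rmorphM scalerA.
Qed.

End SemilinearTheory.

Section BaseChangeAlgebra.
Variables (k K : fieldType) (iota : {rmorphism k -> K}) (A : falgType k).
Implicit Types u v w : bchange iota A.
Local Notation bc := (@bc k K iota A).

Lemma bc_semilin : semilin iota bc.
Proof.
by move=> c x y; apply/rowP => i; rewrite !mxE crdP rmorphD rmorphM.
Qed.

Lemma bc_lift_is_linear (V : lmodType K) (f : A -> V) :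
  linear (@bc_lift k K iota A V f).
Proof.
move=> c u v; rewrite /bc_lift scaler_sumr -big_split; apply: eq_bigr => i _ /=.
by rewrite !mxE scalerDl scalerA.
Qed.

HB.instance Definition _ (V : lmodType K) (f : A -> V) :=
  GRing.isLinear.Build K (bchange iota A) V *:%R (@bc_lift k K iota A V f)
    (bc_lift_is_linear f).

Lemma bc_liftE (V : lmodType K) (f : A -> V) a :
  semilin iota f -> bc_lift f (bc a) = f a.
Proof.
move=> sf; rewrite {2}[a]sbasisE (semilin_sum sf); apply: eq_bigr => i _.
by rewrite (semilinZ sf) mxE.
Qed.

Lemma bc_ind (P : bchange iota A -> Prop) :
  P 0 -> (forall u v, P u -> P v -> P (u + v)) ->
  (forall c a, P (c *: bc a)) -> forall u, P u.
Proof.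
move=> P0 PD Pc u.
have -> : u = \sum_i u 0 i *: bc (sbasis i).
  apply: etrans (row_sum_delta u) _; apply: eq_bigr => i _.
  by congr (_ *: _); apply/rowP => j; rewrite !mxE crd_sbasis eq_sym rmorph_nat.
by apply: big_ind.
Qed.

Lemma bc_lift_funP (V : lmodType K) (f g h : A -> V) c u :
  (forall a, h a = c *: f a + g a) ->
  bc_lift h u = c *: bc_lift f u + bc_lift g u.
Proof.
move=> E; rewrite /bc_lift scaler_sumr -big_split; apply: eq_bigr => i _ /=.
by rewrite E scalerDr !scalerA mulrC.
Qed.

Definition bc_mul u v : bchange iota A :=
  bc_lift (fun a => bc_lift (fun b => bc (a * b)) v) u.

Lemma bc_mulP c u v w : bc_mul u (c *: v + w) = c *: bc_mul u v + bc_mul u w.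
Proof. by apply: bc_lift_funP => a; rewrite linearP. Qed.
Lemma bc_mulDr : right_distributive bc_mul +%R.
Proof. by move=> u v w; rewrite -[v]scale1r bc_mulP !scale1r. Qed.
Lemma bc_mulDl : left_distributive bc_mul +%R.
Proof. by move=> u v w; rewrite /bc_mul linearD. Qed.
Lemma bc_mul0l u : bc_mul 0 u = 0.
Proof. by rewrite /bc_mul linear0. Qed.
Lemma bc_mul0r u : bc_mul u 0 = 0.
Proof. by apply: (addrI (bc_mul u 0)); rewrite -bc_mulDr !addr0. Qed.
Lemma bc_mulZl c u v : bc_mul (c *: u) v = c *: bc_mul u v.
Proof. by rewrite /bc_mul linearZ. Qed.
Lemma bc_mulZr c u v : bc_mul u (c *: v) = c *: bc_mul u v.
Proof. by rewrite -[c *: v]addr0 bc_mulP bc_mul0r addr0. Qed.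

Lemma bc_mul_bc a b : bc_mul (bc a) (bc b) = bc (a * b).
Proof.
rewrite /bc_mul bc_liftE => [|c x y].
  by apply: bc_liftE => c x y; rewrite mulrDr -scalerAr bc_semilin.
by apply: bc_lift_funP => d; rewrite mulrDl -scalerAl bc_semilin.
Qed.

Lemma bc_mulA : associative bc_mul.
Proof.
move=> u v w; elim/bc_ind: u => [|u u' IH IH'|c x].
- by rewrite !bc_mul0l.
- by rewrite !bc_mulDl IH IH'.
elim/bc_ind: v => [|v v' IH IH'|d y].
- by rewrite !(bc_mul0l, bc_mul0r).
- by rewrite !(bc_mulDl, bc_mulDr) IH IH'.
elim/bc_ind: w => [|w w' IH IH'|e z].
- by rewrite !bc_mul0r.
- by rewrite !bc_mulDr IH IH'.
rewrite !(bc_mulZl, bc_mulZr) !bc_mul_bc mulrA !scalerA.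
by congr (_ *: _); rewrite mulrC mulrA.
Qed.

Lemma bc_mul1l : left_id (bc 1) bc_mul.
Proof.
move=> u; elim/bc_ind: u => [|v v' IH IH'|d y]; first by rewrite bc_mul0r.
  by rewrite bc_mulDr IH IH'.
by rewrite bc_mulZr bc_mul_bc mul1r.
Qed.

Lemma bc_mul1r : right_id (bc 1) bc_mul.
Proof.
move=> u; elim/bc_ind: u => [|v v' IH IH'|d y]; first by rewrite bc_mul0l.
  by rewrite bc_mulDl IH IH'.
by rewrite bc_mulZl bc_mul_bc mulr1.
Qed.

Lemma bc1_neq0 : bc 1 != 0.
Proof.
apply: contra (oner_neq0 A) => /eqP/rowP z; apply/eqP/crd_inj => i.
by have /eqP := z i; rewrite !mxE fmorph_eq0 => /eqP ->; rewrite [RHS]linear0.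
Qed.

HB.instance Definition _ := GRing.Zmodule_isNzRing.Build (bchange iota A)
  bc_mulA bc_mul1l bc_mul1r bc_mulDl bc_mulDr bc1_neq0.

Lemma bc_scaleAl c u v : c *: (u * v) = (c *: u) * v.
Proof. by rewrite -[RHS]/(bc_mul _ _) bc_mulZl. Qed.
HB.instance Definition _ := GRing.Lmodule_isLalgebra.Build K (bchange iota A)
  bc_scaleAl.

Lemma bc_scaleAr c u v : c *: (u * v) = u * (c *: v).
Proof. by rewrite -[RHS]/(bc_mul _ _) bc_mulZr. Qed.
HB.instance Definition _ := GRing.Lalgebra_isAlgebra.Build K (bchange iota A)
  bc_scaleAr.

HB.instance Definition _ := Algebra_isFalgebra.Build K (bchange iota A).

Lemma bcM a b : bc a * bc b = bc (a * b).
Proof. exact: bc_mul_bc. Qed.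

Lemma bc_lift_monoid (B : algType K) (f : A -> B) :
  semilin iota f -> monoid_morphism f ->
  monoid_morphism (@bc_lift k K iota A B f).
Proof.
move=> sf [f1 fM]; split=> [|u v]; first by rewrite bc_liftE.
elim/bc_ind: u => [|u u' IH IH'|c x].
- by rewrite mul0r linear0 mul0r.
- by rewrite mulrDl !linearD /= IH IH' mulrDl.
elim/bc_ind: v => [|v v' IH IH'|d y].
- by rewrite mulr0 linear0 mulr0.
- by rewrite mulrDr !linearD /= IH IH' mulrDr.
rewrite -scalerAl -scalerAr bcM !linearZ /= !bc_liftE // fM.
by rewrite -scalerAl -scalerAr.
Qed.

End BaseChangeAlgebra.

Section BaseChangeRep.
Variables (k K : fieldType) (iota : {rmorphism k -> K}) (A : falgType k).
Variable M : rep A.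

Definition bc_rmx : bchange iota A -> 'M[K]_(rdim M) :=
  bc_lift (fun a => map_mx iota (M a)).

Lemma bc_rmx_linear : linear bc_rmx. Proof. exact: linearP. Qed.

Lemma bc_rmx_monoid : monoid_morphism bc_rmx.
Proof.
have sl : semilin iota (fun a => map_mx iota (M a)).
  by move=> c x y; rewrite linearP map_mxD map_mxZ.
split=> [|u v]; rewrite /bc_rmx.
  by rewrite bc_liftE // rmorph1 map_mx1.
elim/bc_ind: u => [|u u' IH IH'|c x].
- by rewrite mul0r linear0 mul0r.
- by rewrite mulrDl !linearD /= IH IH' mulrDl.
elim/bc_ind: v => [|v v' IH IH'|d y].
- by rewrite mulr0 linear0 mulr0.
- by rewrite mulrDr !linearD /= IH IH' mulrDr.
rewrite -scalerAl -scalerAr bcM !linearZ /= !bc_liftE // rmorphM map_mxM.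
by rewrite -[RHS]scalemxAl -scalemxAr.
Qed.

Definition bc_rep : rep (bchange iota A) := Rep bc_rmx_linear bc_rmx_monoid.

End BaseChangeRep.

(* Cocommutative Hopf algebra structures with counit eps. Both sides of       *)
(* comulA live in A (x) (A (x) A).                                            *)
Record hopf (k : fieldType) (A : falgType k) (eps : {lrmorphism A -> k^o}) :=
  Hopf {
    comul : {lrmorphism A -> A ⊗ A};
    antip : {linear A -> A};
    comul_counitl : forall x, tlift (fun a b => eps a *: b) (comul x) = x;
    comul_counitr : forall x, tlift (fun a b => eps b *: a) (comul x) = x;
    comulA : forall x,
      tlift (fun a b => tlift (fun c d => tens c (tens d b)) (comul a))
        (comul x) =
      tlift (fun a b => tens a (comul b)) (comul x);
    comulC : forall x, tlift (fun a b => tens b a) (comul x) = comul x;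
    antipl : forall x, tlift (fun a b => antip a * b) (comul x) = eps x *: 1;
    antipr : forall x, tlift (fun a b => a * antip b) (comul x) = eps x *: 1
  }.

Section TensorRep.
Variables (k : fieldType) (A : falgType k) (eps : {lrmorphism A -> k^o}).
Variables (H : hopf eps) (V W : rep A).

Let phi (a b : A) : 'M[k]_(rdim V * rdim W) := V a *t W b.

Fact phi_bil : bilinear_map phi.
Proof.
split=> [b|a] c x y; rewrite /phi linearP /=; apply/matrixP => i j.
  by rewrite !mxE mulrDl mulrA.
by rewrite !mxE mulrDr mulrCA.
Qed.

Definition tensor_rmx (x : A) : 'M[k]_(rdim V * rdim W) :=
  tlift phi (comul H x).

Fact tensor_rmx_linear : linear tensor_rmx.
Proof. by move=> c x y; rewrite /tensor_rmx !linearP. Qed.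

Fact tlift_phiM s t : tlift phi (s * t) = tlift phi s *m tlift phi t.
Proof.
elim/tprod_ind: s => [|s s' IH IH'|a b].
- by rewrite mul0r !linear0 mul0mx.
- by rewrite mulrDl !linearD /= IH IH' mulmxDl.
elim/tprod_ind: t => [|s s' IH IH'|c d].
- by rewrite mulr0 !linear0.
- by rewrite mulrDr !linearD /= IH IH'.
rewrite tensM !tlift_tens; try exact: phi_bil.
by rewrite /phi tensmx_mul !rmorphM.
Qed.

Fact tensor_rmx_monoid : monoid_morphism tensor_rmx.
Proof.
split=> [|x y]; last by rewrite /tensor_rmx rmorphM /= tlift_phiM.
rewrite /tensor_rmx rmorph1 -[1]/(tens 1 1) tlift_tens; last exact: phi_bil.
rewrite /phi !rmorph1; apply/matrixP => i j.
case: (mxtens_indexP i) => i1 i2; case: (mxtens_indexP j) => j1 j2.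
rewrite tensmxE !mxE -natrM mulnb (can_eq (@mxtens_indexK _ _)).
by rewrite xpair_eqE.
Qed.

Definition tensor_rep : rep A := Rep tensor_rmx_linear tensor_rmx_monoid.

End TensorRep.

Section BaseChangeHopf.
Variables (k K : fieldType) (iota : {rmorphism k -> K}) (A : falgType k).
Local Notation AK := (bchange iota A).
Local Notation bc := (@bc k K iota A).

Section Counit.
Variable eps : {lrmorphism A -> k^o}.

Definition bc_eps : AK -> K^o := bc_lift (fun a => iota (eps a) : K^o).

Fact bc_eps_semilin : semilin iota (fun a => iota (eps a) : K^o).
Proof. by move=> c x y; rewrite linearP rmorphD rmorphM. Qed.

Fact bc_eps_linear : linear bc_eps. Proof. exact: linearP. Qed.
HB.instance Definition _ :=
  GRing.isLinear.Build K AK K^o *:%R bc_eps bc_eps_linear.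

Fact bc_eps_monoid : monoid_morphism bc_eps.
Proof.
apply: bc_lift_monoid => [|]; first exact: bc_eps_semilin.
by split=> [|x y]; rewrite (rmorph1, rmorphM) /= (rmorph1, rmorphM).
Qed.
HB.instance Definition _ :=
  GRing.isMonoidMorphism.Build AK K^o bc_eps bc_eps_monoid.

Lemma bc_epsE a : bc_eps (bc a) = iota (eps a).
Proof. exact: bc_liftE bc_eps_semilin. Qed.

End Counit.

Local Notation bct := (stens iota bc bc).

Let bct_semilin : semilin iota bct := stens_semilin _ _ _.
Let bc_sl : semilin iota bc := @bc_semilin k K iota A.

Lemma bct_tens a b : bct (tens a b) = tens (bc a) (bc b).
Proof. exact: stens_tens. Qed.

Variables (eps : {lrmorphism A -> k^o}) (H : hopf eps).

Definition bc_comul : AK -> AK ⊗ AK := bc_lift (fun a => bct (comul H a)).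

Fact bc_comul_semilin : semilin iota (fun a => bct (comul H a)).
Proof. by move=> c x y; rewrite linearP bct_semilin. Qed.

Lemma bc_comulE a : bc_comul (bc a) = bct (comul H a).
Proof. exact: bc_liftE bc_comul_semilin. Qed.

Fact bc_comul_linear : linear bc_comul. Proof. exact: linearP. Qed.
HB.instance Definition _ :=
  GRing.isLinear.Build K AK (AK ⊗ AK) *:%R bc_comul bc_comul_linear.

Lemma bctM s t : bct (s * t) = bct s * bct t.
Proof.
have D := semilinD bct_semilin; have Z := semilin0 bct_semilin.
elim/tprod_ind: s => [|s s' IH IH'|a b].
- by rewrite mul0r Z mul0r.
- by rewrite mulrDl !D IH IH' mulrDl.
elim/tprod_ind: t => [|s s' IH IH'|c d].
- by rewrite mulr0 Z mulr0.
- by rewrite mulrDr !D IH IH' mulrDr.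
by rewrite tensM !bct_tens tensM !bcM.
Qed.

Fact bc_comul_monoid : monoid_morphism bc_comul.
Proof.
apply: bc_lift_monoid; first exact: bc_comul_semilin.
split=> [|x y]; last by rewrite rmorphM bctM.
by rewrite rmorph1 -[1 in LHS]/(tens 1 1) bct_tens.
Qed.
HB.instance Definition _ :=
  GRing.isMonoidMorphism.Build AK (AK ⊗ AK) bc_comul bc_comul_monoid.

Definition bc_antip : AK -> AK := bc_lift (fun a => bc (antip H a)).
Fact bc_antip_semilin : semilin iota (fun a => bc (antip H a)).
Proof. by move=> c x y; rewrite linearP bc_sl. Qed.
Lemma bc_antipE a : bc_antip (bc a) = bc (antip H a).
Proof. exact: bc_liftE bc_antip_semilin. Qed.
Fact bc_antip_linear : linear bc_antip. Proof. exact: linearP. Qed.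
HB.instance Definition _ :=
  GRing.isLinear.Build K AK AK *:%R bc_antip bc_antip_linear.

Lemma bc_linext (V : lmodType K) (f g : {linear AK -> V}) :
  (forall a, f (bc a) = g (bc a)) -> f =1 g.
Proof.
move=> E; elim/bc_ind => [|u v IH IH'|c a]; first by rewrite !linear0.
  by rewrite !linearD /= IH IH'.
by rewrite !linearZ /= E.
Qed.

Lemma bct_lift (V : lmodType k) (W : lmodType K) (f : V -> W)
    (beta : A -> A -> V) (gamma : AK -> AK -> W) t :
  semilin iota f -> bilinear_map beta -> bilinear_map gamma ->
  (forall a b, gamma (bc a) (bc b) = f (beta a b)) ->
  tlift gamma (bct t) = f (tlift beta t).
Proof.
move=> sf bb bg E; elim/tprod_ind: t => [|s t IH IH'|a b].
- by rewrite (semilin0 bct_semilin) !linear0 (semilin0 sf).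
- by rewrite (semilinD bct_semilin) !linearD /= (semilinD sf) IH IH'.
by rewrite bct_tens !tlift_tens.
Qed.

Fact bc_counitl x : tlift (fun a b => bc_eps eps a *: b) (bc_comul x) = x.
Proof.
move: x; pose f := tlift (fun a b : AK => bc_eps eps a *: b) \o bc_comul.
apply: (@bc_linext _ f idfun) => a /=; rewrite bc_comulE.
rewrite -[in RHS](comul_counitl H a); apply: bct_lift => //.
- by split=> [b|b] c x y; rewrite ?linearP /= ?scalerDl ?scalerDr !scalerA // mulrC.
- by split=> [b|b] c x y; rewrite ?linearP /= ?scalerDl ?scalerDr !scalerA // mulrC.
by move=> b c; rewrite bc_epsE (semilinZ bc_sl).
Qed.

Fact bc_counitr x : tlift (fun a b => bc_eps eps b *: a) (bc_comul x) = x.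
Proof.
move: x; pose f := tlift (fun a b : AK => bc_eps eps b *: a) \o bc_comul.
apply: (@bc_linext _ f idfun) => a /=; rewrite bc_comulE.
rewrite -[in RHS](comul_counitr H a); apply: bct_lift => //.
- by split=> [b|b] c x y; rewrite ?linearP /= ?scalerDl ?scalerDr !scalerA // mulrC.
- by split=> [b|b] c x y; rewrite ?linearP /= ?scalerDl ?scalerDr !scalerA // mulrC.
by move=> b c; rewrite bc_epsE (semilinZ bc_sl).
Qed.

Fact bc_comulC x : tlift (fun a b => tens b a) (bc_comul x) = bc_comul x.
Proof.
have [tl tr] := (tens_bilin A A, tens_bilin AK AK).
move: x; pose f := tlift (fun a b : AK => tens b a) \o bc_comul.
apply: (@bc_linext _ f bc_comul) => a /=; rewrite bc_comulE.
rewrite -[in RHS](comulC H a); apply: bct_lift => //.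
- by split=> b; [exact: tl.2 | exact: tl.1].
- by split=> b; [exact: tr.2 | exact: tr.1].
by move=> b c; rewrite bct_tens.
Qed.

Fact bc_antipl x :
  tlift (fun a b => bc_antip a * b) (bc_comul x) = (bc_eps eps x : K) *: (1 : AK).
Proof.
elim/bc_ind: x => [|u v IH IH'|c a]; first by rewrite !linear0 scale0r.
  by rewrite !linearD /= IH IH' scalerDl.
rewrite !linearZ /= -scalerA; congr (c *: _); rewrite bc_comulE bc_epsE.
rewrite -[1]/(bc 1) -(semilinZ bc_sl) -(antipl H a); apply: bct_lift => //.
- split=> [b|b] z x y; first by rewrite linearP mulrDl scalerAl.
  by rewrite mulrDr scalerAr.
- split=> [b|b] z x y; first by rewrite linearP mulrDl scalerAl.
  by rewrite mulrDr scalerAr.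
by move=> b d; rewrite bc_antipE bcM.
Qed.

Fact bc_antipr x :
  tlift (fun a b => a * bc_antip b) (bc_comul x) = (bc_eps eps x : K) *: (1 : AK).
Proof.
elim/bc_ind: x => [|u v IH IH'|c a]; first by rewrite !linear0 scale0r.
  by rewrite !linearD /= IH IH' scalerDl.
rewrite !linearZ /= -scalerA; congr (c *: _); rewrite bc_comulE bc_epsE.
rewrite -[1]/(bc 1) -(semilinZ bc_sl) -(antipr H a); apply: bct_lift => //.
- split=> [b|b] z x y; first by rewrite mulrDl scalerAl.
  by rewrite linearP mulrDr scalerAr.
- split=> [b|b] z x y; first by rewrite mulrDl scalerAl.
  by rewrite linearP mulrDr scalerAr.
by move=> b d; rewrite bc_antipE bcM.
Qed.

Fact bc_comulA x :
  tlift (fun a b => tlift (fun c d => tens c (tens d b)) (bc_comul a))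
    (bc_comul x) =
  tlift (fun a b => tens a (bc_comul b)) (bc_comul x).
Proof.
move: x; have [tA [tK [t1 t2]]] := (tens_bilin A A,
  (tens_bilin AK AK, (tens_bilin A (A ⊗ A), tens_bilin AK (AK ⊗ AK)))).
pose l (F : fieldType) (C : falgType F) (b c d : C) := tens c (tens d b).
have lA b : bilinear_map (@l _ A b).
  split=> [d|d] c x y; rewrite /l; first by rewrite t1.1.
  by rewrite tA.1 t1.2.
have lK b : bilinear_map (@l _ AK b).
  split=> [d|d] c x y; rewrite /l; first by rewrite t2.1.
  by rewrite tK.1 t2.2.
pose f := tlift (fun a b : AK => tlift (@l K AK b) (bc_comul a)) \o bc_comul.
pose g := tlift (fun a b : AK => tens a (bc_comul b)) \o bc_comul.
apply: (@bc_linext _ f g) => a /=; rewrite bc_comulE.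
have s3 : semilin iota (stens iota bc bct) := stens_semilin _ _ _.
have E3 u v w : stens iota bc bct (tens u (tens v w)) =
    tens (bc u) (tens (bc v) (bc w)).
  by rewrite stens_tens // bct_tens.
transitivity (stens iota bc bct
    (tlift (fun a b : A => tlift (@l k A b) (comul H a)) (comul H a))).
  apply: bct_lift => //.
  - split=> [b|b] c x y; first by rewrite !linearP.
    by apply: tlift_funP => u v; rewrite /l tA.2 t1.2.
  - split=> [b|b] c x y; first by rewrite !linearP.
    by apply: tlift_funP => u v; rewrite /l tK.2 t2.2.
  by move=> b c; rewrite bc_comulE; apply: bct_lift => // u v; rewrite /l E3.
rewrite (comulA H a); symmetry; apply: bct_lift => //.
- by split=> [b|b] c x y; [rewrite t1.1 | rewrite linearP t1.2].
- by split=> [b|b] c x y; [rewrite t2.1 | rewrite linearP t2.2].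
by move=> b c; rewrite bc_comulE stens_tens.
Qed.

Definition bc_hopf : hopf (bc_eps eps) :=
  @Hopf _ _ _ bc_comul bc_antip bc_counitl bc_counitr bc_comulA bc_comulC
    bc_antipl bc_antipr.

End BaseChangeHopf.

Arguments bc_eps {k K} iota {A} eps.
Arguments bc_hopf {k K} iota {A eps} H.

(* A finite group scheme G with group algebra kG = A is a cocommutative Hopf  *)
(* structure on A; its closed subgroup schemes correspond to the Hopf         *)
(* subalgebras of A.                                                          *)
Definition hopf_subalg (k : fieldType) (A : falgType k)
    (eps : {lrmorphism A -> k^o}) (H : hopf eps) (U : {aspace A}) : Prop :=
  [/\ 1 \in U,
      forall u, u \in U ->
        comul H u \in
          <<[seq (tens a b : A ⊗ A) | a <- vbasis U, b <- vbasis U]>>%VS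
    & forall u, u \in U -> antip H u \in U].

(* every nonzero representation has a nonzero fixed vector *)
Definition unipotent (k : fieldType) (A : falgType k)
    (eps : {lrmorphism A -> k^o}) (U : {aspace A}) : Prop :=
  forall M : rep (subvs_of U), (0 < rdim M)%N ->
    exists2 v : 'cV[k]_(rdim M), v != 0
      & forall u : subvs_of U, M u *m v = (eps (vsval u) : k) *: v.

(* H^*(A, k) = Ext_A^*(k, k) is the cohomology of Hom_A(bar resolution, k),   *)
(* with product the cup product. The cochains of degree n are the k-multi-    *)
(* linear maps A^n -> k.                                                      *)
Definition cochain (k : fieldType) (A : algType k) (n : nat) : Type :=
  {ffun 'I_n -> A} -> k.

Section Cohomology.
Variables (k : fieldType) (A : algType k) (eps : A -> k).

Definition upd n (a : {ffun 'I_n -> A}) (i : 'I_n) (x : A) :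
  {ffun 'I_n -> A} := [ffun j => if j == i then x else a j].

Definition multilinear n (f : cochain A n) : Prop :=
  forall a i c x y,
    f (upd a i (c *: x + y)) = c * f (upd a i x) + f (upd a i y).

(* (a_0, ..., a_i a_(i+1), ..., a_n) *)
Definition contract n (i : 'I_n) (a : {ffun 'I_n.+1 -> A}) :
    {ffun 'I_n -> A} :=
  [ffun j : 'I_n => if (j < i)%N then a (widen_ord (leqnSn n) j)
                    else if j == i then
                      a (widen_ord (leqnSn n) i) * a (lift ord0 i)
                    else a (lift ord0 j)].

Definition cdiff n (f : cochain A n) : cochain A n.+1 := fun a =>
  eps (a ord0) * f [ffun j => a (lift ord0 j)]
  + \sum_(i < n) (-1) ^+ i.+1 * f (contract i a)
  + (-1) ^+ n.+1 * (f [ffun j => a (widen_ord (leqnSn n) j)] * eps (a ord_max)).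

Definition cocycle n (f : cochain A n) : Prop :=
  multilinear f /\ forall a, cdiff f a = 0.

Definition coboundary n : cochain A n -> Prop :=
  if n is m.+1 return cochain A n -> Prop then
    fun f => exists2 h : cochain A m, multilinear h & f =1 cdiff h
  else fun f => f =1 (fun=> 0).

Definition cup m n (f : cochain A m) (g : cochain A n) : cochain A (m + n) :=
  fun a => f [ffun i => a (lshift n i)] * g [ffun i => a (rshift m i)].

Definition cup_exp n (f : cochain A n) : forall m, cochain A (m * n) :=
  fix loop m := if m is m'.+1 then cup f (loop m') else fun=> 1.

(* A homogeneous prime of the reduction of H^*(A, k) not containing all of    *)
(* the elements of positive degree, given by the cocycles of each degree      *)
(* whose class maps into it.                                                  *)
Record point := Point {
  pset :> forall n, cochain A n -> Prop;
  pset_cocycle : forall n (f : cochain A n), pset f -> cocycle f;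
  pset_coboundary : forall n (f : cochain A n), coboundary f -> pset f;
  psetD : forall n (f g : cochain A n),
    pset f -> pset g -> pset (fun a => f a + g a);
  psetMl : forall m n (f : cochain A m) (g : cochain A n),
    cocycle f -> pset g -> pset (cup f g);
  psetMr : forall m n (f : cochain A m) (g : cochain A n),
    pset f -> cocycle g -> pset (cup f g);
  pset_prime : forall m n (f : cochain A m) (g : cochain A n),
    cocycle f -> cocycle g -> pset (cup f g) -> pset f \/ pset g;
  pset_relevant : exists n (f : cochain A n),
    [/\ (0 < n)%N, cocycle f & ~ pset f]
}.

Definition same_point (P Q : point) : Prop :=
  forall n (f : cochain A n), P n f <-> Q n f.

(* the Zariski closed subsets V(I) of Proj *)
Definition zariski_closed (S : point -> Prop) : Prop :=
  exists I : forall n, cochain A n -> Prop,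
    forall Q : point,
      S Q <-> forall n (f : cochain A n), cocycle f -> I n f -> Q n f.

Definition closed_point (P : point) : Prop := zariski_closed (same_point P).

End Cohomology.

Arguments cup_exp [k A n] f m _.

Notation trunc_poly K p := {poly %/ ('X^p : {poly K})}.

Definition trunc_eps (K : fieldType) (p : nat) (x : trunc_poly K p) : K :=
  (x : {poly K})`_0.

(* the multilinear extension of a cochain to K (x)_k A *)
Definition bc_cochain (k K : fieldType) (iota : {rmorphism k -> K})
    (A : falgType k) n (f : cochain A n) : cochain (bchange iota A) n :=
  fun u => \sum_(s : {ffun 'I_n -> 'I_(\dim {:A})})
    (\prod_i u i 0 (s i)) * iota (f [ffun i => sbasis (s i)]).

Arguments bc_cochain {k K} iota {A n} f.

Definition pull_cochain (K : fieldType) (A B : algType K) (alpha : B -> A) n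
    (f : cochain A n) : cochain B n :=
  fun b => f [ffun i => alpha (b i)].

Section PiPoints.
Variables (p : nat) (k : fieldType) (A : falgType k).
Variables (eps : {lrmorphism A -> k^o}) (H : hopf eps).

Section OnePiPoint.
Variables (K : fieldType) (iota : {rmorphism k -> K}).
Variable alpha : {lrmorphism trunc_poly K p -> bchange iota A}.

Definition pi_point : Prop :=
  flat (restr alpha (bchange iota A)^o) /\
  exists U : {aspace bchange iota A},
    [/\ hopf_subalg (bc_hopf iota H) U,
        {in U &, commutative *%R},
        unipotent (bc_eps iota eps) U
      & forall x, alpha x \in U].

(* the radical of the kernel of H^*(A, k) -> H^*(K[t]/t^p, K) *)
Definition pi_ideal n (f : cochain A n) : Prop :=
  cocycle eps f /\
  exists m, coboundary (@trunc_eps K p)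
              (pull_cochain alpha (bc_cochain iota (cup_exp f m))).

Definition represents (P : point eps) : Prop :=
  forall n (f : cochain A n), P n f <-> pi_ideal f.

Definition pull_projective (M : rep A) : Prop :=
  projective (restr alpha (rep_mod (bc_rep iota M))).

Definition hopf_image : Prop :=
  exists2 U : {aspace bchange iota A}, hopf_subalg (bc_hopf iota H) U
    & forall y, y \in U <-> exists x, alpha x = y.

End OnePiPoint.

Definition in_support (M : rep A) (P : point eps) : Prop :=
  exists (K : fieldType) (iota : {rmorphism k -> K})
         (alpha : {lrmorphism trunc_poly K p -> bchange iota A}),
    [/\ pi_point alpha, represents alpha P & ~ pull_projective alpha M].

Definition supported_at (P : point eps) (M : rep A) : Prop :=
  forall Q, in_support M Q -> same_point P Q.

Definition noble (P : point eps) : Prop :=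
  exists (K : fieldType) (iota : {rmorphism k -> K})
         (alpha : {lrmorphism trunc_poly K p -> bchange iota A}),
    [/\ pi_point alpha, represents alpha P & hopf_image alpha].

End PiPoints.

Section RestrictedLie.
Variables (k : fieldType) (p : nat) (g : vectType k).

(* The i-th term of the formula for (x + y)^[p]: i *: jacobson_term i x y is  *)
(* the coefficient of l^(i-1) in (ad (l x + y))^(p-1) x.                      *)
Definition jacobson_term (br : g -> g -> g) (i : nat) (x y : g) : g :=
  i%:R^-1 *: \sum_(w : p.-1.-tuple bool | count id w == i.-1)
               foldr (fun b : bool => br (if b then x else y)) x w.

Record restricted_lie := RestrictedLie {
  bracket : g -> g -> g;
  ppow : g -> g;
  bracket_bilin : bilinear_map bracket;
  bracket_alt : forall x, bracket x x = 0;
  bracket_jacobi : forall x y z,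
    bracket x (bracket y z) + bracket y (bracket z x)
      + bracket z (bracket x y) = 0;
  ppow_ad : forall x y, bracket (ppow x) y = iter p (bracket x) y;
  ppowZ : forall c x, ppow (c *: x) = c ^+ p *: ppow x;
  ppowD : forall x y,
    ppow (x + y) =
      ppow x + ppow y + \sum_(1 <= i < p) jacobson_term bracket i x y
}.

Definition restricted_hom (L : restricted_lie) (B : algType k) (f : g -> B) :
    Prop :=
  [/\ linear f, forall x y, f (bracket L x y) = f x * f y - f y * f x
    & forall x, f (ppow L x) = f x ^+ p].

(* the universal property of u(g) *)
Definition restricted_enveloping (L : restricted_lie) (A : algType k)
    (j : g -> A) : Prop :=
  restricted_hom L j /\
  forall (B : algType k) (f : g -> B), restricted_hom L f ->
    exists F : {lrmorphism A -> B}, F \o j =1 f /\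
      forall F' : {lrmorphism A -> B}, F' \o j =1 f -> F' =1 F.

End RestrictedLie.

Section Properties.
Variables (p : nat) (k : fieldType) (A : falgType k).
Variables (eps : {lrmorphism A -> k^o}) (H0 : hopf eps).

Definition property_PA_for : Prop :=
  forall (H : hopf eps) (P : point eps), closed_point P -> noble p H P ->
  forall V W : rep A, supported_at p H P V -> supported_at p H P W ->
    rep_iso (tensor_rep H V W) (tensor_rep H0 V W).

Definition property_PB_for : Prop :=
  forall (H : hopf eps) (P : point eps), closed_point P -> ~ noble p H P ->
  exists V W : rep A, [/\ supported_at p H P V, supported_at p H P W
    & ~ rep_iso (tensor_rep H V W) (tensor_rep H0 V W)].

End Properties.

(* A is u(g), eps its augmentation, and H0 the comultiplication for which all *)
(* elements of g are primitive; these are determined by g.                    *)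
Definition primitive_enveloping (k : fieldType) (p : nat) (g : vectType k)
    (L : restricted_lie p g) (A : falgType k) (j : g -> A)
    (eps : {lrmorphism A -> k^o}) (H0 : hopf eps) : Prop :=
  [/\ restricted_enveloping L j, forall x, eps (j x) = 0
    & forall x, comul H0 (j x) = tens (j x) 1 + tens 1 (j x)].

Definition property_PA (k : fieldType) (p : nat) (g : vectType k)
    (L : restricted_lie p g) : Prop :=
  forall (A : falgType k) (j : g -> A) (eps : {lrmorphism A -> k^o})
         (H0 : hopf eps),
    primitive_enveloping L j H0 -> property_PA_for p H0.

Definition property_PB (k : fieldType) (p : nat) (g : vectType k)
    (L : restricted_lie p g) : Prop :=
  forall (A : falgType k) (j : g -> A) (eps : {lrmorphism A -> k^o})
         (H0 : hopf eps),
    primitive_enveloping L j H0 -> property_PB_for p H0.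

Definition property_PC (k : fieldType) (p : nat) (g : vectType k)
    (L : restricted_lie p g) : Prop :=
  property_PA L /\ property_PB L.

(* Main.v *)
(* The algebra A = u(g) is k[x,y]/(x^2,y^2). A closed point P of X(A) is a     *)
(* line in the span of x and y; complete a generator u of it to primitive      *)
(* generators u, v of A. For a cocommutative Hopf structure on A, the          *)
(* coefficient of v (x) v in Delta(u) vanishes exactly when P is noble: then   *)
(* u + e uv generates a Hopf subalgebra for a suitable e; conversely, if a     *)
(* pi-point at P has Hopf image, then the coefficient of v (x) v in the        *)
(* comultiplication of the image of t is 0.                                    *)
(*   If it does not vanish, then V = W = A/(u) has support {P}, and u acts by  *)
(* a nonzero multiple of v (x) v on the tensor product for Delta but by 0 on   *)
(* the one for primitive u and v.                                              *)
(*   If it vanishes, then modules V and W supported at P split into copies of  *)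
(* A, for which both tensor products are free, and modules killed by uv. On    *)
(* the latter all v + c u are exact, so that u = v N with N nilpotent and N is *)
(* a commutator [E, N] with E commuting with v. On V (x) W the two actions of  *)
(* (u, v) differ by quadratic terms in v (x) 1, 1 (x) v and the N's, which a   *)
(* product of two explicit unipotent operators built from E and the            *)
(* contracting homotopies of v conjugates away.                                *)
From HB Require Import structures.
From Stdlib Require Import Classical FunctionalExtensionality.
Require Import Defs.
From mathcomp Require Import all_boot all_order all_algebra all_field.
From mathcomp Require Import mxtens ring zify.

Set Implicit Arguments.
Unset Strict Implicit.
Unset Printing Implicit Defensive.

Import GRing.Theory.
Local Open Scope ring_scope.

(** * Cochains on words *)

(** Points. The algebra A has a basis 1, u, v, uv with u^2 = v^2 = 0 (a [frame]), and its cohomology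
    is polynomial on the degree one classes dual to u and v. The fact used is [frame_cocycle_split]:
    a cocycle that vanishes at (u, ..., u) is, up to a coboundary, a multiple of the class dual to
    v. It comes from an explicit homotopy on words in the basis. Hence a point that contains the
    class dual to v consists exactly of the cocycles vanishing at (u, ..., u) ([point_frameE]).
    Since a binary form over k has a zero, every closed point is of this kind, for u and v primitive
    ([closed_point_primitive_frame]). The point of a pi-point alpha consists of the cocycles whose
    extension vanishes at (alpha t, ..., alpha t) ([pi_idealE]).

    Nobility. Let c2 be the functional dual to v. The operator D = (c2 (x) id) Delta is a derivation
    of A commuting with all (phi (x) id) Delta, and [twist] = c2 (D u) is the coefficient of v (x) v
    in Delta(u). If it is 0, some u' = u + e uv has D u' = 0, which forces Delta(u') into the span
    of 1 and u' on both sides, so the point is noble ([noble_of_twist]). Conversely, c2 vanishes on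
    the Hopf image of a pi-point at P, and so does c2 (x) c2 on its comultiplication
    ([twist_of_noble]).

    Ignoble points. On the square of A/(u), u acts by [twist] times v (x) v for Delta and by 0 for
    the primitive structure ([quot_supported], [twist_not_same_tensor]).

    Noble points. A module on which uv is nonzero splits off a copy of A ([regular_summand]), and
    the product of A with W is the same module for every Hopf structure ([regular_tensor]). What
    remains are modules killed by uv and supported at P. There every v + c u is exact
    ([supported_exact_lines]), so u = v N with N nilpotent and N = [E, N] for an E commuting with v
    ([exact_pair_structure], [nilpotent_ad]). With this E the two actions on V (x) W are conjugate
    by an explicit unipotent operator ([twisted_conjugate], [tensor_core]). *)

Section Words.
Variables (k : fieldType) (L : Type) (mul : L -> L -> option L).
Implicit Types (F G : seq L -> k) (s : seq L).

Definition wcons F a s := F (a :: s).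

(** The bar differential in characteristic 2, once rewritten as a sum of contractions of adjacent
    letters without outer terms ([cdiff_star]). [None] stands for a zero product. *)
Fixpoint wdiff F s : k :=
  if s is a :: s1 then
    if s1 is b :: s2 then
      oapp (fun c => F (c :: s2)) 0 (mul a b) + wdiff (wcons F a) s1
    else 0
  else 0.

Lemma wdiff_cons F a b s :
  wdiff F (a :: b :: s) =
    oapp (fun c => F (c :: s)) 0 (mul a b) + wdiff (wcons F a) (b :: s).
Proof. by []. Qed.

Lemma eq_wdiff F G s : F =1 G -> wdiff F s = wdiff G s.
Proof.
elim: s F G => [|a [|b s] IH] F G E //.
rewrite !wdiff_cons; congr (_ + _); last by apply: IH => t; apply: E.
by case: (mul a b) => //= c.
Qed.

Lemma wdiff0 s : wdiff (fun=> 0) s = 0.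
Proof.
elim: s => [|a [|b s] IH] //.
rewrite wdiff_cons (eq_wdiff (G := fun=> 0)) // IH addr0.
by case: (mul a b).
Qed.

Lemma wdiffD F G s : wdiff (fun t => F t + G t) s = wdiff F s + wdiff G s.
Proof.
elim: s F G => [|a [|b s] IH] F G; rewrite ?addr0 // !wdiff_cons addrACA -IH.
by congr (_ + _); case: (mul a b) => //=; rewrite addr0.
Qed.

Lemma wdiffZ x F s : wdiff (fun t => x * F t) s = x * wdiff F s.
Proof.
elim: s F => [|a [|b s] IH] F; rewrite ?mulr0 // !wdiff_cons mulrDr -IH.
by congr (_ + _); case: (mul a b) => //=; rewrite mulr0.
Qed.

(** Contractions at disjoint places occur in both orders and cancel in characteristic 2; those at
    overlapping places cancel by associativity. *)
Lemma wdiff_wdiff F s :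
    (forall x : k, x + x = 0) ->
    (forall a b c, obind (mul^~ c) (mul a b) = obind (mul a) (mul b c)) ->
  wdiff (wdiff F) s = 0.
Proof.
move=> addrr mulA; elim: s F => [|a [|b s] IH] F //; rewrite wdiff_cons.
(* The part of the outer differential that contracts a with the first letter of t. *)
pose lmul t := if t is d :: t' then
  oapp (fun c => F (c :: t')) 0 (mul a d) else 0.
have E : wcons (wdiff F) a =1 fun t => lmul t + wdiff (wcons F a) t.
  by case=> [|d t]; rewrite /= ?addr0.
rewrite (eq_wdiff _ E) wdiffD IH addr0.
suff -> : wdiff lmul (b :: s) = oapp (fun c => wdiff F (c :: s)) 0 (mul a b).
  exact: addrr.
case: s {IH E} => [|c s]; first by case: (mul a b).
rewrite wdiff_cons; have -> : oapp (fun d => lmul (d :: s)) 0 (mul b c) =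
    oapp (fun d => F (d :: s)) 0 (obind (mul a) (mul b c)).
  by case: (mul b c).
rewrite -mulA; case ab: (mul a b) => [d|].
  transitivity (wdiff F (d :: c :: s)) => //; rewrite wdiff_cons.
  by congr (_ + _); apply: eq_wdiff => t; rewrite /wcons /= ab.
rewrite add0r (eq_wdiff (G := fun=> 0)) ?wdiff0 ?addr0 // => t.
by rewrite /wcons /= ab.
Qed.

Lemma wdiff_sum e F s :
  wdiff F s = \sum_(i < (size s).-1)
    oapp (fun c => F (take i s ++ c :: drop i.+2 s)) 0
      (mul (nth e s i) (nth e s i.+1)).
Proof.
elim: s F => [|a [|b s] IH] F; rewrite ?big_ord0 //.
by rewrite wdiff_cons IH [RHS]big_ord_recl /= drop0.
Qed.

Lemma eq_wdiff_size (e : L) n F G s : (forall t, size t = n -> F t = G t) ->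
  size s = n.+1 -> wdiff F s = wdiff G s.
Proof.
move=> E sn; rewrite !(wdiff_sum e) sn /=; apply: eq_bigr => i _.
case: (mul _ _) => //= c; apply: E; have lti := ltn_ord i.
by rewrite size_cat /= size_drop size_take; case: ltnP => H; lia.
Qed.

End Words.

(** * A homotopy on words in 1, u, v, uv *)

Section Homotopy.
Variables (k : fieldType) (char2 : 2%N \in [pchar k]).

(* The letter (i, j) stands for u^i v^j. In characteristic 2 the bar          *)
(* differential is the sum of the contractions of adjacent arguments for the  *)
(* product a b + eps(a) b + eps(b) a, for which 1 is an idempotent that is    *)
(* orthogonal to u, v and uv.                                                 *)
Notation lE := (false, false).
Notation lU := (true, false).
Notation lV := (false, true).
Notation lW := (true, true).

Definition mul_uv (a b : bool * bool) : option (bool * bool) :=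
  match a, b with
  | lE, lE => Some lE | lU, lV | lV, lU => Some lW | _, _ => None
  end.

Implicit Types (F G : seq (bool * bool) -> k).
Notation D := (wdiff mul_uv).

(** If s = u^i s' and s' does not begin with u, this is the sum over j <= i of F (u^(j+1) v u^(i-j)
    s'): a leading uv is split into u and v, and v is moved through the u's that follow. *)
Fixpoint hw F s : k :=
  match s with
  | [::] => F [:: lU; lV]
  | b :: s' => F (lU :: lV :: s)
               + (if b is lU then hw (wcons F lU) s' else 0)
  end.

(** Passes over the leading u's, then doubles a 1 or splits a uv as [hw] does. It is 0 if a v or the
    end of the word comes next. *)
Fixpoint hU F s : k :=
  match s with
  | lE :: s' => F (lE :: s)
  | lU :: s' => hU (wcons F lU) s'
  | lW :: s' => hw F s'
  | _ => 0
  end.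

Lemma eq_hw F G s : F =1 G -> hw F s = hw G s.
Proof.
elim: s F G => [|[[] []] s IH] F G E //=; rewrite E //.
by congr (_ + _); apply: IH => t; apply: E.
Qed.

Lemma eq_hU F G s : F =1 G -> hU F s = hU G s.
Proof.
elim: s F G => [|[[] []] s IH] F G E //=; first exact: eq_hw.
by apply: IH => t; apply: E.
Qed.

Lemma hwD F G s : hw (fun t => F t + G t) s = hw F s + hw G s.
Proof.
elim: s F G => [|[[] []] s IH] F G //=; rewrite ?addr0 //.
by rewrite addrACA -IH.
Qed.

Lemma hUD F G s : hU (fun t => F t + G t) s = hU F s + hU G s.
Proof.
elim: s F G => [|[[] []] s IH] F G //=; rewrite ?addr0 //; first exact: hwD.
exact: IH.
Qed.

Lemma hw0 s : hw (fun=> 0) s = 0.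
Proof. by elim: s => [|[[] []] s IH] //=; rewrite add0r ?IH. Qed.

Lemma hU0 s : hU (fun=> 0) s = 0.
Proof.
by elim: s => [|[[] []] s IH] //=; rewrite ?hw0 // (eq_hU (G := fun=> 0)).
Qed.

Definition cupV F s : k := if s is lV :: s' then F s' else 0.

Lemma hw_cupV F s : hw (cupV F) s = 0.
Proof.
by case: s => [|[[] []] s] //=; rewrite add0r // (eq_hw (G := fun=> 0)) ?hw0.
Qed.

Lemma hU_cupV F s : hU (cupV F) s = 0.
Proof.
by case: s => [|[[] []] s] //=; rewrite ?hw_cupV // (eq_hU (G := fun=> 0)) ?hU0.
Qed.

Lemma wcons_wdiffU F s :
  wcons (D F) lU s = D (wcons F lU) s + cupV (wcons F lW) s.
Proof. by case: s => [|[[] []] s]; rewrite /wcons /= ?addr0 // ?add0r // addrC. Qed.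

Let addrr x : x + x = 0 :> k. Proof. exact: addrr_pchar2. Qed.

(** Contracting u with v in F (u v s) restores F (uv s). In the sum over the positions of v, the
    contraction of v with the u on its right cancels that of the next summand with the u on its
    left; the other contractions make up the differential of [hw F]. *)
Lemma hw_homotopy F s :
  F (lW :: s) = wcons (D (hU F)) lW s + hw (D F) s.
Proof.
have DW G t : wcons (D (hU G)) lW t = D (hw G) t.
  by case: t => [|[[] []] t]; rewrite /wcons /= ?add0r.
elim: s F => [|b s IH] F; first by rewrite /= addr0 add0r.
rewrite DW.
have D2 : D (hw F) (b :: s) =
    D (wcons (wcons F lU) lV) (b :: s)
    + (if b is lU then D (hw (wcons F lU)) s else 0).
  case: s {IH} => [|c s]; first by case: b => [] [] []; rewrite /= addr0.
  rewrite !wdiff_cons.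
  have E : wcons (hw F) b =1 fun t =>
     wcons (wcons (wcons F lU) lV) b t
     + (if b is lU then hw (wcons F lU) t else 0) by [].
  rewrite (eq_wdiff _ _ E) wdiffD addrA; congr (_ + _ + _).
    by case: b c {E} => [[] []] [[] []] //=; rewrite addr0.
  by case: b {E} => [[] []] //=; rewrite -/(D _ (c :: s)) ?wdiff0.
rewrite D2.
have -> : hw (D F) (b :: s) = D F (lU :: lV :: b :: s)
   + (if b is lU then hw (D (wcons F lU)) s else 0).
  case: b {D2} => [[] []] //; congr (_ + _).
  by rewrite -[LHS]/(hw (wcons (D F) lU) s) (eq_hw _ (wcons_wdiffU F)) hwD hw_cupV addr0.
have -> : D F (lU :: lV :: b :: s) = F (lW :: b :: s)
   + ((if b is lU then F (lU :: lW :: s) else 0)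
      + D (wcons (wcons F lU) lV) (b :: s)).
  by rewrite !wdiff_cons; congr (_ + (_ + _)); case: b {D2} => [[] []].
set x := D (wcons (wcons F lU) lV) _.
have E y z w : z + y + w = 0 -> F (lW :: b :: s) =
    x + y + (F (lW :: b :: s) + (w + x) + z).
  move=> e; apply/esym; have -> : x + y + (F (lW :: b :: s) + (w + x) + z) =
    F (lW :: b :: s) + (x + x) + (z + y + w) by ring.
  by rewrite e addrr !addr0.
apply: E; case: b {D2} @x => [[] []] x; rewrite ?addr0 //.
have := IH (wcons F lU); rewrite DW /wcons => ->.
by rewrite [X in X + _]addrC addrr.
Qed.

(** A contracting homotopy on words that do not begin with v, except on the words u...u, which carry
    the cohomology there. After the leading u's, a 1 is restored by contracting its double and a uv
    by [hw_homotopy]; if a v follows, the last u contracts with it to a uv that [hw] splits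
    again. *)
Lemma hU_homotopy F a s : a != lV ->
  F (a :: s) = D (hU F) (a :: s) + hU (D F) (a :: s)
    + (if all (pred1 lU) (a :: s) then F (a :: s) else 0).
Proof.
elim: s F a => [|b s IH] F [[] []] // _.
- by rewrite hw_homotopy addr0.
- by rewrite /= !add0r.
- by rewrite /= addr0 add0r addr0.
- by rewrite hw_homotopy addr0.
- have -> : hU (D F) (lU :: b :: s) = hU (D (wcons F lU)) (b :: s).
    rewrite -[LHS]/(hU (wcons (D F) lU) (b :: s)).
    by rewrite (eq_hU _ (wcons_wdiffU F)) hUD hU_cupV addr0.
  have -> : D (hU F) (lU :: b :: s) =
     (if b is lV then hw F s else 0) + D (hU (wcons F lU)) (b :: s).
    by rewrite wdiff_cons; congr (_ + _); case: b {IH} => [[] []].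
  have := IH (wcons F lU) b; case: b => [[] []] IHb.
  - by rewrite add0r [LHS]IHb.
  - by rewrite add0r [LHS]IHb.
  - rewrite [X in _ + X]/= !addr0; case: s {IH IHb} => [|c s].
      by rewrite /= addr0.
    rewrite wdiff_cons (eq_wdiff _ _ (G := fun=> 0)) // wdiff0 addr0.
    by case: c => [[] []]; rewrite [hw _ _]/= ?addr0 // -addrA addrr addr0.
  - by rewrite add0r [LHS]IHb.
- have -> : hU (D F) (lE :: b :: s) = oapp (fun c => F (c :: b :: s)) 0 (Some lE)
    + (oapp (fun c => F (lE :: c :: s)) 0 (mul_uv lE b)
       + D (wcons (wcons F lE) lE) (b :: s)).
    by rewrite -!wdiff_cons.
  have -> : D (hU F) (lE :: b :: s) = oapp (fun c => hU F (c :: s)) 0 (mul_uv lE b)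
    + D (wcons (wcons F lE) lE) (b :: s).
    by rewrite wdiff_cons; congr (_ + _); apply: eq_wdiff.
  move: (D (wcons (wcons F lE) lE) (b :: s)) => x.
  case: b {IH} => [[] []]; rewrite /wcons /= ?add0r ?addr0.
  - by rewrite addrCA addrr addr0.
  - by rewrite addrCA addrr addr0.
  - by rewrite addrCA addrr addr0.
  - have -> (y : k) : y + x + (y + (y + x)) = y + (x + x) + (y + y) by ring.
    by rewrite !addrr !addr0.
Qed.

Lemma mul_uvA a b c : obind (mul_uv^~ c) (mul_uv a b) = obind (mul_uv a) (mul_uv b c).
Proof. by case: a b c => [[] []] [[] []] [[] []]. Qed.

(** Divisibility by the class dual to v, in terms of words: [cupV g] is the cup product of that
    class with g. *)
Lemma word_cocycle_split F : (forall s, D F s = 0) ->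
  (forall s, (0 < size s)%N -> all (pred1 lU) s -> F s = 0) ->
  exists G g, (forall s, (0 < size s)%N -> F s = cupV g s + D G s) /\
              (forall s, D g s = 0).
Proof.
(* By the homotopy, F + D (hU F) vanishes on nonempty words that do not begin with v; g is what is
   left after the leading v. *)
move=> DF F0; pose g s := F (lV :: s) + D (hU F) (lV :: s).
have E s : (0 < size s)%N -> F s = cupV g s + D (hU F) s.
  case: s => [|a s] // _; have [->|nV] := eqVneq a lV.
    by rewrite /= -addrA addrr addr0.
  rewrite {1}(hU_homotopy F s nV) (eq_hU _ DF) hU0 addr0.
  case: ifP => [/F0 -> //|_]; last rewrite addr0.
    by case: a nV => [[] []] // _; rewrite add0r addr0.
  by case: a nV => [[] []] // _; rewrite add0r.
exists (hU F), g; split=> [|[|b s]] //.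
(* This differential is D g (b s) plus the contraction of v with b. The latter is 0, since a nonzero
   product of v with b is uv, and F + D (hU F) vanishes on words beginning with uv. *)
have : D (fun t => F t + D (hU F) t) (lV :: b :: s) = 0.
  by rewrite wdiffD DF wdiff_wdiff ?add0r //; apply: mul_uvA.
rewrite wdiff_cons.
have -> : D (wcons (fun t => F t + D (hU F) t) lV) (b :: s) = D g (b :: s) by [].
have W : F (lW :: s) + D (hU F) (lW :: s) = 0.
  rewrite (E (lW :: s) isT); have -> : cupV g (lW :: s) = 0 by [].
  by rewrite add0r addrr.
suff -> : oapp (fun c => F (c :: s) + D (hU F) (c :: s)) 0 (mul_uv lV b) = 0.
  by rewrite add0r.
by case: b => [[] []] //; exact: W.
Qed.

End Homotopy.

(** * A homotopy on words in 1 and t *)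

Section TruncHomotopy.
Variables (k : fieldType) (char2 : 2%N \in [pchar k]).

Definition mul_t (a b : bool) : option bool :=
  if a || b then None else Some false.

Implicit Types (F G : seq bool -> k).
Notation D := (wdiff mul_t).

(** Doubles the first 1 after the leading t's, so that only the words t...t carry cohomology; [true]
    is t and [false] is 1. *)
Fixpoint hT F s : k :=
  match s with
  | [::] => 0
  | false :: s' => F (false :: s)
  | true :: s' => hT (wcons F true) s'
  end.

Lemma eq_hT F G s : F =1 G -> hT F s = hT G s.
Proof. by elim: s F G => [|[] s IH] F G E //=; apply: IH => t; apply: E. Qed.

Lemma hT0 s : hT (fun=> 0) s = 0.
Proof. by elim: s => [|[] s IH]. Qed.

Lemma hT_homotopy F a s :
  F (a :: s) = D (hT F) (a :: s) + hT (D F) (a :: s)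
    + (if all id (a :: s) then F (a :: s) else 0).
Proof.
have addrr (x : k) : x + x = 0 by exact: addrr_pchar2.
elim: s F a => [|b s IH] F [].
- by rewrite /= !add0r.
- by rewrite /= !addr0 add0r.
- have -> : hT (D F) (true :: b :: s) = hT (D (wcons F true)) (b :: s).
    rewrite -[LHS]/(hT (wcons (D F) true) (b :: s)).
    by apply: eq_hT => -[|c t]; rewrite /wcons ?wdiff_cons //= add0r.
  have -> : D (hT F) (true :: b :: s) = D (hT (wcons F true)) (b :: s).
    by rewrite wdiff_cons /= add0r.
  exact: (IH (wcons F true) b).
have -> : hT (D F) (false :: b :: s) = F (false :: b :: s)
    + (oapp (fun c => F (false :: c :: s)) 0 (mul_t false b)
       + D (wcons (wcons F false) false) (b :: s)).
  by rewrite -!wdiff_cons.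
have -> : D (hT F) (false :: b :: s) =
    oapp (fun c => hT F (c :: s)) 0 (mul_t false b)
    + D (wcons (wcons F false) false) (b :: s).
  by rewrite wdiff_cons; congr (_ + _); apply: eq_wdiff.
move: (D (wcons (wcons F false) false) (b :: s)) => x.
case: b {IH} => /=; rewrite ?add0r ?addr0.
  by rewrite addrCA addrr addr0.
have -> (y : k) : y + x + (y + (y + x)) = y + (x + x) + (y + y) by ring.
by rewrite !addrr !addr0.
Qed.

Lemma word_coboundary_trunc F : (forall s, D F s = 0) ->
  (forall s, (0 < size s)%N -> all id s -> F s = 0) ->
  forall s, (0 < size s)%N -> F s = D (hT F) s.
Proof.
move=> DF F0 [|a s] // _; rewrite {1}hT_homotopy (eq_hT _ DF) hT0 addr0.
by case: ifP => [/F0 ->|_]; rewrite ?addr0.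
Qed.

End TruncHomotopy.


(** * Multilinear cochains on a basis *)

Section MultilinearBasis.
Variables (k : fieldType) (A : algType k) (L : finType).
Variables (bas : L -> A) (co : L -> A -> k).
Hypothesis expand : forall a, a = \sum_l co l a *: bas l.
Hypothesis co_lin : forall l c x y, co l (c *: x + y) = c * co l x + co l y.
Hypothesis co_bas : forall l m, co l (bas m) = (m == l)%:R.

Lemma multilinear0 n (f : cochain A n) a i : multilinear f -> f (upd a i 0) = 0.
Proof.
move=> fl; have := fl a i (-1) 0 0.
by rewrite scaler0 addr0 mulN1r addNr.
Qed.

Lemma multilinearD n (f : cochain A n) a i x y : multilinear f ->
  f (upd a i (x + y)) = f (upd a i x) + f (upd a i y).
Proof. by move=> fl; rewrite -[x]scale1r fl mul1r scale1r. Qed.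

Lemma multilinearZ n (f : cochain A n) a i c x : multilinear f ->
  f (upd a i (c *: x)) = c * f (upd a i x).
Proof. by move=> fl; rewrite -[c *: x]addr0 fl multilinear0 // addr0. Qed.

Lemma multilinear_sum n (f : cochain A n) a i I (r : seq I) (c : I -> k) F :
  multilinear f ->
  f (upd a i (\sum_(j <- r) c j *: F j)) = \sum_(j <- r) c j * f (upd a i (F j)).
Proof.
move=> fl; elim: r => [|j r IH]; first by rewrite !big_nil multilinear0.
by rewrite !big_cons fl IH.
Qed.

Lemma upd_id n (a : {ffun 'I_n -> A}) i : upd a i (a i) = a.
Proof. by apply/ffunP => j; rewrite ffunE; case: eqP => // ->. Qed.

Lemma multilinear_ext n (f g : cochain A n) :
  multilinear f -> multilinear g ->
  (forall s : {ffun 'I_n -> L},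
     f [ffun i => bas (s i)] = g [ffun i => bas (s i)]) ->
  f =1 g.
Proof.
(* Induction on the number m of leading arguments that are arbitrary, the others being basis
   vectors. *)
move=> fl gl fg; suff H m : (m <= n)%N -> forall a : {ffun 'I_n -> A},
    (forall i : 'I_n, (m <= i)%N -> exists l, a i = bas l) -> f a = g a.
  by move=> a; apply: (H n) => // i; rewrite leqNgt ltn_ord.
elim: m => [_ a al|m IH mn a al].
  have [s sE] : exists s : {ffun 'I_n -> L}, forall i, a i = bas (s i).
    have ch i : exists l, a i == bas l by have [l ->] := al i isT; exists l.
    by exists [ffun i => xchoose (ch i)] => i; rewrite ffunE; apply/eqP/(xchooseP (ch i)).
  have -> : a = [ffun i => bas (s i)] by apply/ffunP => i; rewrite ffunE.
  exact: fg.
pose i := Ordinal mn; rewrite -(upd_id a i) (expand (a i)) !multilinear_sum //.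
apply: eq_bigr => l _; congr (_ * _); apply: IH => [|j mj]; first exact: ltnW.
rewrite ffunE; case: eqP => [_|/eqP nij]; first by exists l.
by apply: al; rewrite ltn_neqAle mj andbT eq_sym; apply: contra nij.
Qed.

Definition mext n (G : {ffun 'I_n -> L} -> k) : cochain A n :=
  fun a => \sum_(s : {ffun 'I_n -> L}) (\prod_i co (s i) (a i)) * G s.

Lemma mext_multilinear n (G : {ffun 'I_n -> L} -> k) : multilinear (mext G).
Proof.
move=> a i c x y; rewrite /mext mulr_sumr -big_split; apply: eq_bigr => s _ /=.
have E z : \prod_j co (s j) (upd a i z j) =
    co (s i) z * \prod_(j | j != i) co (s j) (a j).
  rewrite (bigD1 i) //= ffunE eqxx; congr (_ * _).
  by apply: eq_bigr => j ji; rewrite ffunE (negPf ji).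
by rewrite !E co_lin !mulrDl !mulrA.
Qed.

Lemma mextE n (G : {ffun 'I_n -> L} -> k) (s : {ffun 'I_n -> L}) :
  mext G [ffun i => bas (s i)] = G s.
Proof.
rewrite /mext (bigD1 s) //= [X in X * _]big1 => [|i _]; last first.
  by rewrite ffunE co_bas eqxx.
rewrite mul1r big1 ?addr0 // => t ts.
have [i ti] : exists i, t i != s i.
  apply/existsP; rewrite -negb_forall; apply: contra ts => /forallP E.
  by apply/eqP/ffunP => i; apply/eqP.
by rewrite (bigD1 i) //= ffunE co_bas eq_sym (negPf ti) !mul0r.
Qed.

Lemma multilinear_mext n (f : cochain A n) : multilinear f ->
  f =1 mext (fun s => f [ffun i => bas (s i)]).
Proof.
move=> fl; apply: multilinear_ext => // [|s]; first exact: mext_multilinear.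
by rewrite mextE.
Qed.

End MultilinearBasis.

(** * The bar differential and its translation to words *)

Section BarDifferential.
Variables (k : fieldType) (A : algType k) (eps : A -> k).
Hypothesis eps_lin : forall c x y, eps (c *: x + y) = c * eps x + eps y.

Lemma cdiff_multilinear n (f : cochain A n) :
  multilinear f -> multilinear (cdiff eps f).
Proof.
move=> fl a j c x y; rewrite /cdiff.
pose lin (P : A -> k) := P (c *: x + y) = c * P x + P y.
have linD P Q : lin P -> lin Q -> lin (fun z => P z + Q z).
  by rewrite /lin => -> ->; rewrite mulrDr addrACA.
have linZ e P : lin P -> lin (fun z => e * P z).
  by rewrite /lin => ->; rewrite mulrDr mulrCA.
have lin_sum (P : 'I_n -> A -> k) : (forall i, lin (P i)) ->
    lin (fun z => \sum_i P i z).
  move=> H; rewrite /lin mulr_sumr -big_split; apply: eq_bigr => i _; exact: H.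
have lin_upd b (g : A -> A) (psi : A -> {ffun 'I_n -> A}) i :
    g (c *: x + y) = c *: g x + g y -> (forall z, psi z = upd b i (g z)) ->
    lin (fun z => f (psi z)).
  by move=> gl E; rewrite /lin !E gl fl.
pose P1 z := eps (upd a j z ord0) * f [ffun i => upd a j z (lift ord0 i)].
pose P2 z := \sum_(i < n) (-1) ^+ i.+1 * f (contract i (upd a j z)).
pose P3 z := (-1) ^+ n.+1 *
  (f [ffun i => upd a j z (widen_ord (leqnSn n) i)] * eps (upd a j z ord_max)).
apply: (linD (fun z => P1 z + P2 z) P3); first apply: linD.
- have [j0|j0] := eqVneq j ord0.
    have E z : [ffun i => upd a j z (lift ord0 i)] = [ffun i => a (lift ord0 i)].
      by apply/ffunP => i; rewrite !ffunE j0 eq_sym (negPf (neq_lift _ _)).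
    by rewrite /lin /P1 !E !ffunE j0 !eqxx eps_lin mulrDl mulrA.
  have [|j' jE _] := @unlift_some _ ord0 j; first by rewrite eq_sym.
  have E z : upd a j z ord0 = a ord0 by rewrite ffunE eq_sym (negPf j0).
  have H : lin (fun z => f [ffun i => upd a j z (lift ord0 i)]).
    apply: (lin_upd [ffun i => a (lift ord0 i)] id _ j') => // z.
    by apply/ffunP => i; rewrite !ffunE jE (inj_eq lift_inj).
  by rewrite /lin /P1 !E; apply: linZ H.
- apply: (lin_sum (fun i z => (-1) ^+ i.+1 * f (contract i (upd a j z)))) => i.
  apply: (linZ _ (fun z => f (contract i (upd a j z)))).
  have jn : ((if (j <= i)%N then j : nat else j.-1) < n)%N.
    by move: (ltn_ord i) (ltn_ord j) => lti ltj; case: (leqP j i) => ji; lia.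
  (* The j-th argument enters the i-th contraction as a left factor, as a right factor, or alone;
     its position there is j up to i and j - 1 beyond. *)
  pose g z := if (j : nat) == i then z * a (lift ord0 i)
     else if (j : nat) == i.+1 then a (widen_ord (leqnSn n) i) * z else z.
  apply: (lin_upd (contract i a) g _ (Ordinal jn)) => [|z].
    rewrite /g; case: eqP => _; first by rewrite mulrDl scalerAl.
    by case: eqP => _ //; rewrite mulrDr scalerAr.
  apply/ffunP => t; rewrite !ffunE -!val_eqE /= /bump /= /g add1n.
  have E1 (m : 'I_n.+1) : m != j -> upd a j z m = a m.
    by rewrite ffunE => /negPf ->.
  have E2 (m : 'I_n.+1) : m = j -> upd a j z m = z.
    by rewrite ffunE => /eqP ->.
  case: (ltngtP t i) => ti; case: (ltngtP j i) => ji.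
  all: try (have -> : (t == j.-1 :> nat) = false by apply/eqP; lia).
  all: try (have -> : (t == j :> nat) = false by apply/eqP; lia).
  all: rewrite ?add1n; do ?[case: eqP => //= ?]; try (exfalso; lia); try by [].
have P3E z : P3 z = (-1) ^+ n.+1 * eps (upd a j z ord_max) *
    f [ffun i => upd a j z (widen_ord (leqnSn n) i)].
  by rewrite /P3 -mulrA [f _ * _]mulrC.
rewrite /lin !P3E; have [jm|jm] := ltnP j n.
  have E z : upd a j z ord_max = a ord_max.
    by rewrite ffunE -val_eqE /=; case: eqP => // e; lia.
  have H : lin (fun z => f [ffun i => upd a j z (widen_ord (leqnSn n) i)]).
    apply: (lin_upd [ffun i => a (widen_ord (leqnSn n) i)] id _ (Ordinal jm)) => // z.
    by apply/ffunP => i; rewrite !ffunE -!val_eqE.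
  by rewrite !E; apply: linZ H.
have jE : j = ord_max by apply: val_inj => /=; have := ltn_ord j; lia.
have E z : [ffun i => upd a j z (widen_ord (leqnSn n) i)] =
    [ffun i => a (widen_ord (leqnSn n) i)].
  apply/ffunP => i; rewrite !ffunE -val_eqE jE /=.
  by case: eqP => // e; have := ltn_ord i; lia.
rewrite !E !ffunE jE !eqxx eps_lin.
by ring.
Qed.

Definition star (x y : A) : A := x * y + eps x *: y + eps y *: x.

(* In characteristic 2 the two outer terms of the bar differential telescope. *)
Lemma cdiff_star n (f : cochain A n) a : 2%N \in [pchar k] -> multilinear f ->
  cdiff eps f a = \sum_(i < n) f (upd (contract i a) i
     (star (a (widen_ord (leqnSn n) i)) (a (lift ord0 i)))).
Proof.
move=> char2 fl; have addrr (x : k) : x + x = 0 by exact: addrr_pchar2.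
have sgn m : (-1 : k) ^+ m = 1 by rewrite oppr_pchar2 // expr1n.
(* g i is eps (a_i) times f at the tuple with a_i deleted. The two extra terms of [star] at place i
   are g i and g i.+1. *)
pose g (i : nat) : k := let i' : 'I_n.+1 := inord i in
  eps (a i') * f [ffun j => a (lift i' j)].
have -> : cdiff eps f a = g 0%N + \sum_(i < n) f (contract i a) + g n.
  rewrite /cdiff sgn mul1r; congr (_ + _ + _).
  - have -> : ord0 = inord 0 :> 'I_n.+1 by apply: val_inj; rewrite /= inordK.
    by [].
  - by apply: eq_bigr => i _; rewrite sgn mul1r.
  rewrite mulrC /g; have -> : inord n = ord_max :> 'I_n.+1.
    by apply: val_inj; rewrite /= inordK.
  congr (_ * f _); apply/ffunP => i; rewrite !ffunE; congr (a _).
  by apply: val_inj; rewrite /= /bump leqNgt ltn_ord.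
have E i : f (upd (contract i a) i
     (star (a (widen_ord (leqnSn n) i)) (a (lift ord0 i)))) =
   f (contract i a) + (g i + g i.+1).
  rewrite /star !multilinearD // !multilinearZ // -addrA; congr (_ + (_ + _)).
  - congr f; apply/ffunP => t; rewrite !ffunE; case: eqP => // ->.
    by rewrite ltnn.
  - have ii : inord i = widen_ord (leqnSn n) i :> 'I_n.+1.
      by apply: val_inj; rewrite /= inordK // ltnS ltnW.
    rewrite /g ii; congr (_ * f _); apply/ffunP => t; rewrite !ffunE -val_eqE /=.
    case: (ltngtP t i) => ti; last first.
    + by congr (a _); apply: val_inj; rewrite /= /bump /= ti leqnn.
    + by congr (a _); apply: val_inj; rewrite /= /bump /= (ltnW ti).
    + by congr (a _); apply: val_inj; rewrite /= /bump leqNgt ti.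
  - have ii : inord i.+1 = lift ord0 i :> 'I_n.+1.
      by apply: val_inj; rewrite /= inordK // ltnS.
    rewrite /g ii; congr (_ * f _); apply/ffunP => t; rewrite !ffunE -val_eqE /=.
    case: (ltngtP t i) => ti; last first.
    + by congr (a _); apply: val_inj; rewrite /= /bump /= ti add1n ltnn.
    + by congr (a _); apply: val_inj; rewrite /= /bump /= add1n ti.
    + by congr (a _); apply: val_inj; rewrite /= /bump add1n ltnNge (ltnW ti).
rewrite (eq_bigr _ (fun i _ => E i)) big_split /=.
suff -> : \sum_(i < n) (g i + g i.+1) = g 0%N + g n by rewrite addrAC addrA addrC addrA.
elim: (n) => [|m IH]; first by rewrite big_ord0 addrr.
by rewrite big_ord_recr /= IH -addrA [g m + (_ + _)]addrA addrr add0r.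
Qed.

End BarDifferential.

Section WordTransport.
Variables (k : fieldType) (A : algType k) (eps : A -> k).
Hypothesis char2 : 2%N \in [pchar k].
Hypothesis eps_lin : forall c x y, eps (c *: x + y) = c * eps x + eps y.
Variables (L : finType) (l0 : L) (mul : L -> L -> option L).
Variables (bas : L -> A) (co : L -> A -> k).
Hypothesis expand : forall a, a = \sum_l co l a *: bas l.
Hypothesis co_lin : forall l c x y, co l (c *: x + y) = c * co l x + co l y.
Hypothesis co_bas : forall l m, co l (bas m) = (m == l)%:R.
Hypothesis star_bas : forall l m, star eps (bas l) (bas m) = oapp bas 0 (mul l m).

Definition word_of n (f : cochain A n) (s : seq L) : k :=
  if size s == n then f [ffun i : 'I_n => bas (nth l0 s i)] else 0.

Definition of_word n (G : seq L -> k) : cochain A n :=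
  mext co (fun s : {ffun 'I_n -> L} => G (codom s)).

Lemma nth_codom_ord n (s : {ffun 'I_n -> L}) (i : 'I_n) :
  nth l0 (codom s) i = s i.
Proof. by rewrite codomE (nth_map i) ?size_enum_ord // nth_ord_enum. Qed.

Lemma of_word_multilinear n G : multilinear (@of_word n G).
Proof. exact: mext_multilinear. Qed.

Lemma of_wordE n G s : size s = n ->
  @of_word n G [ffun i : 'I_n => bas (nth l0 s i)] = G s.
Proof.
move=> sn; have -> : [ffun i : 'I_n => bas (nth l0 s i)] =
    [ffun i => bas ([ffun i : 'I_n => nth l0 s i] i)].
  by apply/ffunP => i; rewrite !ffunE.
rewrite /of_word mextE //; congr G; apply: (@eq_from_nth _ l0).
  by rewrite size_codom card_ord.
move=> i; rewrite size_codom card_ord => lti.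
by rewrite (nth_codom_ord _ (Ordinal lti)) ffunE.
Qed.

Lemma eq_on_words n (f g : cochain A n) : multilinear f -> multilinear g ->
  (forall s, size s = n -> f [ffun i : 'I_n => bas (nth l0 s i)] =
                           g [ffun i : 'I_n => bas (nth l0 s i)]) -> f =1 g.
Proof.
move=> fl gl E; apply: (multilinear_ext expand) => // s.
have -> : [ffun i => bas (s i)] = [ffun i : 'I_n => bas (nth l0 (codom s) i)].
  by apply/ffunP => i; rewrite !ffunE nth_codom_ord.
by apply: E; rewrite size_codom card_ord.
Qed.

Lemma cdiff_word n (f : cochain A n) s : multilinear f -> size s = n.+1 ->
  cdiff eps f [ffun i : 'I_n.+1 => bas (nth l0 s i)] = wdiff mul (word_of f) s.
Proof.
move=> fl sn; rewrite cdiff_star // (wdiff_sum _ l0) sn /=.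
apply: eq_bigr => i _; rewrite !ffunE star_bas /= /bump /= add1n.
case: (mul _ _) => [c|] /=; last exact: multilinear0.
have st : size (take i s) = i by rewrite size_take sn; case: ltnP => //; have := ltn_ord i; lia.
have lti := ltn_ord i.
rewrite /word_of size_cat /= st size_drop sn.
have -> : (i + (n.+1 - i.+2).+1 == n)%N by apply/eqP; lia.
congr f; apply/ffunP => j; rewrite !ffunE -val_eqE /= nth_cat st.
case: ltngtP => ji; last by rewrite ji subnn.
  by rewrite nth_take // ?ffunE.
rewrite -[(j - i)%N]prednK ?subn_gt0 //= nth_drop; congr (bas (nth _ _ _)).
by rewrite /bump /=; lia.
Qed.

Lemma cdiff_of_word n G s : size s = n.+1 ->
  cdiff eps (@of_word n G) [ffun i : 'I_n.+1 => bas (nth l0 s i)] = wdiff mul G s.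
Proof.
move=> sn; rewrite cdiff_word //; last exact: of_word_multilinear.
apply: (eq_wdiff_size mul l0 (n := n)) => // t tn.
by rewrite /word_of tn eqxx of_wordE.
Qed.

Lemma word_of_cocycle n (f : cochain A n) : cocycle eps f ->
  forall s, wdiff mul (word_of f) s = 0.
Proof.
move=> [fl f0] s; have [sn|sn] := eqVneq (size s) n.+1.
  by rewrite -cdiff_word.
rewrite (wdiff_sum _ l0) big1 // => i _; case: (mul _ _) => //= c.
rewrite /word_of; case: eqP => // sz; case/eqP: sn; rewrite -sz.
have lti := ltn_ord i; rewrite size_cat /= size_drop size_take.
by case: ltnP => H; lia.
Qed.

End WordTransport.


(** * Frames *)

(* A basis 1, u, v, uv of A whose coordinate functionals are eps, fr1, fr2    *)
(* and fr3; frK says that the four elements are linearly independent.         *)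
Record frame (k : fieldType) (A : algType k) (eps : A -> k) (u v : A) := Frame {
  fr1 : A -> k;
  fr2 : A -> k;
  fr3 : A -> k;
  frE : forall a, a = eps a *: 1 + fr1 a *: u + fr2 a *: v + fr3 a *: (u * v);
  frK : forall x0 x1 x2 x3, let a := x0 *: 1 + x1 *: u + x2 *: v + x3 *: (u * v) in
    [/\ eps a = x0, fr1 a = x1, fr2 a = x2 & fr3 a = x3];
  fr_uu : u * u = 0;
  fr_vv : v * v = 0;
  fr_vu : v * u = u * v
}.

Section FrameTheory.
Variables (k : fieldType) (A : algType k) (eps : A -> k) (u v : A).
Variable fr : frame eps u v.

Definition letter (l : bool * bool) : A :=
  match l with
  | (false, false) => 1 | (true, false) => u
  | (false, true) => v | (true, true) => u * v
  end.

Definition coletter (l : bool * bool) : A -> k :=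
  match l with
  | (false, false) => eps | (true, false) => fr1 fr
  | (false, true) => fr2 fr | (true, true) => fr3 fr
  end.

Lemma big_letter (V : nmodType) (F : bool * bool -> V) :
  \sum_l F l = F (false, false) + F (true, false) + F (false, true) + F (true, true).
Proof.
rewrite (bigD1 (false, false)) //= (bigD1 (true, false)) //=.
rewrite (bigD1 (false, true)) //= (bigD1 (true, true)) //= big1 ?addr0 ?addrA //.
by case=> [[] []].
Qed.

Lemma letter_expand a : a = \sum_l coletter l a *: letter l.
Proof. by rewrite big_letter; apply: frE. Qed.

Lemma coletterK (x : bool * bool -> k) l :
  coletter l (\sum_m x m *: letter m) = x l.
Proof.
rewrite big_letter /=.
have [? ? ? ?] := frK fr (x (false, false)) (x (true, false)) (x (false, true)) (x (true, true)).
by case: l => [[] []].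
Qed.

Lemma coletter_lin l c x y : coletter l (c *: x + y) = c * coletter l x + coletter l y.
Proof.
rewrite {1}(letter_expand x) {1}(letter_expand y) scaler_sumr -big_split /=.
under eq_bigr => m _ do rewrite scalerA -scalerDl.
by rewrite (coletterK (fun m => c * coletter m x + coletter m y)).
Qed.

Lemma coletter_letter l m : coletter l (letter m) = (m == l)%:R.
Proof.
rewrite -(coletterK (fun l => (m == l)%:R) l); congr coletter.
rewrite (bigD1 m) //= eqxx scale1r big1 ?addr0 // => i.
by rewrite eq_sym => /negPf ->; rewrite scale0r.
Qed.

Lemma coletterZ l c x : coletter l (c *: x) = c * coletter l x.
Proof.
have l0 : coletter l 0 = 0.
  by have := coletter_lin l (-1) 0 0; rewrite scaler0 addr0 mulN1r addNr.
by rewrite -[c *: x]addr0 coletter_lin l0 !addr0.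
Qed.

Lemma fr_uw : u * (u * v) = 0.
Proof. by rewrite mulrA (fr_uu fr) mul0r. Qed.

Lemma fr_vw : v * (u * v) = 0.
Proof. by rewrite mulrA (fr_vu fr) -mulrA (fr_vv fr) mulr0. Qed.

Lemma fr_wu : u * v * u = 0.
Proof. by rewrite -mulrA (fr_vu fr) fr_uw. Qed.

Lemma fr_wv : u * v * v = 0.
Proof. by rewrite -mulrA (fr_vv fr) mulr0. Qed.

Lemma fr_ww : u * v * (u * v) = 0.
Proof. by rewrite -mulrA fr_vw mulr0. Qed.

Definition fr_mulE :=
  (fr_uw, fr_vw, fr_wu, fr_wv, fr_ww, fr_uu fr, fr_vv fr, fr_vu fr).

Lemma star_letter (char2 : 2%N \in [pchar k]) l m :
  star eps (letter l) (letter m) = oapp letter 0 (mul_uv l m).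
Proof.
have addrr (x : A) : x + x = 0.
  by rewrite -mulr2n -[x]scale1r -scaler_nat scalerA mulr1 (pcharf0 char2) scale0r.
have E w : eps (letter w) = (w == (false, false))%:R.
  exact: (coletter_letter (false, false) w).
rewrite /star !E; case: l m => [[] []] [[] []] /=;
  by rewrite ?fr_mulE ?scale0r ?scale1r ?addr0 ?mul1r ?mulr1 ?addrr ?add0r.
Qed.

End FrameTheory.

(** * The algebra K[t]/t^2 *)

Section TruncPoly.
Variable K : fieldType.
Local Notation R := (trunc_poly K 2).
Implicit Types x y : R.

Definition trunc_t : R := 'qX.
Definition trunc_1 x : K := (x : {poly K})`_1.

Let mkX2 : mk_monic ('X^2 : {poly K}) = 'X^2.
Proof. by rewrite /mk_monic size_polyXn monicXn. Qed.

Lemma trunc_polyE x : (x : {poly K}) = (trunc_eps x)%:P + trunc_1 x *: 'X.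
Proof.
have s2 : (size (x : {poly K}) <= 2)%N.
  by apply: leq_trans (size_npoly x) _; rewrite mkX2 size_polyXn.
apply/polyP => -[|[|i]]; rewrite coefD coefC coefZ coefX /=.
- by rewrite mulr0 addr0.
- by rewrite mulr1 add0r.
by rewrite mulr0 addr0 nth_default // (leq_trans s2).
Qed.

Lemma trunc_tE : (trunc_t : {poly K}) = 'X.
Proof. by rewrite qpolyXE ?monicXn ?size_polyXn. Qed.

Lemma trunc_expand x : x = trunc_eps x *: 1 + trunc_1 x *: trunc_t.
Proof.
apply: val_inj; rewrite /= -[RHS]/(_ *: 1%:P + _ *: (trunc_t : {poly K})).
by rewrite trunc_tE alg_polyC -trunc_polyE.
Qed.

Lemma trunc_eps_lin c x y : trunc_eps (c *: x + y) = c * trunc_eps x + trunc_eps y.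
Proof. by rewrite /trunc_eps coefD coefZ. Qed.

Lemma trunc_1_lin c x y : trunc_1 (c *: x + y) = c * trunc_1 x + trunc_1 y.
Proof. by rewrite /trunc_1 coefD coefZ. Qed.

Lemma trunc_eps1 : trunc_eps (1 : R) = 1. Proof. by rewrite /trunc_eps coefC. Qed.
Lemma trunc_11 : trunc_1 1 = 0. Proof. by rewrite /trunc_1 coefC. Qed.
Lemma trunc_eps_t : trunc_eps trunc_t = 0.
Proof. by rewrite /trunc_eps trunc_tE coefX. Qed.
Lemma trunc_1_t : trunc_1 trunc_t = 1.
Proof. by rewrite /trunc_1 trunc_tE coefX. Qed.

Lemma trunc_tt : trunc_t * trunc_t = 0.
Proof.
rewrite /trunc_t /qpolyX -in_qpolyM; apply: val_inj => /=.
by rewrite mkX2 -expr2 Pdiv.RingMonic.rmodpp // monicXn.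
Qed.

Definition trunc_letter (b : bool) : R := if b then trunc_t else 1.
Definition trunc_coletter (b : bool) : R -> K := if b then trunc_1 else @trunc_eps K 2.

(** The cohomology is one-dimensional in each degree and detected at (t, ..., t), the only words the
    homotopy [hT] leaves over. *)
Lemma trunc_coboundary (char2 : 2%N \in [pchar K]) n (f : cochain R n) :
  cocycle (@trunc_eps K 2) f -> f [ffun=> trunc_t] = 0 ->
  coboundary (@trunc_eps K 2) f.
Proof.
have ex a : a = \sum_l trunc_coletter l a *: trunc_letter l.
  by rewrite big_bool /= addrC -trunc_expand.
have lin l c x y :
    trunc_coletter l (c *: x + y) = c * trunc_coletter l x + trunc_coletter l y.
  by case: l => /=; [apply: trunc_1_lin | apply: trunc_eps_lin].
have du l m : trunc_coletter l (trunc_letter m) = (m == l)%:R.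
  by case: l m => [] [] /=;
    rewrite ?(trunc_11, trunc_1_t, trunc_eps1, trunc_eps_t).
have st l m : star (@trunc_eps K 2) (trunc_letter l) (trunc_letter m) =
    oapp trunc_letter 0 (mul_t l m).
  have addrr (x : R) : x + x = 0.
    by rewrite -mulr2n -[x]scale1r -scaler_nat scalerA mulr1 (pcharf0 char2) scale0r.
  rewrite /star; case: l m => [] [] /=; rewrite ?(trunc_eps1, trunc_eps_t) ?trunc_tt;
    by rewrite ?mulr1 ?mul1r ?scale0r ?scale1r ?addr0 ?addrr ?add0r.
case: n f => [|n] f.
  by move=> _ f0 a; rewrite -f0; congr f; apply/ffunP => -[].
move=> fc f0; have fl := fc.1.
pose F := word_of false trunc_letter f.
exists (of_word trunc_coletter (n := n) (hT F)); first exact: of_word_multilinear.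
apply: (eq_on_words (l0 := false) ex) => [//||s sn].
  by apply: cdiff_multilinear; [exact: trunc_eps_lin | exact: of_word_multilinear].
  have -> : f [ffun i : 'I_n.+1 => trunc_letter (nth false s i)] = F s.
    by rewrite /F /word_of sn eqxx.
  rewrite (cdiff_of_word char2 false lin du st) //.
apply: (word_coboundary_trunc char2) => [t|[|b t] // _ tt|]; last by rewrite sn.
  exact: (word_of_cocycle char2 false st fc).
rewrite /F /word_of; case: eqP => // tn; rewrite -[RHS]f0; congr f.
apply/ffunP => i; rewrite !ffunE /trunc_letter.
by move/all_nthP: tt => ->; rewrite ?tn.
Qed.

End TruncPoly.


(** * Points *)

Section CupWords.
Variables (k : fieldType) (L : Type) (mul : L -> L -> option L).
Implicit Types (F G : seq L -> k).

Definition wcup m F G s := F (take m s) * G (drop m s).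

(** A contraction at a place i < m happens within the first m + 1 letters, and one at i >= m within
    the letters from m on, so there is no cross term. *)
Lemma wdiff_cup m F G s :
  wdiff mul (wcup m F G) s =
    wdiff mul F (take m.+1 s) * G (drop m.+1 s)
    + F (take m s) * wdiff mul G (drop m s).
Proof.
elim: m F s => [|m IH] F s.
  rewrite take0 drop0; have -> : wdiff mul F (take 1 s) = 0 by case: s => [|a s] //=; rewrite take0.
  rewrite mul0r add0r -wdiffZ; apply: eq_wdiff => t.
  by rewrite /wcup take0 drop0.
case: s => [|a [|b s]]; [by rewrite /= mul0r mulr0 addr0 | |].
  by rewrite /= mul0r mulr0 addr0.
rewrite wdiff_cons -/(wcons _ a).
have E : wcons (wcup m.+1 F G) a =1 wcup m (wcons F a) G by [].
rewrite (eq_wdiff _ _ E) IH [take m.+2 _]/= [drop m.+2 _]/= !wdiff_cons mulrDl.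
rewrite -!addrA; congr (_ + (_ + _)).
by case: (mul a b) => /=; rewrite ?mul0r.
Qed.

End CupWords.

Section FramePoint.
Variables (k : fieldType) (char2 : 2%N \in [pchar k]).
Variables (A : algType k) (eps : A -> k) (u v : A) (fr : frame eps u v).

Local Notation bas := (letter u v).
Local Notation co := (coletter fr).
Local Notation l0 := (false, false).
Local Notation word n s := [ffun i : 'I_n => bas (nth l0 s i)].

Let eps_lin c x y : eps (c *: x + y) = c * eps x + eps y.
Proof. exact: (coletter_lin fr (false, false)). Qed.
Let expand := letter_expand fr.
Let co_lin := coletter_lin fr.
Let co_bas := coletter_letter fr.
Let star_bas := star_letter fr char2.

Lemma cdiff_frame_word n (f : cochain A n) s : multilinear f -> size s = n.+1 ->
  cdiff eps f (word n.+1 s) = wdiff mul_uv (word_of l0 bas f) s.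
Proof. exact: cdiff_word. Qed.

Lemma cocycle_words n (f : cochain A n) : multilinear f ->
  (forall s, size s = n.+1 -> wdiff mul_uv (word_of l0 bas f) s = 0) ->
  cocycle eps f.
Proof.
move=> fl f0; split=> //.
apply: (eq_on_words (l0 := l0) expand) => [||s sn].
- exact: cdiff_multilinear.
- by move=> a i c x y; rewrite mulr0 addr0.
by rewrite cdiff_frame_word // f0.
Qed.

Lemma cocycle_word_of n (f : cochain A n) : cocycle eps f ->
  forall s, wdiff mul_uv (word_of l0 bas f) s = 0.
Proof. exact: word_of_cocycle. Qed.

Lemma eq_multilinear n (f g : cochain A n) : f =1 g -> multilinear f -> multilinear g.
Proof. by move=> E fl a i c x y; rewrite -!E. Qed.

Lemma eq_cdiff n (f g : cochain A n) : f =1 g -> cdiff eps f =1 cdiff eps g.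
Proof.
by move=> E a; rewrite /cdiff !E; congr (_ + _ + _); apply: eq_bigr => i _; rewrite E.
Qed.

Lemma eq_cocycle n (f g : cochain A n) : f =1 g -> cocycle eps f -> cocycle eps g.
Proof.
move=> E [fl f0]; split=> [|a]; first exact: eq_multilinear fl.
by rewrite -(eq_cdiff E).
Qed.

Lemma cocycleD n (f g : cochain A n) : cocycle eps f -> cocycle eps g ->
  cocycle eps (fun a => f a + g a).
Proof.
move=> fc gc; apply: cocycle_words => [|s sn].
  by move=> a i c x y; rewrite fc.1 gc.1; ring.
rewrite (eq_wdiff _ _ (G := fun t => word_of l0 bas f t + word_of l0 bas g t)) => [|t].
  by rewrite wdiffD !cocycle_word_of // addr0.
by rewrite /word_of; case: eqP; rewrite ?addr0.
Qed.

Lemma cocycleZ n (f : cochain A n) x : cocycle eps f ->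
  cocycle eps (fun a => x * f a).
Proof.
move=> fc; apply: cocycle_words => [|s sn].
  by move=> a i c y z; rewrite fc.1; ring.
rewrite (eq_wdiff _ _ (G := fun t => x * word_of l0 bas f t)) => [|t].
  by rewrite wdiffZ !cocycle_word_of // mulr0.
by rewrite /word_of; case: eqP; rewrite ?mulr0.
Qed.

Lemma cocycle_cdiff n (f : cochain A n) : multilinear f -> cocycle eps (cdiff eps f).
Proof.
move=> fl; apply: cocycle_words => [|s sn]; first exact: cdiff_multilinear.
rewrite (eq_wdiff_size mul_uv l0 (n := n.+1)
  (G := wdiff mul_uv (word_of l0 bas f))) => [|t tn|//].
  by apply: wdiff_wdiff; [exact: addrr_pchar2 | exact: mul_uvA].
by rewrite {1}/word_of tn eqxx cdiff_frame_word.
Qed.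

Lemma cocycle_coboundary n (f : cochain A n) : coboundary eps f -> cocycle eps f.
Proof.
case: n f => [|n] f /=; last first.
  case=> h hl E; apply: eq_cocycle (cocycle_cdiff hl) => a; exact/esym/E.
move=> E; apply: (@eq_cocycle _ (fun=> 0)) => [a|]; first by rewrite E.
apply: cocycle_words => [a i c x y|s sn]; first by rewrite mulr0 addr0.
by rewrite (eq_wdiff _ _ (G := fun=> 0)) ?wdiff0 // => t; rewrite /word_of; case: eqP.
Qed.

Lemma cup_multilinear m n (f : cochain A m) (g : cochain A n) :
  multilinear f -> multilinear g -> multilinear (cup f g).
Proof.
move=> fl gl a i c x y; rewrite /cup.
have [j ji|j ji] := splitP i.
  have -> : i = lshift n j by exact: val_inj.
  have El z : [ffun t => upd a (lshift n j) z (lshift n t)] =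
      upd [ffun t => a (lshift n t)] j z.
    by apply/ffunP => t; rewrite !ffunE (inj_eq (@lshift_inj _ _)).
  have Er z : [ffun t => upd a (lshift n j) z (rshift m t)] = [ffun t => a (rshift m t)].
    by apply/ffunP => t; rewrite !ffunE eq_sym eq_lrshift.
  by rewrite !El !Er fl; ring.
have -> : i = rshift m j by exact: val_inj.
have El z : [ffun t => upd a (rshift m j) z (rshift m t)] =
    upd [ffun t => a (rshift m t)] j z.
  by apply/ffunP => t; rewrite !ffunE (inj_eq (@rshift_inj _ _)).
have Er z : [ffun t => upd a (rshift m j) z (lshift n t)] = [ffun t => a (lshift n t)].
  by apply/ffunP => t; rewrite !ffunE eq_lrshift.
by rewrite !El !Er gl; ring.
Qed.

Lemma cup_word m n (f : cochain A m) (g : cochain A n) s : size s = (m + n)%N ->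
  cup f g (word (m + n) s) = wcup m (word_of l0 bas f) (word_of l0 bas g) s.
Proof.
move=> sn; rewrite /wcup /word_of size_drop size_take sn addKn eqxx.
have -> : ((if (m < m + n)%N then m else m + n)%N == m).
  by case: ltnP => // H; apply/eqP; lia.
congr (f _ * g _); apply/ffunP => i; rewrite !ffunE /= ?nth_take //.
by rewrite nth_drop.
Qed.

Lemma cocycle_cup m n (f : cochain A m) (g : cochain A n) :
  cocycle eps f -> cocycle eps g -> cocycle eps (cup f g).
Proof.
move=> fc gc; apply: cocycle_words => [|s sn].
  by apply: cup_multilinear; [exact: fc.1 | exact: gc.1].
rewrite (eq_wdiff_size mul_uv l0 (n := m + n)
  (G := wcup m (word_of l0 bas f) (word_of l0 bas g))) => [|t tn|//].
  by rewrite wdiff_cup !cocycle_word_of // mul0r mulr0 addr0.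
by rewrite {1}/word_of tn eqxx cup_word.
Qed.

Definition coch1 (c : A -> k) : cochain A 1 := fun a => c (a ord0).

Lemma cocycle_co l : l != (false, false) -> l != (true, true) ->
  cocycle eps (coch1 (co l)).
Proof.
move=> l1 l2; apply: cocycle_words => [a i c x y|].
  by rewrite (ord1 i) /coch1 !ffunE eqxx; exact: co_lin.
case=> [|a [|b [|]]] // _; rewrite /= addr0.
case ab: (mul_uv a b) => [c|] //=; rewrite /word_of /coch1 /= ffunE co_bas.
by case: eqP => // E; case: c ab E l1 l2 => [[] []] ab <- //; case: a b ab => [[] []] [[] []].
Qed.

(** Every contraction of (z, ..., z) contains [star] z z = 0. So evaluation at (z, ..., z) is well
    defined on cohomology classes. *)
Lemma cdiff_diag n (f : cochain A n) z : multilinear f -> eps z = 0 -> z * z = 0 ->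
  cdiff eps f [ffun=> z] = 0.
Proof.
move=> fl z0 zz; rewrite cdiff_star // big1 // => i _.
rewrite !ffunE /star zz z0 !scale0r !addr0; exact: multilinear0.
Qed.

(** Evaluation at (u, ..., u) is restriction of a class to k[u]/u^2; its kernel is generated by the
    class dual to v. *)
Lemma frame_cocycle_split n (f : cochain A n.+1) :
  cocycle eps f -> f [ffun=> u] = 0 ->
  exists (g G : cochain A n), [/\ cocycle eps g, multilinear G &
    f =1 (fun a => cup (coch1 (fr2 fr)) g a + cdiff eps G a)].
Proof.
move=> fc f0; pose F := word_of l0 bas f.
have [] := word_cocycle_split char2 (cocycle_word_of fc).
  move=> s s0 su; rewrite /word_of; case: eqP => // sn; rewrite -[RHS]f0; congr f.
  apply/ffunP => i; rewrite !ffunE.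
  by move/all_nthP: su => /(_ l0 i); rewrite sn => /(_ (ltn_ord i))/eqP ->.
move=> G [g [FE Dg]].
have gl : multilinear (of_word co (n := n) g) by apply: of_word_multilinear.
have Gl : multilinear (of_word co (n := n) G) by apply: of_word_multilinear.
exists (of_word co g), (of_word co G); split=> //.
  split=> //; apply: (eq_on_words (l0 := l0) expand) => [||s sn].
  - exact: cdiff_multilinear.
  - by move=> a i c x y; rewrite mulr0 addr0.
  by rewrite (cdiff_of_word char2 l0 co_lin co_bas star_bas).
apply: (eq_on_words (l0 := l0) expand) => [||s sn]; first exact: fc.1.
  move=> a i c x y; rewrite (cdiff_multilinear eps_lin Gl).
  rewrite (@cup_multilinear 1 n (coch1 (fr2 fr)) _ _ gl); first by ring.
  exact: (cocycle_co (l := (false, true)) isT isT).1.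
rewrite (cdiff_of_word char2 l0 co_lin co_bas star_bas) //.
have -> : f (word n.+1 s) = F s by rewrite /F /word_of sn eqxx.
rewrite /F FE ?sn //; congr (_ + _).
case: s sn => [|l s] // sn; have {}sn : size s = n by case: sn.
rewrite /cup /coch1 !ffunE -[fr2 _ _]/(fr2 fr (bas l)).
rewrite (co_bas (false, true) l : fr2 fr (bas l) = _).
have -> : [ffun i => word n.+1 (l :: s) (rshift 1 i)] = word n s.
  by apply/ffunP => i; rewrite !ffunE.
by rewrite of_wordE //; case: l => [[] []] /=; rewrite ?mul0r ?mul1r.
Qed.

Lemma fr_epsu : eps u = 0.
Proof. exact: (co_bas (false, false) (true, false)). Qed.

(** The point of the map k[t]/t^2 -> A with t going to u. It is prime because evaluation on the
    diagonal is multiplicative for cup products, and the class dual to u lies outside it. *)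
Definition vanish n (f : cochain A n) := cocycle eps f /\ f [ffun=> u] = 0.

Fact vanish_coboundary n (f : cochain A n) : coboundary eps f -> vanish f.
Proof.
move=> fb; split; first exact: cocycle_coboundary.
case: n f fb => [|n] f /=; first by move->.
by case=> h hl ->; apply: cdiff_diag => //; [exact: fr_epsu | exact: fr_uu fr].
Qed.

Fact vanishD n (f g : cochain A n) : vanish f -> vanish g -> vanish (fun a => f a + g a).
Proof.
move=> [fc f0] [gc g0]; split; first exact: cocycleD.
by rewrite f0 g0 addr0.
Qed.

Lemma cup_diag m n (f : cochain A m) (g : cochain A n) z :
  cup f g [ffun=> z] = f [ffun=> z] * g [ffun=> z].
Proof. by congr (f _ * g _); apply/ffunP => i; rewrite !ffunE. Qed.

Fact vanishMl m n (f : cochain A m) (g : cochain A n) :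
  cocycle eps f -> vanish g -> vanish (cup f g).
Proof. by move=> fc [gc g0]; split; [exact: cocycle_cup|rewrite cup_diag g0 mulr0]. Qed.

Fact vanishMr m n (f : cochain A m) (g : cochain A n) :
  vanish f -> cocycle eps g -> vanish (cup f g).
Proof. by move=> [fc f0] gc; split; [exact: cocycle_cup|rewrite cup_diag f0 mul0r]. Qed.

Fact vanish_prime m n (f : cochain A m) (g : cochain A n) :
  cocycle eps f -> cocycle eps g -> vanish (cup f g) -> vanish f \/ vanish g.
Proof.
move=> fc gc [_ /eqP]; rewrite cup_diag mulf_eq0 => /orP[]/eqP; by [left|right].
Qed.

Fact vanish_relevant : exists n (f : cochain A n),
  [/\ (0 < n)%N, cocycle eps f & ~ vanish f].
Proof.
exists 1%N, (coch1 (fr1 fr)); split=> //; first exact: (cocycle_co (l := (true, false))).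
case=> _ /eqP; rewrite /coch1 ffunE.
by rewrite (co_bas (true, false) (true, false) : fr1 fr u = _) oner_eq0.
Qed.

Definition frame_point : point eps :=
  @Point k A eps vanish (fun n f => @proj1 _ _) vanish_coboundary vanishD vanishMl
    vanishMr vanish_prime vanish_relevant.

End FramePoint.


Section FrameComb.
Variables (k : fieldType) (A : algType k) (eps : A -> k) (u v : A).
Variable fr : frame eps u v.
Implicit Types (x y : k).

Definition comb x0 x1 x2 x3 : A := x0 *: 1 + x1 *: u + x2 *: v + x3 *: (u * v).

Lemma comb_frE a : a = comb (eps a) (fr1 fr a) (fr2 fr a) (fr3 fr a).
Proof. exact: frE. Qed.

Lemma eps_comb x0 x1 x2 x3 : eps (comb x0 x1 x2 x3) = x0.
Proof. by have [] := frK fr x0 x1 x2 x3. Qed.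
Lemma fr1_comb x0 x1 x2 x3 : fr1 fr (comb x0 x1 x2 x3) = x1.
Proof. by have [] := frK fr x0 x1 x2 x3. Qed.
Lemma fr2_comb x0 x1 x2 x3 : fr2 fr (comb x0 x1 x2 x3) = x2.
Proof. by have [] := frK fr x0 x1 x2 x3. Qed.
Lemma fr3_comb x0 x1 x2 x3 : fr3 fr (comb x0 x1 x2 x3) = x3.
Proof. by have [] := frK fr x0 x1 x2 x3. Qed.

Definition fr_comb := (eps_comb, fr1_comb, fr2_comb, fr3_comb).

Lemma combD x0 x1 x2 x3 y0 y1 y2 y3 : comb x0 x1 x2 x3 + comb y0 y1 y2 y3 =
  comb (x0 + y0) (x1 + y1) (x2 + y2) (x3 + y3).
Proof.
rewrite /comb !scalerDl addrACA; congr (_ + _).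
by rewrite addrACA; congr (_ + _); rewrite addrACA.
Qed.

Lemma combZ c x0 x1 x2 x3 : c *: comb x0 x1 x2 x3 = comb (c * x0) (c * x1) (c * x2) (c * x3).
Proof. by rewrite /comb !scalerDr !scalerA. Qed.

Lemma comb1 : comb 1 0 0 0 = 1. Proof. by rewrite /comb !scale0r !addr0 scale1r. Qed.
Lemma combu : comb 0 1 0 0 = u.
Proof. by rewrite /comb !scale0r !addr0 scale1r add0r. Qed.
Lemma combv : comb 0 0 1 0 = v.
Proof. by rewrite /comb !scale0r !addr0 scale1r !add0r. Qed.
Lemma combw : comb 0 0 0 1 = u * v.
Proof. by rewrite /comb !scale0r scale1r !add0r. Qed.
Lemma comb0 : comb 0 0 0 0 = 0.
Proof. by rewrite /comb !scale0r !addr0. Qed.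

Lemma combM x0 x1 x2 x3 y0 y1 y2 y3 : comb x0 x1 x2 x3 * comb y0 y1 y2 y3 =
  comb (x0 * y0) (x0 * y1 + x1 * y0) (x0 * y2 + x2 * y0)
       (x0 * y3 + x3 * y0 + x1 * y2 + x2 * y1).
Proof.
have mulZ x y (a b : A) : (x *: a) * (y *: b) = (x * y) *: (a * b).
  by rewrite -scalerAl -scalerAr scalerA.
rewrite [comb y0 _ _ _]/comb !mulrDr [comb x0 _ _ _]/comb !mulrDl !mulZ.
rewrite !(fr_mulE fr) !mulr1 !mul1r !scaler0 !addr0.
have -> : (x0 * y0) *: 1 + (x1 * y0) *: u + (x2 * y0) *: v + (x3 * y0) *: (u * v) =
   comb (x0 * y0) (x1 * y0) (x2 * y0) (x3 * y0) by [].
have -> : (x0 * y1) *: u + (x2 * y1) *: (u * v) = comb 0 (x0 * y1) 0 (x2 * y1).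
  by rewrite /comb !scale0r add0r addr0.
have -> : (x0 * y2) *: v + (x1 * y2) *: (u * v) = comb 0 0 (x0 * y2) (x1 * y2).
  by rewrite /comb !scale0r !add0r.
have -> : (x0 * y3) *: (u * v) = comb 0 0 0 (x0 * y3).
  by rewrite /comb !scale0r !add0r.
by rewrite !combD; congr comb; ring.
Qed.

Lemma frame_mulC (a b : A) : a * b = b * a.
Proof. by rewrite (comb_frE a) (comb_frE b) !combM; congr comb; ring. Qed.

Lemma comb_inj x0 x1 x2 x3 y0 y1 y2 y3 : comb x0 x1 x2 x3 = comb y0 y1 y2 y3 ->
  [/\ x0 = y0, x1 = y1, x2 = y2 & x3 = y3].
Proof.
move=> E; split; [have := congr1 eps E|have := congr1 (fr1 fr) E
  |have := congr1 (fr2 fr) E|have := congr1 (fr3 fr) E]; by rewrite !fr_comb.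
Qed.

End FrameComb.

Section FrameChange.
Variables (k : fieldType) (char2 : 2%N \in [pchar k]).
Variables (A : algType k) (eps : A -> k) (u v : A) (fr : frame eps u v).

Lemma addrr2 (x : k) : x + x = 0. Proof. exact: addrr_pchar2. Qed.

Lemma addrr_alg (a : A) : a + a = 0.
Proof. by rewrite -[a]scale1r -scalerDl addrr2 scale0r. Qed.

Lemma frame_swap : {fr' : frame eps v u | fr1 fr' = fr2 fr & fr2 fr' = fr1 fr}.
Proof.
have E x0 x1 x2 x3 : x0 *: 1 + x1 *: v + x2 *: u + x3 *: (v * u) = comb u v x0 x2 x1 x3.
  by rewrite /comb (fr_vu fr) -!addrA; congr (_ + _); rewrite addrCA.
have H1 a : a = eps a *: 1 + fr2 fr a *: v + fr1 fr a *: u + fr3 fr a *: (v * u).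
  by rewrite E -comb_frE.
have H2 x0 x1 x2 x3 : let a := x0 *: 1 + x1 *: v + x2 *: u + x3 *: (v * u) in
    [/\ eps a = x0, fr2 fr a = x1, fr1 fr a = x2 & fr3 fr a = x3].
  by rewrite /= E !(fr_comb fr).
by exists (Frame H1 H2 (fr_vv fr) (fr_uu fr) (esym (fr_vu fr))).
Qed.

(** The square of a u + b v + c uv is 2ab uv, which vanishes in characteristic 2. *)
Lemma frame_lin (a b c : k) : a != 0 ->
  {fr' : frame eps (a *: u + b *: v + c *: (u * v)) v |
     (forall x, fr1 fr' x = fr1 fr x / a) /\
     (forall x, fr2 fr' x = fr2 fr x - b * fr1 fr x / a)}.
Proof.
move=> a0; set u' := (a *: u + _ + _).
have u'E : u' = comb u v 0 a b c by rewrite /comb scale0r add0r.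
have vE : v = comb u v 0 0 1 0 by rewrite combv.
have u'v : u' * v = comb u v 0 0 0 a.
  by rewrite u'E {2}vE (combM fr); congr comb; ring.
have E x0 x1 x2 x3 : x0 *: 1 + x1 *: u' + x2 *: v + x3 *: (u' * v) =
    comb u v x0 (x1 * a) (x1 * b + x2) (x1 * c + x3 * a).
  rewrite u'v -[1](comb1 u v) {2}vE u'E !combZ !combD; congr comb; ring.
have H1 x : x = eps x *: 1 + (fr1 fr x / a) *: u' + (fr2 fr x - b * fr1 fr x / a) *: v
    + ((fr3 fr x - c * fr1 fr x / a) / a) *: (u' * v).
  by rewrite E {1}[x](comb_frE fr); congr comb; field.
have H2 x0 x1 x2 x3 : let x := x0 *: 1 + x1 *: u' + x2 *: v + x3 *: (u' * v) in
    [/\ eps x = x0, fr1 fr x / a = x1, fr2 fr x - b * fr1 fr x / a = x2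
      & (fr3 fr x - c * fr1 fr x / a) / a = x3].
  by rewrite /= E !(fr_comb fr); split; [by []|field|field|field].
have u'u' : u' * u' = 0.
  rewrite u'E (combM fr) -(comb0 u v); congr comb; try ring.
  by have -> : 0 * c + c * 0 + a * b + b * a = a * b + a * b :> k; [ring|exact: addrr2].
have vu' : v * u' = u' * v by exact: frame_mulC fr _ _.
by exists (Frame H1 H2 u'u' (fr_vv fr) vu').
Qed.

End FrameChange.

Section PointFacts.
Variables (k : fieldType) (char2 : 2%N \in [pchar k]).
Variables (A : algType k) (eps : A -> k).

Lemma pset_ext (P : point eps) n (f g : cochain A n) : f =1 g -> P n f -> P n g.
Proof. by move=> /functional_extensionality ->. Qed.

Section OneFrame.
Variables (u v : A) (fr : frame eps u v).
Let Pu := frame_point char2 fr.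

Lemma pset_const0 (P : point eps) c : P 0%N (fun=> c) -> c = 0.
Proof.
move=> Pc; apply/eqP/negP => c0; have [n [f [n0 fc nPf]]] := pset_relevant P.
case: nPf; have H := psetMr Pc (cocycleZ char2 fr c^-1 fc).
apply: pset_ext H => a; rewrite /cup mulVKf; last exact/negP.
by congr f; apply/ffunP => i; rewrite ffunE; congr (a _); apply: val_inj.
Qed.

Fixpoint cupower (c : A -> k) n : cochain A n :=
  if n is m.+1 return cochain A n then cup (coch1 c) (@cupower c m) else fun=> 1.
Arguments cupower : clear implicits.

Lemma cupower_diag c n z : cupower c n [ffun=> z] = c z ^+ n.
Proof.
elim: n => [|n IH]; first by rewrite expr0.
rewrite exprS -IH /=; apply: etrans (cup_diag (coch1 c) (cupower c n) z) _.
by rewrite /coch1 ffunE.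
Qed.

Lemma cocycle_fr1 : cocycle eps (coch1 (fr1 fr)).
Proof. exact: (@cocycle_co _ char2 _ _ _ _ fr (true, false)). Qed.

Lemma cocycle_fr2 : cocycle eps (coch1 (fr2 fr)).
Proof. exact: (@cocycle_co _ char2 _ _ _ _ fr (false, true)). Qed.

Lemma cocycle_const c : cocycle eps ((fun=> c) : cochain A 0).
Proof.
split=> [a []//|a]; rewrite /cdiff big_ord0 addr0 expr1 mulN1r.
have -> : ord_max = ord0 :> 'I_1 by apply: val_inj.
by rewrite [c * _]mulrC subrr.
Qed.

Lemma cocycle_cupower n : cocycle eps (cupower (fr1 fr) n).
Proof.
by elim: n => [|n IH]; [exact: cocycle_const | exact: (cocycle_cup char2 fr cocycle_fr1 IH)].
Qed.

Lemma fr1u : fr1 fr u = 1.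
Proof. exact: (coletter_letter fr (true, false) (true, false)). Qed.
Lemma fr2u : fr2 fr u = 0.
Proof. exact: (coletter_letter fr (false, true) (true, false)). Qed.

Lemma cdiff_ext n (f g : cochain A n.+1) (G : cochain A n) : multilinear G ->
  f =1 (fun a => g a + cdiff eps G a) ->
  forall P : point eps, P n.+1 f <-> P n.+1 g.
Proof.
move=> Gl E P.
have PG : P n.+1 (cdiff eps G) by apply: pset_coboundary; exists G.
split=> H; last by apply: pset_ext (psetD H PG) => a; rewrite E.
by apply: pset_ext (psetD H PG) => a; rewrite E -addrA addrr2 // addr0.
Qed.

(** Cocycles vanishing at (u, ..., u) are multiples of the class dual to v, hence in P. Modulo them
    every cocycle of degree n is a multiple of the n-th power of the class dual to u. No such power
    lies in P: by primality P would contain that class, and then everything of positive degree. *)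
Lemma point_frameE (P : point eps) : P 1%N (coch1 (fr2 fr)) -> same_point P Pu.
Proof.
move=> P2; have sub n (f : cochain A n) : vanish eps u f -> P n f.
  case: n f => [|n] f [fc f0].
    apply: pset_coboundary => /= a; rewrite -f0; congr f; by apply/ffunP => -[].
  have [g [G [gc Gl E]]] := frame_cocycle_split char2 fr fc f0.
  by apply/(cdiff_ext Gl E); apply: psetMr P2 gc.
have nP1 : ~ P 1%N (coch1 (fr1 fr)).
  move=> P1; have [n [f [n0 fc []]]] := pset_relevant P.
  case: n f n0 fc => // n f _ fc.
  pose c := f [ffun=> u].
  have cwc := cocycleZ char2 fr c (cocycle_cupower n.+1).
  have H : P n.+1 (fun a => f a + c * cupower (fr1 fr) n.+1 a).
    apply: sub; split; first exact: (cocycleD char2 fr).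
    by rewrite cupower_diag fr1u expr1n mulr1 addrr2.
  have H1 : P n.+1 (cup (coch1 (fr1 fr)) (fun a => c * cupower (fr1 fr) n a)).
    by apply: psetMr P1 _; apply: (cocycleZ char2 fr) => //; apply: cocycle_cupower.
  apply: pset_ext (psetD H H1) => a.
  rewrite -addrA /= /cup [coch1 _ _ * (c * _)]mulrCA.
  by rewrite addrr2 // addr0.
move=> n f; split=> [Pf|]; last exact: sub.
have fc := pset_cocycle Pf; split=> //; apply/eqP/negP => /negP f0.
have nPw m : ~ P m (cupower (fr1 fr) m).
  elim: m => [/pset_const0/eqP|m IH]; first by rewrite oner_eq0.
  by move=> /(pset_prime cocycle_fr1 (cocycle_cupower m))[].
case: (nPw n); pose c := f [ffun=> u].
have H : P n (fun a => f a + c * cupower (fr1 fr) n a).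
  apply: sub; split; first by apply: (cocycleD char2 fr) => //; apply: (cocycleZ char2 fr) => //; apply: cocycle_cupower.
  by rewrite cupower_diag fr1u expr1n mulr1 addrr2.
have H2 := psetD Pf H.
have H3 := psetMl (cocycle_const c^-1) H2.
apply: (@pset_ext P (0 + n)) H3 => a; rewrite /cup.
have -> : [ffun i => a (rshift 0 i)] = a.
  by apply/ffunP => i; rewrite ffunE; congr (a _); apply: val_inj.
by rewrite addrA addrr2 // add0r mulKf.
Qed.

End OneFrame.
End PointFacts.


(** * Closed points and zeros of binary forms *)

Section BinaryForm.
Variables (k : fieldType) (A : algType k).

(* With F s the value of a multilinear cochain at the word s in x (false) and *)
(* y (true), the value of the cochain on the diagonal at x + l y is a         *)
(* polynomial in l.                                                           *)
Fixpoint form_poly (F : seq bool -> k) n : {poly k} :=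
  if n is m.+1 then
    form_poly (wcons F false) m + 'X * form_poly (wcons F true) m
  else (F [::])%:P.

Lemma size_form_poly F n : (size (form_poly F n) <= n.+1)%N.
Proof.
elim: n F => [|n IH] F /=; first exact: size_polyC_leq1.
apply: leq_trans (size_polyD _ _) _; rewrite geq_max (leq_trans (IH _)) //=.
by rewrite mulrC (leq_trans (size_polyMleq _ _)) // size_polyX addn2 /= ltnS IH.
Qed.

Lemma coef_form_poly F n : (form_poly F n)`_n = F (nseq n true).
Proof.
elim: n F => [|n IH] F /=; first by rewrite coefC.
rewrite coefD coefXM /= IH nth_default ?add0r //; exact: size_form_poly.
Qed.

Lemma horner_form_poly n (f : cochain A n) x y l : multilinear f ->
  f [ffun=> x + l *: y] =
  (form_poly (fun s => f [ffun i : 'I_n => if nth false s i then y else x]) n).[l].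
Proof.
move=> fl; pose Q w := fun i : 'I_n => if (i < size w)%N
  then (if nth false w i then y else x) else x + l *: y.
suff H r w : (size w + r)%N = n ->
    f [ffun i => Q w i] = (form_poly (fun s => f [ffun i : 'I_n =>
      if nth false (w ++ s) i then y else x]) r).[l].
  have <- : [ffun i => Q [::] i] = [ffun=> x + l *: y].
    by apply/ffunP => i; rewrite !ffunE.
  exact: H n [::] erefl.
elim: r w => [|r IH] w sw /=.
  rewrite hornerC cats0; congr f; apply/ffunP => i; rewrite !ffunE /Q.
  by rewrite -[size w]addn0 sw ltn_ord.
have ltw : (size w < n)%N by rewrite -sw -addSnnS leq_addr.
have E b : [ffun i => Q (rcons w b) i] =
    upd [ffun i => Q w i] (Ordinal ltw) (if b then y else x).
  apply/ffunP => i; rewrite !ffunE /Q size_rcons nth_rcons -val_eqE /= ltnS.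
  by case: ltngtP.
have -> : [ffun i => Q w i] = upd [ffun i => Q w i] (Ordinal ltw) (l *: y + x).
  apply/ffunP => i; rewrite !ffunE; case: eqP => // ->.
  by rewrite /Q /= ltnn addrC.
rewrite fl -(E true) -(E false) hornerD hornerM hornerX addrC.
have sr b : (size (rcons w b) + r)%N = n by rewrite size_rcons addSnnS.
by rewrite !IH //; congr (_.[l] + _ * _.[l]); congr form_poly;
  apply: functional_extensionality => s; rewrite /wcons cat_rcons.
Qed.

End BinaryForm.

Section ClosedPoint.
Variables (k : closedFieldType) (char2 : 2%N \in [pchar k]).
Variables (A : algType k) (eps : A -> k) (x y : A) (fr : frame eps x y).
Variable S : A -> Prop.
Hypotheses (Sx : S x) (Sy : S y) (SD : forall l a b, S a -> S b -> S (a + l *: b)).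

Lemma cup_split_diag n (f : cochain A n.+1) g G c z : multilinear G ->
  f =1 (fun a => cup (coch1 c) g a + cdiff eps G a) ->
  eps z = 0 -> z * z = 0 -> f [ffun=> z] = c z * g [ffun=> z].
Proof.
move=> Gl -> z0 zz; rewrite cdiff_diag // addr0.
by apply: etrans (cup_diag (coch1 c) g z) _; rewrite /coch1 ffunE.
Qed.

(* A form of positive degree over k vanishes at some line, and there the      *)
(* cocycle is divisible by a linear one.                                      *)
Lemma point_linear_form (P : point eps) n (f : cochain A n) z :
  P n f -> eps z = 0 -> z * z = 0 -> f [ffun=> z] <> 0 ->
  exists (u v : A) (fr' : frame eps u v), [/\ S u, S v & P 1%N (coch1 (fr2 fr'))].
Proof.
move=> Pf z0 zz; elim: n f Pf => [|n IH] f Pf fz.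
  case: fz; apply: (pset_const0 char2 fr (P := P)); apply: pset_ext Pf => a.
  by congr f; apply/ffunP => -[].
have fc := pset_cocycle Pf; have [fl _] := fc.
have use u v (fr' : frame eps u v) : S u -> S v -> f [ffun=> u] = 0 ->
    exists (u v : A) (fr' : frame eps u v), [/\ S u, S v & P 1%N (coch1 (fr2 fr'))].
  move=> Su Sv fu; have [g [G [gc Gl E]]] := frame_cocycle_split char2 fr' fc fu.
  have Pcg : P n.+1 (cup (coch1 (fr2 fr')) g) by apply/(cdiff_ext char2 Gl E).
  have [P2|Pg] := pset_prime (cocycle_fr2 char2 fr') gc Pcg; first by exists u, v, fr'.
  (* The element z only records that the cocycle is nonzero: f(z) is the product of the linear form
     at z and g(z), so g does not vanish at z either. *)
  apply: (IH _ Pg) => gz; apply: fz.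
  by rewrite (cup_split_diag Gl E) // gz mulr0.
pose p := form_poly (fun s => f [ffun i : 'I_n.+1 => if nth false s i then y else x]) n.+1.
have fp l : f [ffun=> x + l *: y] = p.[l] by apply: horner_form_poly.
(* A nonzero constant p has no root, but then the form of degree n + 1 vanishes at infinity, that
   is, at y. *)
have [/eqP/size_poly1P [c c0 pc]|/closed_rootP [l /rootP pl]] := eqVneq (size p) 1%N.
  have [fr' _ _] := frame_swap fr; apply: (use y x fr') => //.
  have : p`_n.+1 = 0 by rewrite pc coefC.
  rewrite coef_form_poly => <-; congr f; apply/ffunP => i.
  by rewrite !ffunE nth_nseq ltn_ord.
have [fr' _] := frame_lin char2 fr l 0 (oner_neq0 k).
by apply: (use _ _ fr') => //; rewrite scale1r scale0r addr0 ?fp //; exact: SD.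
Qed.

(** If some cocycle of P is nonzero at a square-zero z, it yields a linear form in P. Otherwise P is
    contained in every frame point; being closed it equals all of them, although those of u and v
    differ. The set S, later that of primitive elements, is stable under the changes of frame made
    here. *)
Lemma closed_point_frame (P : point eps) : closed_point P ->
  exists (u v : A) (fr' : frame eps u v),
    [/\ S u, S v & same_point P (frame_point char2 fr')].
Proof.
move=> [I IP]; have PI : forall n f, cocycle eps f -> I n f -> P n f by apply/IP.
suff [u [v [fr' [Su Sv P2]]]] : exists (u v : A) (fr' : frame eps u v),
    [/\ S u, S v & P 1%N (coch1 (fr2 fr'))].
  by exists u, v, fr'; split=> //; apply: point_frameE.
have [[n [f [z [Pf z0 zz fz]]]]|nex] := classic (exists n (f : cochain A n) z,
    [/\ P n f, eps z = 0, z * z = 0 & f [ffun=> z] <> 0]).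
  exact: point_linear_form fz.
have van u v (fr' : frame eps u v) : same_point P (frame_point char2 fr').
  apply/IP => n f fc If; split=> //; apply: NNPP => fz; case: nex.
  exists n, f, u; split=> //; [exact: PI | exact: fr_epsu fr' | exact: fr_uu fr'].
have [fr' E1 _] := frame_swap fr.
have /(van _ _ fr)[_ /eqP] : P 1%N (coch1 (fr1 fr)).
  apply/(van _ _ fr'); split; first exact: cocycle_fr1.
  rewrite /coch1 ffunE; exact: (coletter_letter fr (true, false) (false, true)).
by rewrite /coch1 ffunE fr1u oner_eq0.
Qed.

End ClosedPoint.


(** * Points over field extensions *)

Section BaseChangeFrame.
Variables (k K : fieldType) (iota : {rmorphism k -> K}) (A : falgType k).
Variables (eps : {lrmorphism A -> k^o}) (u v : A) (fr : frame eps u v).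
Local Notation AK := (bchange iota A).
Local Notation bc := (@bc k K iota A).

Definition bc_fun (c : A -> k) (x : AK) : K := bc_lift (fun a => iota (c a) : K^o) x.

Lemma bc_fun_lin c e x y : bc_fun c (e *: x + y) = e * bc_fun c x + bc_fun c y.
Proof. by rewrite /bc_fun linearP. Qed.

Lemma bc_fun_bc (c : A -> k) a : (forall e x y, c (e *: x + y) = e * c x + c y) ->
  bc_fun c (bc a) = iota (c a).
Proof.
by move=> cl; rewrite /bc_fun bc_liftE // => e x y; rewrite cl rmorphD rmorphM.
Qed.

Lemma bc_combE x0 x1 x2 x3 : bc (comb u v x0 x1 x2 x3) =
  comb (bc u) (bc v) (iota x0) (iota x1) (iota x2) (iota x3).
Proof.
have sl := bc_semilin iota (A := A).
by rewrite /comb !(semilinD sl) !(semilinZ sl) bcM.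
Qed.

Lemma bc_frame : {fr' : frame (bc_eps iota eps) (bc u) (bc v) |
  [/\ forall x, fr1 fr' x = bc_fun (fr1 fr) x, forall x, fr2 fr' x = bc_fun (fr2 fr) x
    & forall x, fr3 fr' x = bc_fun (fr3 fr) x]}.
Proof.
have l1 : forall e x y, fr1 fr (e *: x + y) = e * fr1 fr x + fr1 fr y.
  exact: coletter_lin fr (true, false).
have l2 : forall e x y, fr2 fr (e *: x + y) = e * fr2 fr x + fr2 fr y.
  exact: coletter_lin fr (false, true).
have l3 : forall e x y, fr3 fr (e *: x + y) = e * fr3 fr x + fr3 fr y.
  exact: coletter_lin fr (true, true).
have sl := bc_semilin iota (A := A).
have H1 x : x = comb (bc u) (bc v) (bc_eps iota eps x) (bc_fun (fr1 fr) x)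
    (bc_fun (fr2 fr) x) (bc_fun (fr3 fr) x).
  elim/bc_ind: x => [|x y IH IH'|c a].
  - by rewrite /bc_fun !linear0 /comb !scale0r !addr0.
  - by rewrite /bc_fun !linearD /= -combD -IH -IH'.
  rewrite /bc_fun !linearZ /= -combZ bc_epsE -!/(bc_fun _ _) !bc_fun_bc //.
  by rewrite -bc_combE -comb_frE.
have H2 x0 x1 x2 x3 : let x := comb (bc u) (bc v) x0 x1 x2 x3 in
    [/\ bc_eps iota eps x = x0, bc_fun (fr1 fr) x = x1, bc_fun (fr2 fr) x = x2
      & bc_fun (fr3 fr) x = x3].
  have bc_comb (c : A -> k) : (forall e x y, c (e *: x + y) = e * c x + c y) ->
      bc_fun c (comb (bc u) (bc v) x0 x1 x2 x3) =
      x0 * iota (c 1) + x1 * iota (c u) + x2 * iota (c v) + x3 * iota (c (u * v)).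
    move=> cl; rewrite /comb bcM -[1 : AK]/(bc 1) -!addrA !bc_fun_lin !bc_fun_bc //.
    by rewrite -[x3 *: _]addr0 bc_fun_lin bc_fun_bc // /bc_fun linear0 addr0.
  have le : forall e x y, eps (e *: x + y) = e * eps x + eps y.
    by move=> e x y; rewrite linearP.
  have val z y0 y1 y2 y3 : comb u v y0 y1 y2 y3 = z ->
      [/\ eps z = y0, fr1 fr z = y1, fr2 fr z = y2 & fr3 fr z = y3].
    by move=> <-; have := frK fr y0 y1 y2 y3.
  have [a0 a1 a2 a3] := val _ _ _ _ _ (comb1 u v).
  have [b0 b1 b2 b3] := val _ _ _ _ _ (combu u v).
  have [c0 c1 c2 c3] := val _ _ _ _ _ (combv u v).
  have [d0 d1 d2 d3] := val _ _ _ _ _ (combw u v).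
  split; first (apply: etrans (bc_comb eps le) _; rewrite a0 b0 c0 d0).
  - by rewrite rmorph0 rmorph1; ring.
  - by rewrite bc_comb // a1 b1 c1 d1 rmorph0 rmorph1; ring.
  - by rewrite bc_comb // a2 b2 c2 d2 rmorph0 rmorph1; ring.
  - by rewrite bc_comb // a3 b3 c3 d3 rmorph0 rmorph1; ring.
have bM a b : bc a * bc b = bc (a * b) by exact: bcM.
have Huu : bc u * bc u = 0 by rewrite bM (fr_uu fr) (semilin0 sl).
have Hvv : bc v * bc v = 0 by rewrite bM (fr_vv fr) (semilin0 sl).
have Hvu : bc v * bc u = bc u * bc v by rewrite !bM (fr_vu fr).
by exists (Frame H1 H2 Huu Hvv Hvu).
Qed.

End BaseChangeFrame.

Section BaseChangeCochain.
Variables (k K : fieldType) (iota : {rmorphism k -> K}) (A : falgType k).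
Hypothesis char2 : 2%N \in [pchar k].
Variables (eps : {lrmorphism A -> k^o}) (u v : A) (fr : frame eps u v).
Local Notation AK := (bchange iota A).
Local Notation bc := (@bc k K iota A).
Local Notation l0 := (false, false).

Lemma char2K : 2%N \in [pchar K].
Proof. by rewrite (fmorph_pchar iota). Qed.

Lemma bc_cochain_multilinear n (f : cochain A n) : multilinear (bc_cochain iota f).
Proof.
move=> a i c x y; rewrite /bc_cochain mulr_sumr -big_split; apply: eq_bigr => s _ /=.
have E z : \prod_j upd a i z j 0 (s j) =
    (z : 'rV_ _) 0 (s i) * \prod_(j | j != i) a j 0 (s j).
  rewrite (bigD1 i) //= ffunE eqxx; congr (_ * _).
  by apply: eq_bigr => j ji; rewrite ffunE (negPf ji).
by rewrite !E !mxE; ring.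
Qed.

Lemma bc_cochain_bc n (f : cochain A n) (a : {ffun 'I_n -> A}) : multilinear f ->
  bc_cochain iota f [ffun i => bc (a i)] = iota (f a).
Proof.
move=> fl; have ex (x : A) : x = \sum_i crd x i *: sbasis i by exact: sbasisE.
rewrite (@multilinear_mext _ A _ (@sbasis k A) (fun i x => crd x i) ex _ _ _ f fl).
- rewrite /mext /bc_cochain rmorph_sum; apply: eq_bigr => s _ /=.
  rewrite rmorphM rmorph_prod; congr (_ * _).
  by apply: eq_bigr => i _; rewrite ffunE mxE.
- by move=> i c x y; rewrite crdP.
- by move=> i j; rewrite crd_sbasis.
Qed.

Lemma bc_word_of n (f : cochain A n) s : multilinear f ->
  word_of l0 (letter (bc u) (bc v)) (bc_cochain iota f) s =
  iota (word_of l0 (letter u v) f s).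
Proof.
move=> fl; rewrite /word_of; case: eqP => _; last by rewrite rmorph0.
rewrite -bc_cochain_bc //; congr bc_cochain; apply/ffunP => i; rewrite !ffunE.
by case: nth => [[] []] //=; rewrite bcM.
Qed.

Lemma wdiff_rmorph L (mul : L -> L -> option L) (F : seq L -> k) s :
  wdiff mul (fun t => iota (F t)) s = iota (wdiff mul F s).
Proof.
elim: s F => [|a [|b s] IH] F; rewrite ?rmorph0 // !wdiff_cons rmorphD -IH.
by congr (_ + _); case: (mul a b) => //=; rewrite rmorph0.
Qed.

Lemma bc_cocycle n (f : cochain A n) : cocycle eps f ->
  cocycle (bc_eps iota eps) (bc_cochain iota f).
Proof.
have [frK _] := bc_frame iota fr; move=> fc.
apply: (cocycle_words char2K frK); first exact: bc_cochain_multilinear.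
move=> s sn; have E t := bc_word_of t fc.1; rewrite (eq_wdiff _ _ E) wdiff_rmorph.
by rewrite (cocycle_word_of char2 fr) ?rmorph0.
Qed.

Lemma bc_cochain_cup m n (f : cochain A m) (g : cochain A n) :
  multilinear f -> multilinear g ->
  bc_cochain iota (cup f g) =1 cup (bc_cochain iota f) (bc_cochain iota g).
Proof.
move=> fl gl; have [frK _] := bc_frame iota fr.
apply: (eq_on_words (l0 := l0) (letter_expand frK)).
- exact: bc_cochain_multilinear.
- by apply: cup_multilinear; exact: bc_cochain_multilinear.
move=> s sn; have E : [ffun i : 'I_(m + n) => letter (bc u) (bc v) (nth l0 s i)] =
    [ffun i => bc ([ffun i : 'I_(m + n) => letter u v (nth l0 s i)] i)].
  apply/ffunP => i; rewrite !ffunE.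
  by case: nth => [[] []] //=; rewrite bcM.
rewrite {}E bc_cochain_bc; last exact: cup_multilinear.
rewrite /cup rmorphM -!bc_cochain_bc //; congr (_ * _); [congr (bc_cochain iota f _)|congr (bc_cochain iota g _)];
  by apply/ffunP => i; rewrite !ffunE.
Qed.

Lemma cup_exp_multilinear n (f : cochain A n) m : multilinear f -> multilinear (cup_exp f m).
Proof.
by move=> fl; elim: m => [a []//|m IH]; apply: (cup_multilinear fl IH).
Qed.

Lemma bc_cup_exp_diag n (f : cochain A n) m z : multilinear f ->
  bc_cochain iota (cup_exp f m) [ffun=> z] = bc_cochain iota f [ffun=> z] ^+ m.
Proof.
move=> fl; elim: m => [|m IH].
  rewrite expr0 -(rmorph1 iota).
  apply: etrans (@bc_cochain_bc 0 (fun=> 1) [ffun=> 0] _); last by move=> a [].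
  by congr bc_cochain; apply/ffunP => -[].
rewrite exprS -IH; have ml : multilinear (cup_exp f m) by exact: cup_exp_multilinear.
by apply: etrans (bc_cochain_cup fl ml _) _; apply: cup_diag.
Qed.

Section Alpha.
Variable alpha : {lrmorphism trunc_poly K 2 -> AK}.
Local Notation t := (trunc_t K).

Lemma bc_eps_alpha x : bc_eps iota eps (alpha x) = trunc_eps x.
Proof.
rewrite {1}(trunc_expand x) !linearD !linearZ /= !rmorph1.
have -> : bc_eps iota eps (alpha t) = 0.
  have : bc_eps iota eps (alpha (t * t)) = 0 by rewrite trunc_tt !rmorph0.
  rewrite !rmorphM => /eqP; rewrite -[_ * _]/((_ : K) * (_ : K)) mulf_eq0 orbb.
  by move/eqP.
by rewrite /GRing.scale /= mulr0 mulr1 addr0.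
Qed.

Lemma pull_cocycle n (g : cochain AK n) : cocycle (bc_eps iota eps) g ->
  cocycle (@trunc_eps K 2) (pull_cochain alpha g).
Proof.
move=> [gl g0]; split=> [a i c x y|a].
  have E z : [ffun j => alpha (upd a i z j)] = upd [ffun j => alpha (a j)] i (alpha z).
    by apply/ffunP => j; rewrite !ffunE; case: eqP.
  by rewrite /pull_cochain !E linearP gl.
rewrite -(g0 [ffun j => alpha (a j)]) /cdiff /pull_cochain !ffunE !bc_eps_alpha.
congr (_ * g _ + _ + _ * (g _ * _)).
- by apply/ffunP => j; rewrite !ffunE.
- apply: eq_bigr => i _; congr (_ * g _); apply/ffunP => j; rewrite !ffunE.
  by case: ifP => _ //; case: ifP => _ //; rewrite rmorphM.
- by apply/ffunP => j; rewrite !ffunE.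
Qed.

(** Classes on K[t]/t^2 are detected at (t, ..., t) ([trunc_coboundary], [cdiff_diag]), where a cup
    power takes the power of the value; so a nilpotent class is already zero. *)
Lemma pi_idealE n (f : cochain A n) :
  pi_ideal eps alpha f <-> cocycle eps f /\ bc_cochain iota f [ffun=> alpha t] = 0.
Proof.
have pullE m (g : cochain AK m) : pull_cochain alpha g [ffun=> t] = g [ffun=> alpha t].
  by congr g; apply/ffunP => i; rewrite !ffunE.
split=> -[fc]; last first.
  move=> f0; split=> //; exists 1%N; apply: (trunc_coboundary char2K).
    apply: pull_cocycle; apply: bc_cocycle.
    exact: (cocycle_cup char2 fr fc (cocycle_const eps 1)).
  by rewrite pullE bc_cup_exp_diag ?f0 ?expr1 //; exact: fc.1.
case=> m cb; split=> //; apply/eqP.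
suff : bc_cochain iota f [ffun=> alpha t] ^+ m == 0 by rewrite expf_eq0 => /andP[].
rewrite -bc_cup_exp_diag -?pullE; last exact: fc.1.
move: (pull_cochain _ _) cb; case: (m * n)%N => [|d] g /=; first by move->.
case=> h hl ->; apply/eqP; apply: cdiff_diag => //.
- exact: char2K.
- exact: trunc_eps_t.
- exact: trunc_tt.
Qed.

Lemma pi_ideal_coch1 (c : A -> k) : cocycle eps (coch1 c) ->
  pi_ideal eps alpha (coch1 c) <-> bc_fun c (alpha t) = 0.
Proof.
move=> cc; rewrite pi_idealE.
have cl e x y : c (e *: x + y) = e * c x + c y.
  have := cc.1 [ffun=> 0] ord0 e x y; by rewrite /coch1 !ffunE eqxx.
have E x : [ffun=> x] = upd [ffun=> 0 : AK] (ord0 : 'I_1) x.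
  by apply/ffunP => i; rewrite !ffunE (ord1 i) eqxx.
have bl := bc_cochain_multilinear (coch1 c).
have -> : bc_cochain iota (coch1 c) [ffun=> alpha t] = bc_fun c (alpha t).
  elim/bc_ind: (alpha t) => [|x y IH IH'|e a].
  - by rewrite E multilinear0 // /bc_fun linear0.
  - by rewrite E multilinearD // -!E IH IH' /bc_fun linearD.
  rewrite E multilinearZ // -E /bc_fun linearZ /= -/(bc_fun c _) bc_fun_bc //.
  congr (_ * _).
  have -> : iota (c a) = iota (coch1 c [ffun=> a]) by rewrite /coch1 ffunE.
  rewrite -bc_cochain_bc; last exact: cc.1.
  by congr bc_cochain; apply/ffunP => i; rewrite !ffunE.
by split=> [[]|].
Qed.

End Alpha.
End BaseChangeCochain.


(** * Modules over the truncated polynomial algebra *)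

Section DualBasis.
Variables (R : comPzRingType) (M : lmodType R) (n : nat).
Variables (m : 'I_n -> M) (q : 'I_n -> M -> R).
Hypothesis q_lin : forall j r x y, q j (r *: x + y) = r * q j x + q j y.
Hypothesis q_expand : forall x, x = \sum_j q j x *: m j.

Lemma dual_basis_projective : projective M.
Proof.
move=> E F g f gs; have [e eE] : exists e : 'I_n -> E, forall j, g (e j) = f (m j).
  have [e eE] : exists e : {ffun 'I_n -> E}, forall j, g (e j) == f (m j).
    have ch j : exists x, g x == f (m j) by have [x <-] := gs (f (m j)); exists x.
    exists [ffun j => xchoose (ch j)] => j; rewrite ffunE; exact: (xchooseP (ch j)).
  by exists e => j; apply/eqP.
pose h x := \sum_j q j x *: e j.
have hl : linear h.
  move=> r x y; rewrite /h scaler_sumr -big_split; apply: eq_bigr => j _ /=.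
  by rewrite q_lin scalerDl scalerA.
pose H : {linear M -> E} := HB.pack h (GRing.isLinear.Build R M E *:%R h hl).
exists H => x; rewrite /= /h linear_sum [in RHS](q_expand x) linear_sum.
by apply: eq_bigr => j _; rewrite !linearZ /= eE.
Qed.

Lemma dual_basis_flat : flat M.
Proof.
move=> N N' f finj s fs Z beta [bl br bs].
have q0 j : q j 0 = 0.
  by have := q_lin j (-1) 0 0; rewrite scaler0 addr0 mulN1r addNr.
have b0l x : beta 0 x = 0 by have := bl x 0 0; rewrite !subrr.
have b0r x : beta x 0 = 0 by have := br x 0 0; rewrite !subrr.
have brN x y : beta x (- y) = - beta x y by rewrite -[- y]sub0r br b0r sub0r.
have brD x y z : beta x (y + z) = beta x y + beta x z.
  by rewrite -[in LHS](opprK z) br brN opprK.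
have blN x y : beta (- y) x = - beta y x by rewrite -[- y]sub0r bl b0l sub0r.
have blD x y z : beta (y + z) x = beta y x + beta z x.
  by rewrite -[in LHS](opprK z) bl blN opprK.
(* The functional q j reads off the j-th coordinate of an element of N (x) M. It vanishes after
   applying f, hence before, f being injective. *)
have K j : \sum_(x <- s) q j x.2 *: x.1 = 0.
  apply: finj; rewrite linear0 linear_sum /=.
  have bal : balanced (fun (n' : N') (x : M) => q j x *: n').
    split=> [x y z|y x z|r y x] /=; first by rewrite scalerBr.
      by rewrite [x - z]addrC -scaleN1r q_lin mulN1r scalerDl scaleNr addrC.
    by rewrite -[r *: x]addr0 q_lin q0 addr0 !scalerA mulrC.
  rewrite -[RHS](fs _ _ bal) big_map /=.
  by apply: eq_bigr => x _; rewrite linearZ.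
have -> : \sum_(x <- s) beta x.1 x.2 = \sum_j beta (\sum_(x <- s) q j x.2 *: x.1) (m j).
  have E1 x : beta x.1 x.2 = \sum_j beta (q j x.2 *: x.1) (m j).
    rewrite [in LHS](q_expand x.2).
    rewrite (big_morph (beta x.1) (brD x.1) (b0r x.1)).
    by apply: eq_bigr => j _; rewrite bs.
  rewrite (eq_bigr _ (fun x _ => E1 x)) exchange_big; apply: eq_bigr => j _ /=.
  by rewrite (big_morph (beta^~ (m j)) (blD (m j)) (b0l (m j))).
by rewrite big1 // => j _; rewrite K b0l.
Qed.

End DualBasis.

Section TruncModule.
Variables (K : fieldType).
Local Notation R := (trunc_poly K 2).
Local Notation t := (trunc_t K).

Lemma trunc_scale_expand (M : lmodType R) (r : R) (x : M) :
  r *: x = (trunc_eps r *: 1 : R) *: x + (trunc_1 r *: 1 : R) *: (t *: x).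
Proof. by rewrite {1}(trunc_expand r) scalerDl scalerA -scalerAl mul1r. Qed.

Section TruncDual.
Variables (M : lmodType R) (n : nat) (m : 'I_n -> M) (a b : 'I_n -> M -> K).
Hypothesis a_lin : forall j c x y, a j ((c *: 1 : R) *: x + y) = c * a j x + a j y.
Hypothesis b_lin : forall j c x y, b j ((c *: 1 : R) *: x + y) = c * b j x + b j y.
Hypothesis a_t : forall j x, a j (t *: x) = 0.
Hypothesis b_t : forall j x, b j (t *: x) = a j x.
Hypothesis ab_expand : forall x,
  x = \sum_j ((a j x *: 1 : R) *: m j + (b j x *: 1 : R) *: (t *: m j)).

(** The numbers a j x and b j x are the coordinates of x on m j and t m j; the rules for t x make q
    j linear over K[t]/t^2. *)
Let q j x : R := a j x *: 1 + b j x *: t.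

Let q_lin j r x y : q j (r *: x + y) = r * q j x + q j y.
Proof.
rewrite trunc_scale_expand -addrA /q !a_lin !b_lin a_t b_t mulr0 add0r.
have -> : r * (a j x *: 1 + b j x *: t) = (trunc_eps r * a j x) *: 1 +
    (trunc_eps r * b j x + trunc_1 r * a j x) *: t.
  rewrite {1}(trunc_expand r) mulrDl !mulrDr -!scalerAl -!scalerAr !mul1r !mulr1.
  by rewrite trunc_tt !scaler0 addr0 !scalerA scalerDl addrA.
by rewrite addrACA -!scalerDl addrA.
Qed.

Let q_expand x : x = \sum_j q j x *: m j.
Proof.
rewrite {1}(ab_expand x); apply: eq_bigr => j _.
by rewrite /q scalerDl scalerA -scalerAl mul1r.
Qed.

Lemma trunc_free_projective : projective M.
Proof. exact: dual_basis_projective q_lin q_expand. Qed.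

Lemma trunc_free_flat : flat M.
Proof. exact: dual_basis_flat q_lin q_expand. Qed.

End TruncDual.

(** M is a retract of R^n, and in R^n an element killed by t has coordinates without constant term,
    hence is divisible by t. *)
Lemma trunc_projective_exact (M : lmodType R) n (m : 'I_n -> M) :
  (forall x, exists c : 'I_n -> R, x = \sum_j c j *: m j) -> projective M ->
  forall x : M, t *: x = 0 -> exists y, x = t *: y.
Proof.
move=> gen prj; pose g (c : 'rV[R]_n) := \sum_j c 0 j *: m j.
have gl : linear g.
  move=> r x y; rewrite /g scaler_sumr -big_split; apply: eq_bigr => j _ /=.
  by rewrite !mxE scalerDl scalerA.
pose G : {linear 'rV[R]_n -> M} := HB.pack g (GRing.isLinear.Build R _ M *:%R g gl).
have [h hE] : exists h : {linear M -> 'rV[R]_n}, G \o h =1 idfun.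
  apply: (prj _ _ G idfun) => y; have [c ->] := gen y; exists (\row_j c j).
  by rewrite /= /g; apply: eq_bigr => j _; rewrite mxE.
move=> x tx; have htx : t *: h x = 0 by rewrite -linearZ tx linear0.
exists (g (\row_j (trunc_1 (h x 0 j) *: 1))).
transitivity (G (t *: \row_j (trunc_1 (h x 0 j) *: 1))); last by rewrite linearZ.
rewrite -[LHS]hE /=; congr g; apply/rowP => j.
have := congr1 (fun y : 'rV_n => y 0 j) htx; rewrite !mxE => tr.
have e0 : trunc_eps (h x 0 j) = 0.
  have := congr1 (@trunc_1 K) tr.
  rewrite {1}(trunc_expand (h x 0 j)) mulrDr -!scalerAr trunc_tt scaler0 addr0 mulr1.
  by rewrite -[_ *: t]addr0 trunc_1_lin trunc_1_t mulr1 /trunc_1 coef0 addr0.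
by rewrite {1}(trunc_expand (h x 0 j)) e0 scale0r add0r -scalerAr mulr1.
Qed.

End TruncModule.

Section TruncMap.
Variables (K : fieldType) (B : algType K) (z : B) (zz : z * z = 0).
Local Notation R := (trunc_poly K 2).

Definition trunc_map of z * z = 0 : R -> B := fun x => trunc_eps x *: 1 + trunc_1 x *: z.

Fact trunc_map_linear : linear (trunc_map zz).
Proof.
move=> c x y; rewrite /trunc_map trunc_eps_lin trunc_1_lin !scalerDl scalerDr !scalerA.
by rewrite addrACA.
Qed.
HB.instance Definition _ :=
  GRing.isLinear.Build K R B *:%R (trunc_map zz) trunc_map_linear.

Fact trunc_map_monoid : monoid_morphism (trunc_map zz).
Proof.
split=> [|x y]; first by rewrite /trunc_map trunc_eps1 trunc_11 scale1r scale0r addr0.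
have -> : x * y = (trunc_eps x * trunc_eps y) *: 1
   + ((trunc_eps x * trunc_1 y + trunc_1 x * trunc_eps y) *: trunc_t K + 0).
  rewrite {1}(trunc_expand x) {1}(trunc_expand y) mulrDl !mulrDr -!scalerAl -!scalerAr.
  by rewrite trunc_tt !mulr1 mul1r !scaler0 !addr0 !scalerA scalerDl -addrA.
rewrite /trunc_map !trunc_eps_lin !trunc_1_lin trunc_eps1 trunc_11 trunc_eps_t trunc_1_t.
have -> : trunc_eps (0 : R) = 0 by rewrite /trunc_eps coef0.
have -> : trunc_1 (0 : R) = 0 by rewrite /trunc_1 coef0.
rewrite !mulr0 !mulr1 !addr0 add0r mulrDl !mulrDr -!scalerAl -!scalerAr.
by rewrite zz !mulr1 mul1r !scaler0 !addr0 !scalerA scalerDl -addrA.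
Qed.
HB.instance Definition _ :=
  GRing.isMonoidMorphism.Build R B (trunc_map zz) trunc_map_monoid.

Lemma trunc_map_t : trunc_map zz (trunc_t K) = z.
Proof. by rewrite /trunc_map trunc_eps_t trunc_1_t scale0r scale1r add0r. Qed.

End TruncMap.


(** * Pi-points *)

Section Unipotent.
Variables (k : fieldType) (A : falgType k) (eps : {lrmorphism A -> k^o}).

Lemma tens_span_full (t : A ⊗ A) :
  t \in <<[seq (tens a b : A ⊗ A) | a <- vbasis {:A}, b <- vbasis {:A}]>>%VS.
Proof.
have [tl tr] := tens_bilin A A.
elim/tprod_ind: t => [|s t IH IH'|a b]; [exact: mem0v|exact: memvD|].
rewrite [a]sbasisE (bilin_suml _ _ _ _ (tens_bilin A A)); apply: memv_suml => i _.
rewrite [b]sbasisE (bilin_sumr _ _ _ _ (tens_bilin A A)); apply: memvZ.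
apply: memv_suml => j _; apply: memvZ; apply: memv_span.
by apply: allpairs_f; apply: mem_nth; rewrite size_tuple.
Qed.

Lemma hopf_subalg_full (H : hopf eps) : hopf_subalg H {:A}%AS.
Proof. by split=> [|u _|u _]; [exact: memvf|exact: tens_span_full|exact: memvf]. Qed.

Variables (u v : A) (fr : frame eps u v).

(** u and v act by commuting square-zero operators; applying them to a nonzero vector as long as the
    result is nonzero ends in their common kernel. *)
Lemma frame_unipotent : unipotent eps {:A}%AS.
Proof.
move=> M d0; pose S := subvs_of {:A}%AS.
pose pr (x : A) : S := vsproj {:A}%VS x.
have prK x : vsval (pr x) = x by rewrite vsprojK // memvf.
pose X := M (pr u); pose Y := M (pr v).
have M0 (x : S) : vsval x = 0 -> M x = 0.
  move=> x0; have -> : x = 0 by apply: subvs_inj; rewrite x0 linear0.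
  by rewrite linear0.
have MM (x y : S) : M x *m M y = M (x * y) by rewrite [RHS]rmorphM.
have XX : X *m X = 0 by rewrite MM M0 //= !prK (fr_uu fr).
have YY : Y *m Y = 0 by rewrite MM M0 //= !prK (fr_vv fr).
have XY : X *m Y = Y *m X.
  by rewrite !MM; congr (M _); apply: subvs_inj; rewrite /= !prK (fr_vu fr).
have [w w0] : exists w : 'cV[k]_(rdim M), w != 0.
  by exists (delta_mx (Ordinal d0) 0); apply/negP => /eqP/matrixP/(_ (Ordinal d0) 0)/eqP;
    rewrite !mxE !eqxx oner_eq0.
have [x x0 Xx] : exists2 x : 'cV[k]_(rdim M), x != 0 & X *m x = 0.
  have [Xw|Xw] := eqVneq (X *m w) 0; first by exists w.
  by exists (X *m w) => //; rewrite mulmxA XX mul0mx.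
have [y y0 [Xy Yy]] : exists2 y : 'cV[k]_(rdim M), y != 0 & X *m y = 0 /\ Y *m y = 0.
  have [Yx|Yx] := eqVneq (Y *m x) 0; first by exists x.
  by exists (Y *m x) => //; rewrite !mulmxA XY YY mul0mx -mulmxA Xx mulmx0.
exists y => // a.
have id1 : algid {:A}%AS = 1 by apply/eqP; rewrite algid_eq1 memvf.
have E : a = (eps (vsval a) : k) *: (1 : subvs_of {:A}%AS) + fr1 fr (vsval a) *: pr u
    + fr2 fr (vsval a) *: pr v + fr3 fr (vsval a) *: (pr u * pr v).
  by apply: subvs_inj; rewrite /= !prK id1; apply: frE.
rewrite {1}E !linearD !linearZ /= rmorph1 rmorphM !mulmxDl -!scalemxAl mul1mx.
by rewrite -[(_ * _) *m y]mulmxA [M (pr u) *m y]Xy [M (pr v) *m y]Yy mulmx0 !scaler0 !addr0.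
Qed.

End Unipotent.

Section FramePiPoint.
Variables (k : fieldType) (A : falgType k) (eps : {lrmorphism A -> k^o}).
Variables (H : hopf eps) (K : fieldType) (iota : {rmorphism k -> K}).
Local Notation AK := (bchange iota A).
Variables (u v : AK) (fr : frame (bc_eps iota eps) u v).
Variable alpha : {lrmorphism trunc_poly K 2 -> AK}.
Hypothesis alpha_t : alpha (trunc_t K) = u.

(** Along t -> u the algebra is free with basis 1, v. *)
Lemma frame_flat : flat (restr alpha AK^o).
Proof.
pose m (i : 'I_2) : restr alpha AK^o := if i == 0 then 1 : AK else v.
pose a (i : 'I_2) (x : restr alpha AK^o) : K := if i == 0 then bc_eps iota eps x else fr2 fr x.
pose b (i : 'I_2) (x : restr alpha AK^o) : K := if i == 0 then fr1 fr x else fr3 fr x.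
have sc (c : K) (x : restr alpha AK^o) :
    (c *: 1 : trunc_poly K 2) *: x = c *: (x : AK) :> AK.
  by rewrite -[LHS]/(alpha (c *: 1) * (x : AK)) linearZ rmorph1 -scalerAl mul1r.
have ts (x : restr alpha AK^o) : trunc_t K *: x = u * (x : AK) :> AK.
  by rewrite -[LHS]/(alpha _ * (x : AK)) alpha_t.
have ux (x : AK) : u * x = comb u v 0 (bc_eps iota eps x) 0 (fr2 fr x).
  by rewrite {1}(comb_frE fr x) -{1}(combu u v) (combM fr); congr comb; ring.
apply: (@trunc_free_flat K _ 2 m a b).
- move=> j c x y; rewrite /a sc; case: (j == 0); first exact: (coletter_lin fr (false, false)).
  exact: (coletter_lin fr (false, true)).
- move=> j c x y; rewrite /b sc; case: (j == 0); first exact: (coletter_lin fr (true, false)).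
  exact: (coletter_lin fr (true, true)).
- by move=> j x; rewrite /a ts ux !(fr_comb fr) if_same.
- by move=> j x; rewrite /a /b ts ux !(fr_comb fr).
move=> x; rewrite big_ord_recl big_ord1 !sc !ts /a /b /m /=.
by apply: etrans (frE fr x) _; rewrite mulr1 !addrA.
Qed.

(** The whole group scheme is unipotent and abelian, so it serves as the subgroup scheme through
    which alpha factors. *)
Lemma frame_pi_point : pi_point H alpha.
Proof.
split; first exact: frame_flat.
exists {:AK}%AS; split=> [|x y _ _||x].
- exact: hopf_subalg_full.
- exact: frame_mulC fr x y.
- exact: frame_unipotent fr.
- exact: memvf.
Qed.

End FramePiPoint.

(** * Supports *)

Section Support.
Variables (k : fieldType) (char2 : 2%N \in [pchar k]).
Variables (A : falgType k) (eps : {lrmorphism A -> k^o}) (H : hopf eps).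

Lemma pull_projective_exact (K : fieldType) (iota : {rmorphism k -> K})
    (alpha : {lrmorphism trunc_poly K 2 -> bchange iota A}) (V : rep A) :
  pull_projective alpha V -> forall x : 'cV[K]_(rdim V),
  bc_rep iota V (alpha (trunc_t K)) *m x = 0 ->
  exists y, x = bc_rep iota V (alpha (trunc_t K)) *m y.
Proof.
move=> prj x x0; pose M := restr alpha (rep_mod (bc_rep iota V)).
have sc (c : K) (y : M) : (c *: 1 : trunc_poly K 2) *: y = c *: (y : 'cV[K]_(rdim V)) :> 'cV_ _.
  rewrite -[LHS]/(bc_rep iota V (alpha (c *: 1)) *m y) !linearZ /= !rmorph1.
  by have [m1 _] := bc_rmx_monoid iota V; rewrite -scalemxAl m1 mul1mx.
have [|y xE] := trunc_projective_exact (M := M) (m := fun j => delta_mx j 0) _ prj x0.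
  move=> y; exists (fun j => (y : 'cV_ _) j 0 *: 1).
  rewrite {1}[y]matrix_sum_delta; apply: eq_bigr => i _.
  by rewrite big_ord1 sc.
by exists y; exact: xE.
Qed.

Section KPoint.
Variables (u v : A) (fr : frame eps u v).

Lemma frame_point_represented :
  exists (alpha : {lrmorphism trunc_poly k 2 -> bchange idfun A}),
    [/\ alpha (trunc_t k) = bc idfun u, pi_point H alpha
      & represents alpha (frame_point char2 fr)].
Proof.
have [frK _] := bc_frame idfun fr.
exists (trunc_map (fr_uu frK)); split; first exact: trunc_map_t.
  by apply: (frame_pi_point H frK); apply: trunc_map_t.
move=> n f; rewrite (pi_idealE char2 fr) /= trunc_map_t.
split=> -[fc f0]; split=> //.
  have := bc_cochain_bc idfun [ffun=> u] fc.1; rewrite f0 /= => E; rewrite -[RHS]E.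
  by congr bc_cochain; apply/ffunP => i; rewrite !ffunE.
rewrite -[LHS](bc_cochain_bc idfun [ffun=> u] fc.1) -[RHS]f0.
by congr bc_cochain; apply/ffunP => i; rewrite !ffunE.
Qed.

(** The map t -> u is a pi-point at a point other than P, so V is projective along it: the kernel of
    u is its image. *)
Lemma supported_exact (P : point eps) (V : rep A) : supported_at 2 H P V ->
  ~ same_point P (frame_point char2 fr) ->
  forall x : 'cV[k]_(rdim V), V u *m x = 0 -> exists y, x = V u *m y.
Proof.
move=> sV nP; have [alpha [at_ pa ra]] := frame_point_represented.
have prj : pull_projective alpha V.
  apply: NNPP => np; apply/nP/sV; exists k, idfun, alpha; by split.
have VE : bc_rep idfun V (alpha (trunc_t k)) = V u.
  rewrite at_ /= /bc_rmx bc_liftE => [|c x y]; first by apply/matrixP => i j; rewrite mxE.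
  by rewrite linearP map_mxD map_mxZ.
by have := pull_projective_exact prj; rewrite VE.
Qed.

End KPoint.
End Support.


(** * Comultiplications *)

Lemma linear_tlift (k : fieldType) (A B : vectType k) (V W : lmodType k)
    (f : {linear V -> W}) (beta : A -> B -> V) (t : A ⊗ B) :
  f (tlift beta t) = tlift (fun a b => f (beta a b)) t.
Proof.
rewrite /tlift linear_sum; apply: eq_bigr => i _; rewrite linear_sum.
by apply: eq_bigr => j _; rewrite linearZ.
Qed.

Lemma eq_tlift (k : fieldType) (A B : vectType k) (V : lmodType k)
    (beta gamma : A -> B -> V) (t : A ⊗ B) :
  (forall a b, beta a b = gamma a b) -> tlift beta t = tlift gamma t.
Proof. by move=> E; apply: eq_bigr => i _; apply: eq_bigr => j _; rewrite E. Qed.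

Section Convolution.
Variables (k : fieldType) (A : falgType k) (eps : {lrmorphism A -> k^o}).
Variable H : hopf eps.
Notation Delta := (comul H).

Definition functional (phi : A -> k) := forall c x y, phi (c *: x + y) = c * phi x + phi y.

Lemma functional_eps : functional eps.
Proof. by move=> c x y; rewrite linearP. Qed.

Definition pairing (phi psi : A -> k) (t : A ⊗ A) : k :=
  tlift (fun x y => phi x * psi y : k^o) t.

(** The operator (phi (x) id) Delta. These operators compose by convolution of functionals, and
    commute because Delta is cocommutative. *)
Definition left_conv (phi : A -> k) (a : A) : A :=
  tlift (fun x y => phi x *: y) (Delta a).

Lemma functionalZ phi c x : functional phi -> phi (c *: x) = c * phi x.
Proof.
move=> fp; have p0 : phi 0 = 0.
  by have := fp (-1) 0 0; rewrite scaler0 addr0 mulN1r addNr.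
by rewrite -[c *: x]addr0 fp p0 addr0.
Qed.

Lemma functionalD phi x y : functional phi -> phi (x + y) = phi x + phi y.
Proof. by move=> fp; rewrite -[x]scale1r fp mul1r scale1r. Qed.

Lemma functional_sum phi I (r : seq I) (F : I -> A) : functional phi ->
  phi (\sum_(i <- r) F i) = \sum_(i <- r) phi (F i).
Proof.
move=> fp; have p0 : phi 0 = 0.
  by have := fp (-1) 0 0; rewrite scaler0 addr0 mulN1r addNr.
by elim/big_rec2: _ => // i x y _ <-; rewrite functionalD.
Qed.

Lemma pairing_bil phi psi : functional phi -> functional psi ->
  bilinear_map (fun x y => phi x * psi y : k^o).
Proof.
move=> fp fq; split=> [b|a] c x y /=; first by rewrite fp mulrDl -mulrA.
by rewrite fq mulrDr mulrCA.
Qed.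

Lemma conv_bil phi : functional phi -> bilinear_map (fun x y : A => phi x *: y).
Proof.
move=> fp; split=> [b|a] c x y /=; first by rewrite fp scalerDl scalerA.
by rewrite scalerDr !scalerA mulrC.
Qed.

Lemma pairing_tens phi psi a b : functional phi -> functional psi ->
  pairing phi psi (tens a b) = phi a * psi b.
Proof. by move=> fp fq; rewrite /pairing tlift_tens; last exact: pairing_bil. Qed.

Lemma pairing_lin phi psi c s t :
  pairing phi psi (c *: s + t) = c * pairing phi psi s + pairing phi psi t.
Proof. by rewrite /pairing linearP. Qed.

Lemma left_conv_lin phi c x y :
  left_conv phi (c *: x + y) = c *: left_conv phi x + left_conv phi y.
Proof. by rewrite /left_conv !linearP. Qed.

Lemma conv_pairing phi psi a : functional psi ->
  psi (left_conv phi a) = pairing phi psi (Delta a).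
Proof.
move=> fp; rewrite /left_conv /pairing /tlift functional_sum //.
apply: eq_bigr => i _; rewrite functional_sum //; apply: eq_bigr => j _.
by rewrite !functionalZ.
Qed.

Lemma pairingC phi psi a : functional phi -> functional psi ->
  pairing phi psi (Delta a) = pairing psi phi (Delta a).
Proof.
move=> fp fq; rewrite -[in LHS](comulC H a).
have bil := pairing_bil fp fq.
pose f : {linear A ⊗ A -> k^o} := tlift (fun x y => phi x * psi y : k^o).
rewrite -[LHS]/(f _) linear_tlift /pairing; apply: (@eq_tlift k A A k^o) => x y.
by rewrite /f /= tlift_tens // mulrC.
Qed.

Lemma conv_eps a : left_conv eps a = a.
Proof. exact: comul_counitl. Qed.

Lemma eps_conv phi a : functional phi -> eps (left_conv phi a) = phi a.
Proof.
move=> fp; have fe := functional_eps; rewrite (conv_pairing phi a fe) pairingC //.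
by rewrite -(conv_pairing eps a fp) conv_eps.
Qed.

Lemma conv_conv phi psi a : functional phi -> functional psi ->
  left_conv psi (left_conv phi a) =
  left_conv (fun x => psi (left_conv phi x)) a.
Proof.
move=> fp fq; have bp := conv_bil fp; have bq := conv_bil fq.
pose f2 : {linear A ⊗ A -> A} := tlift (fun y z : A => psi y *: z).
have bil : bilinear_map (fun (x : A) (t : A ⊗ A) => phi x *: f2 t).
  split=> [b|b] c x y; first by rewrite fp scalerDl scalerA.
  by rewrite linearP scalerDr !scalerA mulrC.
pose f : {linear A ⊗ (A ⊗ A) -> A} := tlift (fun x t => phi x *: f2 t).
have := congr1 f (comulA H a); rewrite !linear_tlift => E.
have El : tlift (fun x y => f (tlift (fun c d => tens c (tens d y)) (Delta x))) (Delta a)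
   = left_conv (fun x => psi (left_conv phi x)) a.
  apply: eq_tlift => x y; rewrite linear_tlift (conv_pairing phi x fq) /pairing.
  have gl : linear (fun c : k^o => c *: y) by move=> c b d; rewrite scalerDl scalerA.
  pose g : {linear k^o -> A} := HB.pack (fun c : k^o => c *: y)
    (GRing.isLinear.Build k k^o A *:%R (fun c : k^o => c *: y) gl).
  rewrite -[RHS]/(g (tlift (fun c d => phi c * psi d : k^o) (Delta x))) linear_tlift.
  apply: eq_tlift => c d.
  by rewrite /f /g /= tlift_tens // /f2 /= tlift_tens // scalerA.
have Er : tlift (fun x y => f (tens x (Delta y))) (Delta a) = left_conv psi (left_conv phi a).
  pose g : {linear A -> A} := HB.pack (left_conv psi)
    (GRing.isLinear.Build k A A *:%R _ (left_conv_lin psi)).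
  rewrite -[RHS]/(g (left_conv phi a)) [in RHS]/left_conv linear_tlift.
  by apply: eq_tlift => x y; rewrite linearZ /f /= tlift_tens.
by rewrite -El -Er.
Qed.

Lemma conv_comm phi psi a : functional phi -> functional psi ->
  left_conv psi (left_conv phi a) = left_conv phi (left_conv psi a).
Proof.
move=> fp fq; rewrite !conv_conv //; apply: eq_tlift => x y.
by rewrite !conv_pairing // pairingC.
Qed.

(** Delta is multiplicative, phi (x) id is a derivation along eps (x) id, and (eps (x) id) Delta is
    the identity. *)
Lemma conv_derivation phi a b : functional phi ->
  (forall x y, phi (x * y) = eps x * phi y + phi x * eps y) ->
  left_conv phi (a * b) = left_conv phi a * b + a * left_conv phi b.
Proof.
move=> fp der; have fe := functional_eps; have bp := conv_bil fp; have be := conv_bil fe.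
pose f : {linear A ⊗ A -> A} := tlift (fun y z : A => phi y *: z).
pose e : {linear A ⊗ A -> A} := tlift (fun y z : A => eps y *: z).
have D s t : f (s * t) = f s * e t + e s * f t.
  elim/tprod_ind: s => [|s s' IH IH'|x y].
  - by rewrite mul0r !linear0 !mul0r addr0.
  - by rewrite mulrDl !linearD IH IH' !mulrDl addrACA.
  elim/tprod_ind: t => [|t t' IH IH'|x' y'].
  - by rewrite mulr0 !linear0 !mulr0 addr0.
  - by rewrite mulrDr !linearD IH IH' !mulrDr addrACA.
  rewrite tensM /f /e /= !tlift_tens // der -!scalerAl -!scalerAr !scalerA.
  by rewrite scalerDl addrC.
rewrite /left_conv rmorphM -[LHS]/(f _) D -[e (Delta b)]/(left_conv eps b) conv_eps.
by rewrite -[e (Delta a)]/(left_conv eps a) conv_eps.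
Qed.

End Convolution.


Section FrameComul.
Variables (k : fieldType) (char2 : 2%N \in [pchar k]).
Variables (A : falgType k) (eps : {lrmorphism A -> k^o}) (H : hopf eps).
Notation Delta := (comul H).
Notation L := (left_conv H).

Lemma functional_co u v (fr : frame eps u v) l : functional (coletter fr l).
Proof. exact: coletter_lin. Qed.

Section OneFrame.
Variables (u v : A) (fr : frame eps u v).
Notation co := (coletter fr).
Notation c1 := (fr1 fr).
Notation c2 := (fr2 fr).
Notation c3 := (fr3 fr).
Notation D := (L c2).

Lemma functional1 : functional c1. Proof. exact: (functional_co fr (true, false)). Qed.
Lemma functional2 : functional c2. Proof. exact: (functional_co fr (false, true)). Qed.
Lemma functional3 : functional c3. Proof. exact: (functional_co fr (true, true)). Qed.
Let F1 := functional1. Let F2 := functional2. Let F3 := functional3.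

Lemma fr2_derivation x y : c2 (x * y) = eps x * c2 y + c2 x * eps y.
Proof.
rewrite {1}(comb_frE fr x) {1}(comb_frE fr y) (combM fr) (fr2_comb fr).
by rewrite addrC mulrC addrC.
Qed.

Definition twist : k := c2 (D u).

Lemma twistE : twist = pairing c2 c2 (Delta u).
Proof. by rewrite /twist conv_pairing. Qed.

Let der a b : D (a * b) = D a * b + a * D b.
Proof. by apply: conv_derivation F2 _ => x y; exact: fr2_derivation. Qed.

Let cE := (eps_comb fr, fr1_comb fr, fr2_comb fr, fr3_comb fr).
Let val z x0 x1 x2 x3 : comb u v x0 x1 x2 x3 = z ->
  [/\ eps z = x0, c1 z = x1, c2 z = x2 & c3 z = x3].
Proof. by move=> <-; have := frK fr x0 x1 x2 x3. Qed.
Let c_1 := val (comb1 u v).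
Let c_u := val (combu u v).
Let c_v := val (combv u v).
Let c_w := val (combw u v).

Lemma conv2_1 : D 1 = 0.
Proof.
have := der 1 1; rewrite !mulr1 mul1r => E.
by apply: (addrI (D 1)); rewrite -E addr0.
Qed.

Lemma conv2_u : D u = comb u v 0 (c1 (D u)) twist (c3 (D u)).
Proof.
have [_ _ c2u _] := c_u.
by rewrite {1}(comb_frE fr (D u)) eps_conv // c2u.
Qed.

Lemma conv2_v : D v = comb u v 1 (c1 (D v)) (c2 (D v)) (c3 (D v)).
Proof.
have [_ _ c2v _] := c_v.
by rewrite {1}(comb_frE fr (D v)) eps_conv // c2v.
Qed.

Lemma conv2_w : D (u * v) = comb u v 0 1 0 (c1 (D u) + c2 (D v)).
Proof.
have -> : D (u * v) = comb u v 0 (c1 (D u)) twist (c3 (D u)) * comb u v 0 0 1 0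
   + comb u v 0 1 0 0 * comb u v 1 (c1 (D v)) (c2 (D v)) (c3 (D v)).
  by rewrite combv combu -conv2_u -conv2_v der.
by rewrite !(combM fr) combD; congr comb; ring.
Qed.

Lemma twist_w : c2 (D (u * v)) = 0.
Proof. by rewrite conv2_w cE. Qed.

(** When D u = 0, D v has augmentation 1 and D (uv) = u D v has coefficient 1 at u, so the kernel of
    D is the span of 1 and u. *)
Lemma conv_fr2_eq0 x : D u = 0 -> D x = 0 -> c2 x = 0 /\ c3 x = 0.
Proof.
move=> Du Dx; have : D x = comb u v (c2 x) (c2 x * c1 (D v) + c3 x)
    (c2 x * c2 (D v)) (c2 x * c3 (D v) + c3 x * c2 (D v)).
  have xE : x = eps x *: 1 + (c1 x *: u + (c2 x *: v + (c3 x *: (u * v) + 0))).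
    by rewrite {1}(frE fr x) addr0 !addrA.
  have D0 : D 0 = 0 by rewrite /left_conv !linear0.
  have c10 : c1 0 = 0 by rewrite -(comb0 u v) cE.
  rewrite {1}xE !left_conv_lin conv2_1 D0; move: conv2_v conv2_w; rewrite Du c10.
  move: (c1 (D v)) (c2 (D v)) (c3 (D v)) => p q r -> ->.
  by rewrite !scaler0 !add0r addr0 !combZ combD; congr comb; ring.
rewrite Dx -(comb0 u v) => /(comb_inj fr)[<- e _ _]; split=> //.
by move: e; rewrite mul0r add0r => <-.
Qed.

Lemma letter_tens_expand (t : A ⊗ A) :
  t = \sum_l \sum_m pairing (co l) (co m) t *: tens (letter u v l) (letter u v m).
Proof.
elim/tprod_ind: t => [|s t IH IH'|a b].
- by rewrite big1 // => l _; rewrite big1 // => m _; rewrite /pairing linear0 scale0r.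
- rewrite {1}IH {1}IH' -big_split; apply: eq_bigr => l _ /=; rewrite -big_split.
  by apply: eq_bigr => m _ /=; rewrite /pairing linearD scalerDl.
rewrite {1}(letter_expand fr a) (bilin_suml _ _ _ _ (tens_bilin A A)).
apply: eq_bigr => l _.
rewrite {1}(letter_expand fr b) (bilin_sumr _ _ _ _ (tens_bilin A A)).
rewrite scaler_sumr; apply: eq_bigr => m _.
by rewrite scalerA pairing_tens //; exact: functional_co.
Qed.

(** D commutes with every [left_conv] operator, so each of them sends u into the kernel of D, the
    span of 1 and u. By symmetry Delta u lies in the tensor square of that span, and the counit
    fixes all coefficients but one. *)
Lemma comul_unipotent : D u = 0 ->
  Delta u = tens 1 u + tens u 1 + c1 (L c1 u) *: tens u u.
Proof.
move=> Du; have Fe := functional_eps eps.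
have K phi : functional phi -> c2 (L phi u) = 0 /\ c3 (L phi u) = 0.
  move=> fp; apply: conv_fr2_eq0 => //.
  by rewrite conv_comm // Du /left_conv !linear0.
have [e0 e1 e2 e3] := c_u.
have Lu phi : functional phi -> L phi u = comb u v (phi u) (c1 (L phi u)) 0 0.
  by move=> fp; rewrite {1}(comb_frE fr (L phi u)) eps_conv //; have [-> ->] := K _ fp.
have P l m : pairing (co l) (co m) (Delta u) = co m (L (co l) u).
  by rewrite conv_pairing //; exact: functional_co.
have c1L phi : functional phi -> c1 (L phi u) = phi (L c1 u).
  by move=> fp; rewrite !conv_pairing // pairingC.
have L1 : L c1 u = comb u v 1 (c1 (L c1 u)) 0 0 by rewrite {1}Lu // e1.
have L3 : L c3 u = 0.
  by rewrite Lu // c1L // (K _ F1).2 e3 comb0.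
move: (c1 (L c1 u)) L1 => kap L1; rewrite (letter_tens_expand (Delta u)) !big_letter !P /=.
rewrite Du L3 conv_eps L1 !cE e0 e1 e2 e3 -(comb0 u v) !cE.
by rewrite !scale0r !scale1r !addr0 ?add0r addrA.
Qed.

(** The antipode identity is u + s + kap s u = 0. Multiplying it by u gives s u = 0, whence s = - u
    = u. *)
Lemma antip_unipotent kap : Delta u = tens 1 u + tens u 1 + kap *: tens u u ->
  antip H u = u.
Proof.
move=> Du; have [e0 _ _ _] := c_u.
have bil : bilinear_map (fun a b => antip H a * b).
  by split=> [b|b] c x y; rewrite ?linearP /= ?mulrDl ?mulrDr -?scalerAl -?scalerAr.
have S1 : antip H 1 = 1.
  have := antipl H 1; rewrite rmorph1 -[1 : A ⊗ A]/(tens 1 1) tlift_tens // rmorph1.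
  by rewrite mulr1 scale1r.
have := antipl H u; rewrite Du !linearD linearZ /= !tlift_tens // e0 scale0r S1 mul1r mulr1.
set s := antip H u => E.
have {}E : s = u * (1 + kap *: u).
  have -> : u * (1 + kap *: u) = u.
    by rewrite mulrDr mulr1 -scalerAr (fr_uu fr) scaler0 addr0.
  have : (u + s + kap *: (s * u)) * u = 0 by rewrite E mul0r.
  rewrite !mulrDl -scalerAl -mulrA (fr_uu fr) mulr0 scaler0 addr0 add0r => su.
  rewrite su scaler0 addr0 in E.
  by rewrite -[s]add0r -(addrr_alg char2 u) -addrA E addr0.
by rewrite E mulrDr mulr1 -scalerAr (fr_uu fr) scaler0 addr0.
Qed.
End OneFrame.

(* e is the coefficient of v (x) u in the comultiplication of u *)
Lemma twist0_frame u v (fr : frame eps u v) : twist fr = 0 ->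
  exists (e : k) (fr' : frame eps (u + e *: (u * v)) v),
    (forall x, fr2 fr' x = fr2 fr x) /\ L (fr2 fr') (u + e *: (u * v)) = 0.
Proof.
move=> tw.
have F2 := functional2 fr.
pose e := fr1 fr (L (fr2 fr) u); pose mu := fr3 fr (L (fr2 fr) u); pose d := fr2 fr (L (fr2 fr) v).
have Du : L (fr2 fr) u = comb u v 0 e 0 mu by rewrite conv2_u tw.
have Dw : L (fr2 fr) (u * v) = comb u v 0 1 0 (e + d) by exact: conv2_w.
(* Since c2 (D u) = 0 and c2 (D (uv)) = 0, the functional c2 D is d c2, so D D = d D by [conv_conv];
   compare the coefficients of uv in D (D u) and d D u. *)
have mu_e : e * e + mu = d * e.
  have sq x : fr2 fr (L (fr2 fr) x) = d * fr2 fr x.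
    have xE : x = eps x *: 1 + (fr1 fr x *: u + (fr2 fr x *: v + (fr3 fr x *: (u * v) + 0))).
      by rewrite {1}(frE fr x) addr0 !addrA.
    rewrite {1}xE !left_conv_lin conv2_1.
    have -> : L (fr2 fr) 0 = 0 by rewrite /left_conv !linear0.
    rewrite !F2 -[fr2 fr (L (fr2 fr) v)]/d -[fr2 fr (L (fr2 fr) u)]/(twist fr) tw [fr2 fr (L (fr2 fr) (u * v))]twist_w.
    have -> : fr2 fr 0 = 0 by rewrite -(comb0 u v) (fr2_comb fr).
    by ring.
  have := conv_conv H u F2 F2.
  have -> : L (fun x => fr2 fr (L (fr2 fr) x)) u =
      d *: L (fr2 fr) u.
    rewrite /left_conv /tlift scaler_sumr; apply: eq_bigr => i _.
    rewrite scaler_sumr; apply: eq_bigr => j _.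
    by rewrite [X in X *: sbasis j]sq !scalerA mulrCA mulrA.
  rewrite {1}Du /comb scale0r scale0r add0r addr0 -[_ + _]addr0 -addrA !left_conv_lin.
  rewrite Du Dw; have -> : L (fr2 fr) 0 = 0 by rewrite /left_conv !linear0.
  by rewrite addr0 !combZ !combD => /(comb_inj fr)[_ + _ _]; rewrite mulr1.
have [fr' [E1 E2]] := frame_lin char2 fr 0 e (oner_neq0 k).
have uE : 1 *: u + 0 *: v + e *: (u * v) = u + e *: (u * v) by rewrite scale1r scale0r addr0.
rewrite uE in fr' E1 E2.
have E3 x : fr2 fr' x = fr2 fr x by rewrite E2 !mul0r subr0.
exists e, fr'; split=> //.
have -> : L (fr2 fr') (u + e *: (u * v)) = L (fr2 fr) (u + e *: (u * v)).
  by apply: eq_tlift => x y; rewrite E3.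
(* D (u + e uv) has coefficient e + e at u and mu + e (e + d) at uv; the second vanishes by
   [mu_e]. *)
rewrite [u + _]addrC left_conv_lin Du Dw combZ combD -(comb0 u v); congr comb; try by ring.
  by rewrite mulr1 addrr2.
by rewrite mulrDr addrAC [e * d]mulrC mu_e addrr2.
Qed.

End FrameComul.


(** * Noble points and the twist *)

Section HopfSpan.
Variable k : fieldType.
Variables (A : falgType k) (eps : {lrmorphism A -> k^o}) (H : hopf eps).

Lemma tens_mem_span (U : {vspace A}) a b : a \in U -> b \in U ->
  tens a b \in <<[seq (tens x y : A ⊗ A) | x <- vbasis U, y <- vbasis U]>>%VS.
Proof.
move=> aU bU; rewrite (coord_vbasis aU) (bilin_suml _ _ _ _ (tens_bilin A A)).
apply: memv_suml => i _; apply: memvZ.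
rewrite (coord_vbasis bU) (bilin_sumr _ _ _ _ (tens_bilin A A)).
apply: memv_suml => j _; apply: memvZ; apply: memv_span.
by apply: allpairs_f; apply: mem_nth; rewrite size_tuple.
Qed.

Lemma antip1 : antip H 1 = 1.
Proof.
have bil : bilinear_map (fun a b => antip H a * b).
  by split=> [b|b] c x y; rewrite ?linearP /= ?mulrDl ?mulrDr -?scalerAl -?scalerAr.
have := antipl H 1; rewrite rmorph1 -[1 : A ⊗ A]/(tens 1 1) tlift_tens // rmorph1.
by rewrite mulr1 scale1r.
Qed.

Lemma hopf_subalg_span2 (u : A) kap : u * u = 0 ->
  comul H u = tens 1 u + tens u 1 + kap *: tens u u -> antip H u = u ->
  exists2 U : {aspace A}, hopf_subalg H U
    & forall y, y \in U <-> exists a b : k, y = a *: 1 + b *: u.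
Proof.
move=> uu Du Su; pose U : {vspace A} := (<[1]> + <[u]>)%VS.
have UP y : y \in U <-> exists a b : k, y = a *: 1 + b *: u.
  split=> [/memv_addP[_ /vlineP[a ->] [_ /vlineP[b ->] ->]]|[a [b ->]]].
    by exists a, b.
  by apply: memv_add; apply: memvZ; apply: memv_line.
have U1 : 1 \in U by apply/UP; exists 1, 0; rewrite scale1r scale0r addr0.
have Uu : u \in U by apply/UP; exists 0, 1; rewrite scale1r scale0r add0r.
have asU : is_aspace U.
  apply/andP; split; first exact: has_algid1.
  apply/prodvP => x y /UP[a [b ->]] /UP[c [d ->]]; apply/UP.
  exists (a * c), (a * d + b * c); rewrite mulrDl !mulrDr -!scalerAl -!scalerAr uu.
  by rewrite !mulr1 !mul1r !scaler0 addr0 !scalerA scalerDl addrA.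
exists (ASpace asU) => //; split=> // x /UP[a [b ->]].
  rewrite linearD !linearZ /= rmorph1 Du.
  by apply: memvD; apply: memvZ; [|apply: memvD; [apply: memvD|apply: memvZ]];
    apply: tens_mem_span.
by rewrite linearD !linearZ /= antip1 Su; apply/UP; exists a, b.
Qed.

End HopfSpan.

Section Noble.
Variables (k : fieldType) (char2 : 2%N \in [pchar k]).
Variables (A : falgType k) (eps : {lrmorphism A -> k^o}) (H : hopf eps).
Variables (u v : A) (fr : frame eps u v).

(** The corrected generator u + e uv still represents P, and together with 1 it spans a Hopf
    subalgebra, the image of t -> u + e uv. *)
Lemma noble_of_twist (P : point eps) : same_point P (frame_point char2 fr) ->
  twist H fr = 0 -> noble 2 H P.
Proof.
move=> PE tw; have [e [fr' [E2 Du]]] := twist0_frame char2 tw.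
set u' := u + _ in fr' E2 Du.
have Delta_u := comul_unipotent Du.
have Su := antip_unipotent char2 fr' Delta_u.
have PE' : same_point P (frame_point char2 fr').
  apply: point_frameE; apply/PE; split; first exact: cocycle_fr2.
  by rewrite /coch1 ffunE E2 fr2u.
have [alpha [at_ pa ra]] := frame_point_represented char2 H fr'.
exists k, idfun, alpha; split=> //.
  by move=> n f; apply: iff_trans (PE' n f) (ra n f).
have sl := bc_semilin idfun (A := A).
have st := stens_semilin idfun (bc idfun (A := A)) (bc idfun (A := A)).
have uu : bc idfun u' * bc idfun u' = 0.
  by rewrite [LHS]bcM (fr_uu fr') (semilin0 sl).
have DK : comul (bc_hopf idfun H) (bc idfun u') =
   tens 1 (bc idfun u') + tens (bc idfun u') 1
   + fr1 fr' (left_conv H (fr1 fr') u') *: tens (bc idfun u') (bc idfun u').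
  rewrite [LHS]bc_comulE {1}Delta_u !(semilinD st) (semilinZ st).
  by rewrite !bct_tens.
have SK : antip (bc_hopf idfun H) (bc idfun u') = bc idfun u'.
  by rewrite [LHS]bc_antipE Su.
have [U hU UE] := hopf_subalg_span2 uu DK SK.
exists U => // y; split=> [/UE[a [b ->]]|[x <-]].
  by exists (a *: 1 + b *: trunc_t k); rewrite linearD !linearZ /= rmorph1 at_.
apply/UE; exists (trunc_eps x), (trunc_1 x).
by rewrite {1}(trunc_expand x) linearD !linearZ /= rmorph1 at_.
Qed.

(** As alpha represents P, alpha t = y1 u + y3 uv with y1 nonzero. Its Hopf image U is killed by c2,
    so c2 (x) c2 kills the comultiplication of alpha t; this value is y1 times the twist, because uv
    contributes 0 ([twist_w]). *)
Lemma twist_of_noble (P : point eps) : same_point P (frame_point char2 fr) ->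
  noble 2 H P -> twist H fr = 0.
Proof.
move=> PE [K [iota [alpha [_ ra [U [_ hU _] UE]]]]].
have [frK [K1 K2 K3]] := bc_frame iota fr.
pose y := alpha (trunc_t K).
have y2 : bc_fun (fr2 fr) y = 0.
  apply/(pi_ideal_coch1 char2 fr alpha (cocycle_fr2 char2 fr)); apply/ra/PE.
  by split; [exact: cocycle_fr2|rewrite /coch1 ffunE fr2u].
have y1 : bc_fun (fr1 fr) y <> 0.
  move=> /(pi_ideal_coch1 char2 fr alpha (cocycle_fr1 char2 fr)) /ra /PE [_ /eqP].
  by rewrite /coch1 ffunE fr1u oner_eq0.
have F2 := functional2 fr.
have FK : functional (bc_fun (iota := iota) (fr2 fr)) by exact: bc_fun_lin.
have U0 x : x \in U -> bc_fun (fr2 fr) x = 0.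
  move=> /UE[r <-]; rewrite (trunc_expand r) linearD !linearZ /= rmorph1.
  rewrite FK functionalZ // y2 mulr0 addr0 -K2.
  by rewrite -(comb1 (bc iota u) (bc iota v)) (fr2_comb frK) mulr0.
pose X := [seq (tens a b : bchange iota A ⊗ bchange iota A) |
    a <- vbasis U, b <- vbasis U].
have pairX t : t \in X -> pairing (bc_fun (fr2 fr)) (bc_fun (fr2 fr)) t = 0.
  move=> /allpairsP[[a b] /= [aU bU ->]]; rewrite pairing_tens //.
  by rewrite U0 ?mul0r //; apply: vbasis_mem.
have pair0 t : t \in <<X>>%VS -> pairing (bc_fun (fr2 fr)) (bc_fun (fr2 fr)) t = 0.
  move=> tX; rewrite (@coord_span _ _ _ (in_tuple X) t tX) /pairing linear_sum big1 // => i _.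
  rewrite linearZ /= -/(pairing _ _ _) pairX ?scaler0 //; exact: mem_nth.
have bctE (t : A ⊗ A) : pairing (bc_fun (fr2 fr)) (bc_fun (fr2 fr)) (stens iota (bc iota (A := A)) (bc iota (A := A)) t) =
    iota (pairing (fr2 fr) (fr2 fr) t).
  have sl : semilin iota (fun x : k^o => iota x : K^o).
    by move=> c a b; rewrite rmorphD rmorphM.
  apply: (@bct_lift k K iota A k^o K^o _ _ _ t sl).
  - exact: pairing_bil.
  - exact: pairing_bil.
  by move=> a b; rewrite !bc_fun_bc // rmorphM.
have yU : y \in U by apply/UE; exists (trunc_t K).
have := pair0 _ (hU y yU).
have -> : y = bc_fun (fr1 fr) y *: bc iota u + bc_fun (fr3 fr) y *: bc iota (u * v).
  rewrite {1}(frE frK y) K1 K2 K3 y2 (bc_eps_alpha eps alpha) trunc_eps_t.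
  by rewrite !scale0r add0r addr0 bcM.
rewrite linearD !linearZ /= !bc_comulE -[_ *: _ + _]addr0 -addrA !pairing_lin.
rewrite !bctE -(conv_pairing H _ u F2) -(conv_pairing H _ (u * v) F2) twist_w.
rewrite rmorph0 mulr0 add0r /pairing linear0 addr0 => /eqP.
by rewrite mulf_eq0 => /orP[/eqP //|]; rewrite fmorph_eq0 => /eqP.
Qed.

End Noble.


(** * Nilpotent matrices *)

Section Nilpotent.
Variable k : closedFieldType.

Lemma char_poly_eigen0 n (A : 'M[k]_n) :
  (forall l, eigenvalue A l -> l = 0) -> char_poly A = 'X^n.
Proof.
move=> A0; have [r rE] := closed_field_poly_normal (char_poly A).
move: rE; rewrite (monicP (char_poly_monic A)) scale1r => rE.
have r0 z : z \in r -> z = 0.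
  move=> zr; apply: A0; rewrite eigenvalue_root_char rE.
  by rewrite root_prod_XsubC.
have rX : \prod_(z <- r) ('X - z%:P) = 'X^(size r) :> {poly k}.
  elim: r r0 {rE} => [|z r IH] r0; first by rewrite big_nil.
  rewrite big_cons IH => [|y yr]; last by apply: r0; rewrite inE yr orbT.
  by rewrite (r0 z) ?mem_head // subr0 exprS.
by have := size_char_poly A; rewrite rE rX size_polyXn => -[->].
Qed.

Lemma mxtrace_eigen0 n (A : 'M[k]_n) :
  (forall l, eigenvalue A l -> l = 0) -> \tr A = 0.
Proof.
move=> A0; case: n A A0 => [|n] A A0; first by rewrite /mxtrace big_ord0.
apply: oppr_inj; rewrite oppr0 -char_poly_trace // char_poly_eigen0 //.
by rewrite coefXn /= eqn_leq ltnn andbF.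
Qed.

Lemma nilpotent_eigen0 n (A : 'M[k]_n) m l : A ^+ m = 0 -> eigenvalue A l -> l = 0.
Proof.
move=> Am /eigenvalueP[x xA x0]; have H j : x *m (A ^+ j) = l ^+ j *: x.
  elim: j => [|j IH]; first by rewrite !expr0 scale1r mulmx1.
  by rewrite exprSr -[A ^+ j * A]/(A ^+ j *m A) mulmxA IH -scalemxAl xA scalerA -exprSr.
have /eqP := H m; rewrite Am mulmx0 eq_sym scaler_eq0 (negPf x0) orbF.
by rewrite expf_eq0 => /andP[_ /eqP].
Qed.

Lemma eigen0_nilpotent n (A : 'M[k]_n) :
  (forall l, eigenvalue A l -> l = 0) -> A ^+ n = 0.
Proof.
case: n A => [|n] A A0; first by apply/matrixP => -[].
by have := Cayley_Hamilton A; rewrite char_poly_eigen0 // rmorphXn /= horner_mx_X.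
Qed.

(** Every linear functional on matrices is a trace form. *)
Lemma mxvec_trace n (Y : 'M[k]_n) (c : 'cV[k]_(n * n)) :
  mxvec Y *m c = (\tr (Y *m (vec_mx c^T)^T))%:M.
Proof.
apply/matrixP => i j; rewrite !ord1 !mxE eqxx mulr1n /mxtrace.
rewrite (reindex _ (curry_mxvec_bij _ _)) /=.
transitivity (\sum_a \sum_b mxvec Y 0 (mxvec_index a b) * c (mxvec_index a b) 0).
  by rewrite pair_bigA /=; apply: eq_bigr => -[a b] _.
apply: eq_bigr => a _; rewrite mxE; apply: eq_bigr => b _.
by rewrite mxvecE !mxE.
Qed.

Lemma mxtrace_delta n (Z : 'M[k]_n) a b : \tr (delta_mx b a *m Z) = Z a b.
Proof.
rewrite /mxtrace (bigD1 b) //= [X in _ + X]big1 ?addr0 => [|d db].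
  rewrite mxE (bigD1 a) //= [X in _ + X]big1 ?addr0 => [|d da]; last first.
    by rewrite mxE (negPf da) andbF mul0r.
  by rewrite mxE !eqxx mul1r.
by rewrite mxE big1 // => x _; rewrite mxE (negPf db) mul0r.
Qed.

(* N lies in the image of ad N: for the trace form that image is the          *)
(* orthogonal of the centralizer of N, and N C is nilpotent when C commutes   *)
(* with N.                                                                    *)
Lemma nilpotent_ad n (N : 'M[k]_n) m : N ^+ m = 0 ->
  exists E : 'M[k]_n, E *m N - N *m E = N.
Proof.
move=> Nm; pose phi (X : 'M[k]_n) := X *m N - N *m X.
have phil : linear phi.
  by move=> c x y; rewrite /phi mulmxDl mulmxDr -scalemxAl -scalemxAr scalerBr opprD addrACA.
pose Phi : {linear 'M[k]_n -> 'M[k]_n} := HB.pack phi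
  (GRing.isLinear.Build k 'M[k]_n 'M[k]_n *:%R phi phil).
suff /submxP[X XE] : (mxvec N <= lin_mx Phi)%MS.
  exists (vec_mx X); have := mul_vec_lin Phi (vec_mx X); rewrite vec_mxK -XE.
  by move/(can_inj mxvecK).
rewrite submxE; apply/eqP/matrixP => i j; rewrite !ord1 [RHS]mxE.
pose c := col j (cokermx (lin_mx Phi)); pose C := (vec_mx c^T)^T.
have cE Y : (mxvec Y *m cokermx (lin_mx Phi)) 0 j = \tr (Y *m C).
  transitivity ((mxvec Y *m c) 0 0); last by rewrite mxvec_trace mxE eqxx mulr1n.
  by rewrite !mxE; apply: eq_bigr => x _; rewrite [c _ _]mxE.
have trC X : \tr (Phi X *m C) = 0.
  rewrite -cE -mul_vec_lin -mulmxA mulmx_coker mulmx0 mxE //.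
rewrite cE; have NC : N *m C = C *m N.
  apply/eqP; rewrite -subr_eq0; apply/eqP/matrixP => a b; rewrite [RHS]mxE.
  have := trC (delta_mx b a).
  have -> X : \tr (Phi X *m C) = \tr (X *m (N *m C - C *m N)).
    rewrite /= /phi mulmxBl mulmxBr !raddfB /= mulmxA; congr (_ - _).
    by rewrite -[N *m X *m C]mulmxA mxtrace_mulC mulmxA.
  by rewrite mxtrace_delta.
apply: mxtrace_eigen0 => l; apply: (@nilpotent_eigen0 _ _ m).
have cNC : GRing.comm N C by exact: NC.
by rewrite -[N *m C]/(N * C) exprMn_comm // Nm mul0r.
Qed.

End Nilpotent.


(** * Exact pairs of operators *)

Definition exact_mx (k : fieldType) d (v : 'M[k]_d) : Prop :=
  forall x : 'cV[k]_d, v *m x = 0 -> exists y, x = v *m y.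

Section Contraction.
Variables (k : fieldType) (d : nat) (v : 'M[k]_d).
Hypotheses (vv : v *m v = 0) (ev : exact_mx v).

Lemma exact_mx_lift m (X : 'M[k]_(d, m)) : v *m X = 0 -> exists Y, X = v *m Y.
Proof.
move=> vX; have ch j : exists y : 'cV_d, col j X == v *m y.
  have [|y ->] := ev (x := col j X); last by exists y.
  by rewrite colE mulmxA vX mul0mx.
exists (\matrix_(i, j) xchoose (ch j) i 0); apply/matrixP => i j.
have /eqP/matrixP/(_ i 0) := xchooseP (ch j); rewrite !mxE => ->.
by apply: eq_bigr => a _; rewrite mxE.
Qed.

(** For a generalized inverse g of v, e = g v is a projection with the kernel of v. The operator s
    projects onto that kernel by 1 - e, inverts v there by g, and moves the result into the image of
    e, which makes s s = 0. *)
Lemma exact_contraction : exists s : 'M[k]_d, v *m s + s *m v = 1%:M /\ s *m s = 0.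
Proof.
have [g vgv] : exists g, v *m g *m v = v by exists (pinvmx v); rewrite mulmxKpV.
have [e eE] : exists e, e = g *m v by exists (g *m v).
have ve : v *m e = v by rewrite eE mulmxA vgv.
have ev0 : e *m v = 0 by rewrite eE -mulmxA vv mulmx0.
have ee : e *m e = e by rewrite {1}eE -mulmxA ve -eE.
have [|Y YE] := @exact_mx_lift _ (1%:M - e); first by rewrite mulmxBr mulmx1 ve subrr.
exists (e *m g *m (1%:M - e)); split.
  rewrite !mulmxA ve -[_ *m (1%:M - e) *m v]mulmxA mulmxBl mul1mx ev0 subr0.
  by rewrite -[e *m g *m v]mulmxA -eE ee YE mulmxA vgv -YE subrK.
rewrite !mulmxA -[_ *m (1%:M - e) *m e]mulmxA mulmxBl mul1mx ee subrr.
by rewrite mulmx0 !mul0mx.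
Qed.

End Contraction.

Lemma inj_unitmx (k : fieldType) d (M : 'M[k]_d) :
  (forall x : 'cV[k]_d, M *m x = 0 -> x = 0) -> M \in unitmx.
Proof.
move=> inj; rewrite -unitmx_tr -row_free_unit -kermx_eq0; apply/rowV0P => x.
move=> /sub_kermxP xM; apply: trmx_inj; rewrite trmx0; apply: inj.
by rewrite -[M]trmxK -trmx_mul xM trmx0.
Qed.

Section ExactPair.
Variables (k : closedFieldType) (char2 : 2%N \in [pchar k]) (d : nat).
Variables (u v : 'M[k]_d).
Hypotheses (vv : v *m v = 0) (uv : u *m v = 0) (vu : v *m u = 0).
Hypothesis exact_line : forall c, exact_mx (v + c *: u).

(* The exactness of all v + c u makes N nilpotent, hence a commutator E N - N E. *)
Lemma exact_pair_structure : exists s N E : 'M[k]_d,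
  [/\ v *m s + s *m v = 1%:M, v *m N = u, N *m v = u, s *m N = N *m s
    & E *m v = v *m E /\ E *m N - N *m E = N].
Proof.
have addM m n (X : 'M[k]_(m, n)) : X + X = 0.
  by rewrite -[X]scale1r -scalerDl addrr_pchar2 // scale0r.
have ev : exact_mx v by move=> x; have := @exact_line 0 x; rewrite scale0r addr0.
have [s [vs ss]] := exact_contraction vv ev.
(* N is u divided by v with the help of the contraction s: v N = N v = u. *)
pose N := s *m u + u *m s.
have vsE : v *m s = 1%:M + s *m v by rewrite -vs -addrA addM addr0.
have svE : s *m v = 1%:M + v *m s by rewrite -vs addrAC addM add0r.
have vN : v *m N = u.
  by rewrite /N mulmxDr !mulmxA vu mul0mx addr0 vsE mulmxDl mul1mx -mulmxA vu mulmx0 addr0.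
have Nv : N *m v = u.
  by rewrite /N mulmxDl -!mulmxA uv mulmx0 add0r svE mulmxDr mulmx1 mulmxA uv mul0mx addr0.
have sN : s *m N = N *m s.
  by rewrite /N mulmxDl mulmxDr !mulmxA ss mul0mx add0r -[u *m s *m s]mulmxA ss mulmx0 addr0.
(* M = 1 + c N commutes with v and s, and v M = v + c u. If M z = 0, exactness gives z = (v + c u)
   z' = v M z', so v z = 0. For y in the kernel of M this applies to y and to s y, and y = v s y + s
   v y. *)
have unitN c : 1%:M + c *: N \in unitmx.
  apply: inj_unitmx => y My; set M := 1%:M + c *: N in My *.
  have vM : v *m M = v + c *: u by rewrite mulmxDr mulmx1 -scalemxAr vN.
  have Mv : M *m v = v + c *: u by rewrite mulmxDl mul1mx -scalemxAl Nv.
  have Ms : M *m s = s *m M.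
    by rewrite mulmxDl mulmxDr mul1mx mulmx1 -scalemxAl -scalemxAr sN.
  have K (z : 'cV[k]_d) : M *m z = 0 -> v *m z = 0.
    move=> Mz; have [|z' ->] := @exact_line c z.
      by rewrite -vM -mulmxA Mz mulmx0.
    by rewrite -vM !mulmxA vv !mul0mx.
  rewrite -[y]mul1mx -vs mulmxDl -!mulmxA (K y My) mulmx0 addr0 K //.
  by rewrite mulmxA Ms -mulmxA My mulmx0.
have N0 l : eigenvalue N l -> l = 0.
  move=> /eigenvalueP[x xN x0]; apply/eqP; apply: contraT => l0.
  have : x *m (1%:M + l^-1 *: N) = 0.
    by rewrite mulmxDr mulmx1 -scalemxAr xN scalerA mulVf // scale1r addM.
  move=> /(congr1 (fun z => z *m invmx (1%:M + l^-1 *: N))).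
  by rewrite mulmxK // mul0mx => x00; rewrite x00 eqxx in x0.
have [E0 E0N] := nilpotent_ad (eigen0_nilpotent N0).
(* The block of E0 for the idempotent s v, carried over to the complementary block v s by v and s;
   hence E commutes with v, and still [E, N] = N as N commutes with v and s. *)
pose E := s *m v *m E0 *m s *m v + v *m E0 *m s.
have vNC : v *m N = N *m v by rewrite vN Nv.
have vsv : v *m s *m v = v by rewrite vsE mulmxDl mul1mx -mulmxA vv mulmx0 addr0.
exists s, N, E; split=> //; split.
  rewrite /E mulmxDl mulmxDr !mulmxA vv !mul0mx addr0 vsv.
  by rewrite -[_ *m v *m v]mulmxA vv mulmx0 add0r.
have -> : E *m N = s *m v *m (E0 *m N) *m s *m v + v *m (E0 *m N) *m s.
  rewrite /E mulmxDl -!mulmxA; congr (_ + _); last by rewrite sN.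
  by rewrite vNC [s *m (N *m v)]mulmxA sN -!mulmxA.
have -> : N *m E = s *m v *m (N *m E0) *m s *m v + v *m (N *m E0) *m s.
  rewrite /E mulmxDr; congr (_ + _); last by rewrite !mulmxA -vNC.
  by rewrite !mulmxA -sN -[s *m N *m v]mulmxA -vNC !mulmxA.
rewrite opprD addrACA -!mulmxBl -!mulmxBr E0N.
have -> : s *m v *m N *m s *m v = s *m v *m N.
  by rewrite -[s *m v *m N]mulmxA vNC !mulmxA sN -!mulmxA [v *m (s *m v)]mulmxA vsv.
have -> : v *m N *m s = v *m s *m N by rewrite -!mulmxA sN.
by rewrite -mulmxDl addrC vs mul1mx.
Qed.

End ExactPair.

(** * Conjugating the twisted action into the primitive one *)

Section TwistedTensor.
Variables (R : pzRingType) (addrr : forall x : R, x + x = 0).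
Variables (v1 v2 s1 s2 N1 N2 E : R) (m0 m1 g : R).
Hypotheses (v1v1 : v1 * v1 = 0) (v2v2 : v2 * v2 = 0) (v12 : v1 * v2 = v2 * v1).
Hypotheses (vs1 : v1 * s1 + s1 * v1 = 1) (vs2 : v2 * s2 + s2 * v2 = 1).
Hypotheses (s1v2 : s1 * v2 = v2 * s1) (s2v1 : s2 * v1 = v1 * s2).
Hypotheses (N1v1 : N1 * v1 = v1 * N1) (N1v2 : N1 * v2 = v2 * N1).
Hypotheses (N2v1 : N2 * v1 = v1 * N2) (N2v2 : N2 * v2 = v2 * N2).
Hypotheses (N1s1 : N1 * s1 = s1 * N1) (N1s2 : N1 * s2 = s2 * N1).
Hypotheses (N2s1 : N2 * s1 = s1 * N2) (N2s2 : N2 * s2 = s2 * N2).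
Hypothesis N12 : N1 * N2 = N2 * N1.
Hypotheses (Ev1 : E * v1 = v1 * E) (Ev2 : E * v2 = v2 * E) (EN2 : E * N2 = N2 * E).
Hypothesis EN1 : E * N1 + N1 * E = N1.
Hypotheses (gv1 : g * v1 = v1 * g) (gv2 : g * v2 = v2 * g) (gs1 : g * s1 = s1 * g).
Hypotheses (gN1 : g * N1 = N1 * g) (gN2 : g * N2 = N2 * g).
Hypothesis m0C : forall x, m0 * x = x * m0.
Hypothesis m1C : forall x, m1 * x = x * m1.

Variables (z D r p X kap w U0 q : R).
Hypotheses (zE : z = v1 + v2) (DE : D = N1 + N2) (rE : r = m0 * N2 + g).
Hypotheses (pE : p = v1 * (s1 + s2)) (XE : X = E * r + m1 * p).
Hypotheses (kapE : kap = N1 * r + m1 * D) (wE : w = v1 * v2).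
Hypotheses (U0E : U0 = v1 * N1 + v2 * N2) (qE : q = g * w * s1).

Local Notation comm := GRing.comm.

Let zz : z * z = 0.
Proof. by rewrite zE mulrDl !mulrDr v1v1 v2v2 add0r addr0 v12 addrr. Qed.

Let commz x : comm x v1 -> comm x v2 -> comm x z.
Proof. by move=> a b; rewrite zE; apply: commrD. Qed.

Let rv1 : comm r v1.
Proof. by rewrite rE; apply/commr_sym/commrD; [apply: commrM|]; apply/commr_sym=> //; exact: m0C. Qed.
Let rv2 : comm r v2.
Proof. by rewrite rE; apply/commr_sym/commrD; [apply: commrM|]; apply/commr_sym=> //; exact: m0C. Qed.
Let Dv1 : comm D v1.
Proof. by rewrite DE; apply/commr_sym/commrD; apply/commr_sym. Qed.
Let Dv2 : comm D v2.
Proof. by rewrite DE; apply/commr_sym/commrD; apply/commr_sym. Qed.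
Let rD : comm r D.
Proof.
rewrite DE rE; apply/commr_sym/commrD.
  apply: commrM; first by apply/commr_sym; exact: m0C.
  by apply/commr_sym/commrD => //; apply/commr_sym.
by apply/commr_sym/commrD.
Qed.

Let pz : comm p z.
Proof.
have sz : comm (s1 + s2) z.
  rewrite /GRing.comm zE !mulrDl !mulrDr s1v2 s2v1.
  have -> : s1 * v1 = 1 + v1 * s1 by rewrite -vs1 addrAC addrr add0r.
  have -> : s2 * v2 = 1 + v2 * s2 by rewrite -vs2 addrAC addrr add0r.
  have -> : 1 + v1 * s1 + v2 * s1 + (v1 * s2 + (1 + v2 * s2)) =
     (1 + 1) + (v1 * s1 + v1 * s2 + (v2 * s1 + v2 * s2)).
    by rewrite (AC (3*(1*2)) ((1*5)*((2*4)*(3*6)))).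
  by rewrite addrr add0r.
rewrite pE; apply/commr_sym/commrM; last exact/commr_sym.
by rewrite /GRing.comm zE mulrDl mulrDr v12.
Qed.

Let zv1 : z * v1 = w.
Proof. by rewrite zE mulrDl v1v1 add0r -v12. Qed.

Let wz : w * z = 0.
Proof.
by rewrite wE zE mulrDr -[v1 * v2 * v2]mulrA v2v2 mulr0 addr0 -mulrA -v12 mulrA v1v1 mul0r.
Qed.

Let zw : z * w = 0.
Proof. by rewrite -zv1 mulrA zz mul0r. Qed.

Let U0E' : U0 = z * N2 + v1 * D.
Proof.
rewrite U0E zE DE mulrDl mulrDr [RHS](AC (2*2) ((3*2)*(1*4))) /=.
by rewrite addrr addr0.
Qed.

Let ED : E * D + D * E = N1.
Proof. by rewrite DE mulrDl mulrDr EN2 (AC (2*2) ((1*3)*(2*4))) /= EN1 addrr addr0. Qed.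

Let Xz : comm X z.
Proof.
rewrite XE; apply/commr_sym/commrD.
  apply: commrM; first by apply/commr_sym/commz.
  by apply/commr_sym/commz.
by apply: commrM; [apply/commr_sym; exact: m1C | apply/commr_sym].
Qed.

(** E contributes the term N1 r, because [E, D] = N1; p contributes m1 D, because p v1 = v1 and v1 p
    = 0. *)
Let X_key : X * (v1 * D) + v1 * D * X = v1 * kap.
Proof.
have c1 : E * r * (v1 * D) + v1 * D * (E * r) = v1 * (N1 * r).
  have -> : E * r * (v1 * D) = v1 * (E * D) * r.
    by rewrite -mulrA [r * _]mulrA rv1 -[v1 * r * D]mulrA rD !mulrA Ev1.
  have -> : v1 * D * (E * r) = v1 * (D * E) * r by rewrite !mulrA.
  by rewrite -mulrDl -mulrDr ED mulrA.
have c2 : m1 * p * (v1 * D) + v1 * D * (m1 * p) = v1 * (m1 * D).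
  have pv : p * v1 = v1.
    rewrite pE -mulrA mulrDl s2v1 mulrDr mulrA.
    have -> : v1 * s1 = 1 + s1 * v1 by rewrite -vs1 -addrA addrr addr0.
    by rewrite mulrDl mul1r -[s1 * v1 * v1]mulrA v1v1 mulr0 addr0 mulrA v1v1 mul0r addr0.
  have vp : v1 * p = 0 by rewrite pE mulrA v1v1 mul0r.
  have pD : D * p = p * D.
    have Ds : comm D (s1 + s2).
      by rewrite DE; apply: commrD; apply/commr_sym/commrD; apply/commr_sym.
    by rewrite pE mulrA Dv1 -mulrA Ds mulrA.
  have -> : v1 * D * (m1 * p) = 0.
    by rewrite -mulrA [D * _]mulrA -m1C -mulrA pD mulrA -m1C -mulrA [v1 * _]mulrA vp mul0r mulr0.
  by rewrite addr0 -mulrA [p * _]mulrA pv mulrA m1C mulrA.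
by rewrite XE kapE [(E * r + m1 * p) * _]mulrDl [v1 * D * (E * r + _)]mulrDr
  [v1 * (N1 * r + _)]mulrDr addrACA c1 c2.
Qed.

Let kapz : comm kap z.
Proof.
have N1z : comm N1 z by apply: commz.
have Dz : comm D z by apply: commz.
have rz : comm r z by apply: commz.
rewrite kapE; apply/commr_sym/commrD; apply: commrM; apply/commr_sym => //; exact: m1C.
Qed.

Let U0z : comm U0 z.
Proof.
have N2z : comm N2 z by apply: commz.
have Dz : comm D z by apply: commz.
have v1z : comm v1 z by apply: commz.
by rewrite U0E'; apply/commr_sym/commrD; apply: commrM => //; apply/commr_sym.
Qed.

Let conj2 : (1 + z * X) * U0 = (U0 + w * kap) * (1 + z * X).
Proof.
have wX : w * kap * (z * X) = 0.
  by rewrite -mulrA [kap * _]mulrA kapz !mulrA wz !mul0r.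
rewrite [(1 + z * X) * _]mulrDl mul1r [(U0 + w * kap) * _]mulrDr mulr1.
rewrite [(U0 + w * kap) * (z * X)]mulrDl wX addr0 -addrA; congr (_ + _).
rewrite [U0 * _]mulrA U0z -!mulrA.
have zN : z * (X * (z * N2)) = 0 by rewrite mulrA -Xz -mulrA [z * (z * _)]mulrA zz mul0r mulr0.
have -> : z * (X * U0) = z * (X * (v1 * D)) by rewrite U0E' !mulrDr zN add0r.
have -> : z * (U0 * X) = z * (v1 * D * X).
  by rewrite U0E' mulrDl mulrDr !mulrA zz !mul0r add0r.
rewrite -zv1 -[z * v1 * kap]mulrA -X_key mulrDr -addrA addrr addr0 //.
Qed.

Let gw : comm g w. Proof. by rewrite wE; apply: commrM. Qed.
Let wv1 : w * v1 = 0. Proof. by rewrite wE -mulrA -v12 mulrA v1v1 mul0r. Qed.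
Let wv2 : w * v2 = 0. Proof. by rewrite wE -mulrA v2v2 mulr0. Qed.
Let ws1v1 : w * s1 * v1 = w.
Proof.
have -> : w * s1 * v1 = w * (1 + v1 * s1).
  by rewrite -vs1 addrAC addrr add0r mulrA.
by rewrite mulrDr mulr1 mulrA wv1 mul0r addr0.
Qed.
Let ws1v2 : w * s1 * v2 = 0. Proof. by rewrite -mulrA s1v2 mulrA wv2 mul0r. Qed.

Let xq x : x * w = 0 -> comm x g -> x * q = 0.
Proof. by move=> xw xg; rewrite qE -mulrA mulrA xg -mulrA [x * _]mulrA xw mul0r mulr0. Qed.

Let zg : comm z g. Proof. by apply/commr_sym/commz. Qed.
Let ww : w * w = 0. Proof. by rewrite {2}wE mulrA wv1 mul0r. Qed.
Let wgq : w * g * q = 0. Proof. by rewrite -gw -mulrA xq // mulr0. Qed.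

(** w s1 v1 = w and w s1 v2 = 0 give q z = w g, while z q = 0. *)
Let conj1z : (1 + q) * z = (z + w * g) * (1 + q).
Proof.
have qz : q * z = w * g.
  have -> : q * z = g * (w * s1 * v1 + w * s1 * v2) by rewrite -mulrDr -zE qE -!mulrA.
  by rewrite ws1v1 ws1v2 addr0 gw.
rewrite [(1 + q) * z]mulrDl mul1r [(z + w * g) * _]mulrDr mulr1.
by rewrite [(z + w * g) * q]mulrDl wgq xq // !addr0 qz.
Qed.

Let conj1U : (1 + q) * (U0 + w * kap) = (U0 + w * (m0 * N1 * N2 + m1 * D)) * (1 + q).
Proof.
have qU : q * U0 = w * (g * N1).
  have -> : q * U0 = g * (w * s1 * v1 * N1 + w * s1 * v2 * N2).
    by rewrite qE U0E !mulrDr !mulrA.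
  by rewrite ws1v1 ws1v2 mul0r addr0 mulrA gw -mulrA.
have qw : q * (w * kap) = 0.
  have -> : q * (w * kap) = g * (w * s1 * v1) * v2 * kap by rewrite qE wE !mulrA.
  by rewrite ws1v1 -[g * w * v2]mulrA wv2 mulr0 mul0r.
have U0w : U0 * w = 0.
  rewrite U0E mulrDl -!mulrA.
  have -> : N1 * w = w * N1 by rewrite wE mulrA N1v1 -mulrA N1v2 mulrA.
  have -> : N2 * w = w * N2 by rewrite wE mulrA N2v1 -mulrA N2v2 mulrA.
  by rewrite !mulrA {1}wE mulrA v1v1 !mul0r add0r wE v12 mulrA v2v2 !mul0r.
have gU0 : comm U0 g.
  by rewrite U0E; apply/commr_sym/commrD; apply: commrM.
have [t tE] : exists t, t = m0 * N1 * N2 + m1 * D by eexists.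
rewrite -tE.
have tw : t * w = w * t.
  have m0w : m0 * w = w * m0 by exact: m0C.
  have wN1 : comm w N1.
    by rewrite wE; apply/commr_sym/commrM.
  have wN2 : comm w N2.
    by rewrite wE; apply/commr_sym/commrM.
  rewrite tE; apply/esym/commrD; first by apply: commrM => //; apply: commrM.
  by apply: commrM; [apply/commr_sym; exact: m1C | rewrite DE; apply: commrD].
have gt : comm t g.
  rewrite tE; apply/commr_sym/commrD; apply: commrM; try (by apply/commr_sym; exact: m1C).
    by apply: commrM => //; apply/commr_sym; exact: m0C.
  by [].
  by rewrite DE; apply: commrD.
have wtq : w * t * q = 0.
  by rewrite -tw -mulrA xq ?mulr0 //; apply/commr_sym.
rewrite [(1 + q) * _]mulrDl mul1r [q * (U0 + _)]mulrDr qU qw addr0.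
rewrite [(U0 + w * t) * _]mulrDr mulr1 [(U0 + w * t) * q]mulrDl wtq xq // !addr0.
rewrite -addrA -mulrDr; congr (_ + w * _); rewrite kapE rE tE mulrDr gN1.
by rewrite (AC (3*1) ((1*3)*(2*4))) /= addrr addr0 [N1 * (m0 * N2)]mulrA m0C.
Qed.

Let conjugate : [/\ (1 + q) * (1 + z * X) * ((1 + z * X) * (1 + q)) = 1,
  (1 + z * X) * (1 + q) * ((1 + q) * (1 + z * X)) = 1,
  (1 + q) * (1 + z * X) * z = (z + w * g) * ((1 + q) * (1 + z * X))
  & (1 + q) * (1 + z * X) * U0 =
    (U0 + w * (m0 * N1 * N2 + m1 * D)) * ((1 + q) * (1 + z * X))].
Proof.
have sq (y : R) : y * y = 0 -> (1 + y) * (1 + y) = 1.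
  move=> yy; rewrite !(mulrDl, mulrDr) !mulr1 !mul1r yy addr0.
  by rewrite -addrA addrr addr0.
have q2 : (1 + q) * (1 + q) = 1.
  apply: sq; have -> : q * q = g * (w * s1 * g * w * s1) by rewrite qE !mulrA.
  have -> : w * s1 * g * w * s1 = g * (w * s1 * v1 * v2) * s1.
    by rewrite -[w * s1 * g]mulrA -gs1 mulrA -gw wE !mulrA.
  by rewrite ws1v1 wv2 mulr0 mul0r mulr0.
have zX2 : (1 + z * X) * (1 + z * X) = 1.
  by apply: sq; rewrite -mulrA [X * (z * X)]mulrA Xz -mulrA mulrA zz mul0r.
split.
- by rewrite mulrA -[(1 + q) * _ * _]mulrA zX2 mulr1 q2.
- by rewrite mulrA -[(1 + z * X) * _ * _]mulrA q2 mulr1 zX2.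
- have zXz : (1 + z * X) * z = z * (1 + z * X).
    rewrite [(1 + z * X) * z]mulrDl mul1r [z * (1 + z * X)]mulrDr mulr1 mulrA zz.
    by rewrite mul0r -mulrA Xz mulrA zz mul0r.
  by rewrite -[LHS]mulrA zXz mulrA conj1z mulrA.
by rewrite -[LHS]mulrA conj2 mulrA conj1U mulrA.
Qed.

(** z and U0 are the primitive actions of v and u, the other sides those through Delta. The factor 1
    + z X fixes z and turns U0 into U0 + w kap ([conj2]). The factor 1 + q turns z into z + w g and
    adds w g N1 to the other, which cancels the g in r. Both are their own inverses, since z X and q
    have square zero. *)
Lemma twisted_conjugate : exists Phi Psi : R, [/\ Phi * Psi = 1, Psi * Phi = 1,
  Phi * z = (z + w * g) * Phi & Phi * U0 = (U0 + w * (m0 * N1 * N2 + m1 * D)) * Phi].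
Proof. by exists ((1 + q) * (1 + z * X)), ((1 + z * X) * (1 + q)). Qed.

End TwistedTensor.


(** * Tensor products of representations *)

Section TensMx.
Variable k : fieldType.

Lemma tmx_linl m n p q (B : 'M[k]_(p, q)) c (X Y : 'M[k]_(m, n)) :
  (c *: X + Y) *t B = c *: (X *t B) + Y *t B.
Proof. by apply/matrixP => i j; rewrite !mxE mulrDl mulrA. Qed.

Lemma tmx_linr m n p q (A : 'M[k]_(m, n)) c (X Y : 'M[k]_(p, q)) :
  A *t (c *: X + Y) = c *: (A *t X) + A *t Y.
Proof. by apply/matrixP => i j; rewrite !mxE mulrDr mulrCA. Qed.

Lemma tmx_Dl m n p q (B : 'M[k]_(p, q)) (X Y : 'M[k]_(m, n)) :
  (X + Y) *t B = X *t B + Y *t B.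
Proof. by apply/matrixP => i j; rewrite !mxE mulrDl. Qed.

Lemma tmx_Zl m n p q (B : 'M[k]_(p, q)) c (X : 'M[k]_(m, n)) :
  (c *: X) *t B = c *: (X *t B).
Proof. by apply/matrixP => i j; rewrite !mxE mulrA. Qed.

Lemma tmx_Dr m n p q (A : 'M[k]_(m, n)) (X Y : 'M[k]_(p, q)) :
  A *t (X + Y) = A *t X + A *t Y.
Proof. by apply/matrixP => i j; rewrite !mxE mulrDr. Qed.

Lemma tmx_Zr m n p q (A : 'M[k]_(m, n)) c (X : 'M[k]_(p, q)) :
  A *t (c *: X) = c *: (A *t X).
Proof. by apply/matrixP => i j; rewrite !mxE mulrCA. Qed.

Lemma tmx_11 m n : (1%:M : 'M[k]_m) *t (1%:M : 'M[k]_n) = 1%:M.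
Proof.
apply/matrixP => i j.
case: (mxtens_indexP i) => i1 i2; case: (mxtens_indexP j) => j1 j2.
rewrite tensmxE !mxE -natrM mulnb (can_eq (@mxtens_indexK _ _)).
by rewrite xpair_eqE.
Qed.

Definition flip_mx m n : 'M[k]_(n * m, m * n) :=
  \matrix_(a, b) (((mxtens_unindex a).1 == (mxtens_unindex b).2)%:R
               * ((mxtens_unindex a).2 == (mxtens_unindex b).1)%:R).

Lemma flip_mxE m n i1 i2 j1 j2 :
  flip_mx m n (mxtens_index (i1, i2)) (mxtens_index (j1, j2)) =
  (i1 == j2)%:R * (i2 == j1)%:R.
Proof. by rewrite !mxE !mxtens_indexK. Qed.

Lemma sum_mxtens m n (F : 'I_(m * n) -> k) :
  \sum_a F a = \sum_i \sum_j F (mxtens_index (i, j)).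
Proof.
rewrite (reindex (@mxtens_index m n)) /=; last first.
  by exists (@mxtens_unindex m n) => x _; [exact: mxtens_indexK|exact: mxtens_unindexK].
by rewrite pair_bigA /=; apply: eq_bigr => -[a b] _.
Qed.

Lemma sum_delta n (F : 'I_n -> k) i : \sum_j (i == j)%:R * F j = F i.
Proof.
rewrite (bigD1 i) //= eqxx mul1r big1 ?addr0 // => j.
by rewrite eq_sym => /negPf ->; rewrite mul0r.
Qed.

Lemma flip_mx_tens m n (A : 'M[k]_m) (B : 'M[k]_n) :
  flip_mx m n *m (A *t B) = (B *t A) *m flip_mx m n.
Proof.
apply/matrixP => i j.
case: (mxtens_indexP i) => i1 i2; case: (mxtens_indexP j) => j1 j2.
rewrite !mxE !sum_mxtens; transitivity (A i2 j1 * B i1 j2).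
  rewrite -(sum_delta (fun a => A a j1 * B i1 j2) i2); apply: eq_bigr => a _.
  rewrite -(sum_delta (fun b => A a j1 * B b j2) i1) mulr_sumr; apply: eq_bigr => b _.
  by rewrite flip_mxE tensmxE; ring.
symmetry; rewrite -(sum_delta (fun a => A i2 j1 * B i1 a) j2); apply: eq_bigr => a _.
rewrite -(sum_delta (fun b => A i2 b * B i1 a) j1) mulr_sumr; apply: eq_bigr => b _.
by rewrite flip_mxE tensmxE ![_ == j2]eq_sym ![_ == j1]eq_sym; ring.
Qed.

Lemma flip_mxK m n : flip_mx m n *m flip_mx n m = 1%:M.
Proof.
apply/matrixP => i j.
case: (mxtens_indexP i) => i1 i2; case: (mxtens_indexP j) => j1 j2.
rewrite !mxE sum_mxtens (can_eq (@mxtens_indexK _ _)) xpair_eqE.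
transitivity (\sum_a (i2 == a)%:R * ((i1 == j1)%:R * (a == j2)%:R : k)).
  apply: eq_bigr => a _.
  rewrite -(sum_delta (fun b => (i2 == a)%:R * ((b == j1)%:R * (a == j2)%:R)) i1).
  by apply: eq_bigr => b _; rewrite !flip_mxE; ring.
by rewrite sum_delta -natrM mulnb.
Qed.

End TensMx.

Section Reps.
Variables (k : fieldType) (A : falgType k).
Implicit Types (M N X Y : rep A).

Definition intertwines M N (f : 'M[k]_(rdim N, rdim M)) := forall a, f *m M a = N a *m f.

Lemma rep_iso_sym M N : rep_iso M N -> rep_iso N M.
Proof.
move=> [P [Q [PQ QP PM]]]; exists Q, P; split=> // a.
by rewrite -[Q *m N a]mulmx1 -PQ -mulmxA [N a *m _]mulmxA -PM !mulmxA QP mul1mx.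
Qed.

Lemma rep_iso_trans M N X : rep_iso M N -> rep_iso N X -> rep_iso M X.
Proof.
move=> [P [Q [PQ QP PM]]] [P' [Q' [PQ' QP' PM']]]; exists (P' *m P), (Q *m Q'); split.
- by rewrite mulmxA -[P' *m P *m Q]mulmxA PQ mulmx1.
- by rewrite mulmxA -[Q *m Q' *m P']mulmxA QP' mulmx1.
by move=> a; rewrite -mulmxA PM mulmxA PM' mulmxA.
Qed.

Record biproduct M X Y := Biproduct {
  inj1 : 'M[k]_(rdim M, rdim X); proj1 : 'M[k]_(rdim X, rdim M);
  inj2 : 'M[k]_(rdim M, rdim Y); proj2 : 'M[k]_(rdim Y, rdim M);
  inj1_rep : intertwines inj1; proj1_rep : intertwines proj1;
  inj2_rep : intertwines inj2; proj2_rep : intertwines proj2;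
  proj_inj1 : proj1 *m inj1 = 1%:M; proj_inj2 : proj2 *m inj2 = 1%:M;
  proj12 : proj1 *m inj2 = 0; proj21 : proj2 *m inj1 = 0;
  inj_proj : inj1 *m proj1 + inj2 *m proj2 = 1%:M
}.

Lemma biproduct_iso M X Y M' X' Y' : biproduct M X Y -> biproduct M' X' Y' ->
  rep_iso X X' -> rep_iso Y Y' -> rep_iso M M'.
Proof.
move=> [i1 p1 i2 p2 i1r p1r i2r p2r e1 e2 e12 e21 e].
move=> [i1' p1' i2' p2' i1r' p1r' i2r' p2r' e1' e2' e12' e21' e'].
move=> [P1 [Q1 [PQ1 QP1 PM1]]] [P2 [Q2 [PQ2 QP2 PM2]]].
exists (i1' *m P1 *m p1 + i2' *m P2 *m p2), (i1 *m Q1 *m p1' + i2 *m Q2 *m p2'); split.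
- rewrite -e' mulmxDl !mulmxDr !mulmxA -![_ *m p1 *m i1]mulmxA -![_ *m p2 *m i2]mulmxA.
  rewrite -![_ *m p1 *m i2]mulmxA -![_ *m p2 *m i1]mulmxA e1 e2 e12 e21 !mulmx0 !mul0mx !mulmx1.
  by rewrite addr0 add0r -![_ *m P1 *m Q1]mulmxA -![_ *m P2 *m Q2]mulmxA PQ1 PQ2 !mulmx1.
- rewrite -e mulmxDl !mulmxDr !mulmxA -![_ *m p1' *m i1']mulmxA -![_ *m p2' *m i2']mulmxA.
  rewrite -![_ *m p1' *m i2']mulmxA -![_ *m p2' *m i1']mulmxA e1' e2' e12' e21' !mulmx0 !mul0mx !mulmx1.
  by rewrite addr0 add0r -![_ *m Q1 *m P1]mulmxA -![_ *m Q2 *m P2]mulmxA QP1 QP2 !mulmx1.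
move=> a; rewrite mulmxDl mulmxDr -!mulmxA p1r p2r; congr (_ + _).
  by rewrite [P1 *m _]mulmxA PM1 !mulmxA i1r'.
by rewrite [P2 *m _]mulmxA PM2 !mulmxA i2r'.
Qed.

Section Tensor.
Variables (eps : {lrmorphism A -> k^o}) (H : hopf eps).

Definition tact V W (t : A ⊗ A) : 'M[k]_(rdim (V : rep A) * rdim (W : rep A)) :=
  tlift (fun a b => V a *t W b) t.

Lemma tact_bil (V W : rep A) : bilinear_map (fun a b => V a *t W b).
Proof. by split=> [b|a] c x y; rewrite linearP /= (tmx_linl, tmx_linr). Qed.

Lemma tact_tens (V W : rep A) a b : tact V W (tens a b) = V a *t W b.
Proof. by rewrite /tact tlift_tens //; exact: tact_bil. Qed.

Lemma tensor_repE (V W : rep A) a : tensor_rep H V W a = tact V W (comul H a).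
Proof. by []. Qed.

Lemma tact_ind (V W V' W' : rep A)
    (P : 'M[k]_(rdim V' * rdim W', rdim V * rdim W)) :
  (forall a b, P *m (V a *t W b) = (V' a *t W' b) *m P) ->
  forall t, P *m tact V W t = tact V' W' t *m P.
Proof.
move=> E t; elim/tprod_ind: t => [|s t IH IH'|a b].
- by rewrite /tact !linear0 ?mulmx0 ?mul0mx.
- by rewrite /tact !linearD /= mulmxDl ?mulmxDr IH IH'.
by rewrite !tact_tens.
Qed.

Lemma intertwines_tensorl (V V' W : rep A) (f : 'M[k]_(rdim V', rdim V)) :
  @intertwines V V' f ->
  @intertwines (tensor_rep H V W) (tensor_rep H V' W) (f *t (1%:M : 'M[k]_(rdim W))).
Proof.
move=> fr a; apply: tact_ind => b c.
by rewrite !tensmx_mul fr mulmx1 mul1mx.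
Qed.

Lemma biproduct_tensorl V X Y W : biproduct V X Y ->
  biproduct (tensor_rep H V W) (tensor_rep H X W) (tensor_rep H Y W).
Proof.
move=> [i1 p1 i2 p2 i1r p1r i2r p2r e1 e2 e12 e21 e].
pose I := (1%:M : 'M[k]_(rdim W)).
apply: (@Biproduct (tensor_rep H V W) (tensor_rep H X W) (tensor_rep H Y W)
  (i1 *t I) (p1 *t I) (i2 *t I) (p2 *t I)); try exact: intertwines_tensorl.
- by rewrite tensmx_mul e1 mulmx1 tmx_11.
- by rewrite tensmx_mul e2 mulmx1 tmx_11.
- by rewrite tensmx_mul e12 tens0mx.
- by rewrite tensmx_mul e21 tens0mx.
by rewrite !tensmx_mul mulmx1 -tmx_Dl e tmx_11.
Qed.

Lemma tensor_flip (V W : rep A) : rep_iso (tensor_rep H V W) (tensor_rep H W V).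
Proof.
exists (flip_mx k (rdim V) (rdim W)), (flip_mx k (rdim W) (rdim V)).
split=> [||a]; try exact: flip_mxK.
rewrite !tensor_repE -[in RHS](comulC H a).
move: (comul H a) => t; elim/tprod_ind: t => [|s t IH IH'|b c].
- by rewrite /tact !linear0 ?mulmx0 ?mul0mx.
- by rewrite /tact !linearD /= mulmxDl; congr (_ + _).
rewrite tlift_tens; last by have [tl tr] := tens_bilin A A; split=> d; [exact: tr|exact: tl].
by rewrite !tact_tens flip_mx_tens.
Qed.

End Tensor.

Lemma biproduct_exact M X Y a : biproduct M X Y ->
  (forall x : 'cV[k]_(rdim M), M a *m x = 0 -> exists y, x = M a *m y) ->
  forall x : 'cV[k]_(rdim Y), Y a *m x = 0 -> exists y, x = Y a *m y.
Proof.
move=> [i1 p1 i2 p2 i1r p1r i2r p2r e1 e2 e12 e21 e] ex x Yx.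
have [|y yE] := ex (i2 *m x); first by rewrite mulmxA -i2r -mulmxA Yx mulmx0.
exists (p2 *m y); rewrite mulmxA -p2r -mulmxA -yE mulmxA e2 mul1mx //.
Qed.

End Reps.


(** * The regular representation *)

Section SplitSummand.
Variables (k : fieldType) (A : falgType k).

Lemma idempotent_factor d (q : 'M[k]_d) : q *m q = q ->
  exists (C : 'M[k]_(d, \rank q)) (R : 'M[k]_(\rank q, d)), C *m R = q /\ R *m C = 1%:M.
Proof.
move=> qq; have := mulmx_base q.
have [R' RR'] := row_freeP (row_base_free q).
have [C' C'C] := row_fullP (col_base_full q).
move: (col_base q) (row_base q) C'C RR' => C R C'C RR' CR; exists C, R; split=> //.
have -> : R *m C = C' *m (C *m R *m (C *m R)) *m R'.
  by rewrite !mulmxA C'C mul1mx -!mulmxA RR' mulmx1.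
by rewrite CR qq -[X in C' *m X]CR !mulmxA C'C mul1mx RR'.
Qed.

(** The complement is the image of the idempotent 1 - i p, in the coordinates of a rank
    factorization; this idempotent is singular as X is nonzero. *)
Lemma split_summand (V X : rep A) (i : 'M[k]_(rdim V, rdim X)) (p : 'M[k]_(rdim X, rdim V)) :
  intertwines i -> intertwines p -> p *m i = 1%:M -> (0 < rdim X)%N ->
  exists V' : rep A, (rdim V' < rdim V)%N /\ exists bi : biproduct V X V', True.
Proof.
move=> ir pr pi X0; have [q qE] : exists q, q = 1%:M - i *m p by eexists.
have qi : q *m i = 0 by rewrite qE mulmxBl mul1mx -mulmxA pi mulmx1 subrr.
have pq : p *m q = 0 by rewrite qE mulmxBr mulmx1 mulmxA pi mul1mx subrr.
have qq : q *m q = q by rewrite {2}qE mulmxBr mulmx1 mulmxA qi mul0mx subr0.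
have qV a : q *m V a = V a *m q.
  by rewrite qE mulmxBl mulmxBr mul1mx mulmx1 -mulmxA pr mulmxA ir mulmxA.
have [C [R [CR RC]]] := idempotent_factor qq.
have qC : q *m C = C by rewrite -[X in X *m C]CR -mulmxA RC mulmx1.
have Rq : R *m q = R by rewrite -[X in R *m X]CR mulmxA RC mul1mx.
pose cmx (a : A) : 'M[k]_(\rank q) := R *m V a *m C.
have cl : linear cmx.
  by move=> c x y; rewrite /cmx linearP /= mulmxDr mulmxDl -scalemxAr -scalemxAl.
have cm : monoid_morphism cmx.
  split=> [|x y]; rewrite /cmx; first by rewrite rmorph1 mulmx1 RC.
  rewrite -[RHS]/((R *m V x *m C) *m (R *m V y *m C)) !mulmxA -[_ *m C *m R]mulmxA CR.
  by rewrite -[_ *m q *m V y]mulmxA qV rmorphM !mulmxA -![_ *m q *m C]mulmxA qC.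
pose V' := Rep cl cm.
have i2r : @intertwines k A V' V C by move=> a; rewrite /= /cmx !mulmxA CR qV -mulmxA qC.
have p2r : @intertwines k A V V' R by move=> a; rewrite /= /cmx -[RHS]mulmxA CR -mulmxA -qV mulmxA Rq.
have pC : p *m C = 0 by rewrite -[X in p *m X]qC mulmxA pq mul0mx.
have Ri : R *m i = 0 by rewrite -[X in X *m i]Rq -mulmxA qi mulmx0.
have e : i *m p + C *m R = 1%:M by rewrite CR qE addrC subrK.
exists V'; split; last first.
  by exists (@Biproduct k A V X V' i p C R ir pr i2r p2r pi RC pC Ri e).
rewrite /= ltn_neqAle rank_leq_row andbT; apply/negP => /eqP rq.
have qu : q \in unitmx by rewrite -row_free_unit -row_leq_rank rq.
have i0 : i = 0 by rewrite -[i](mulKmx qu) qi mulmx0.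
have := pi; rewrite i0 mulmx0 => /matrixP E.
by have /eqP := E (Ordinal X0) (Ordinal X0); rewrite !mxE eqxx eq_sym oner_eq0.
Qed.

End SplitSummand.

Section Regular.
Variables (k : fieldType) (char2 : 2%N \in [pchar k]).
Variables (A : falgType k) (eps : {lrmorphism A -> k^o}).
Variables (u v : A) (fr : frame eps u v).
Local Notation L := (bool * bool)%type.
Local Notation n4 := #|{: L}|.
Local Notation b := (letter u v).
Local Notation co := (coletter fr).
Local Notation w := (u * v).

Definition colet (l : L) : L := (~~ l.1, ~~ l.2).

(* The coefficient of uv is a nondegenerate trace form on A. *)
Lemma coletter_trace l a : co l a = fr3 fr (b (colet l) * a).
Proof.
have uM x0 x1 x2 x3 : u * comb u v x0 x1 x2 x3 = comb u v 0 x0 0 x2.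
  by rewrite -{1}(combu u v) (combM fr); congr comb; ring.
have vM x0 x1 x2 x3 : v * comb u v x0 x1 x2 x3 = comb u v 0 0 x0 x1.
  by rewrite -{1}(combv u v) (combM fr); congr comb; ring.
have wM x0 x1 x2 x3 : w * comb u v x0 x1 x2 x3 = comb u v 0 0 0 x0.
  by rewrite -{1}(combw u v) (combM fr); congr comb; ring.
case: l => [[] []] /=; first by rewrite mul1r.
- by rewrite {2}(comb_frE fr a) vM (fr3_comb fr).
- by rewrite {2}(comb_frE fr a) uM (fr3_comb fr).
- by rewrite {2}(comb_frE fr a) wM (fr3_comb fr).
Qed.

Lemma sum_enum_val (V : nmodType) (F : L -> V) : \sum_(i < n4) F (enum_val i) = \sum_l F l.
Proof.
rewrite [RHS](reindex (enum_val : 'I_n4 -> L)) //=.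
by exists enum_rank => x _; [exact: enum_valK|exact: enum_rankK].
Qed.

Definition reg_mx (a : A) : 'M[k]_n4 :=
  \matrix_(i, j) co (enum_val i) (a * b (enum_val j)).

Fact reg_linear : linear reg_mx.
Proof.
move=> c x y; apply/matrixP => i j; rewrite !mxE mulrDl -scalerAl.
exact: coletter_lin.
Qed.

Fact reg_monoid : monoid_morphism reg_mx.
Proof.
split=> [|x y]; apply/matrixP => i j; rewrite !mxE.
  by rewrite mul1r coletter_letter (inj_eq enum_val_inj) eq_sym.
transitivity (\sum_l co (enum_val i) (x * b l) * co l (y * b (enum_val j))).
  rewrite -mulrA {1}(letter_expand fr (y * _)) mulr_sumr.
  rewrite (functional_sum (phi := co (enum_val i))); last exact: coletter_lin.
  by apply: eq_bigr => l _; rewrite -scalerAr coletterZ mulrC.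
by rewrite -sum_enum_val; apply: eq_bigr => l _; rewrite !mxE.
Qed.

Definition reg_rep : rep A := Rep reg_linear reg_monoid.

Section Split.
Variables (V : rep A) (z : 'cV[k]_(rdim V)) (lam : 'rV[k]_(rdim V)).
Hypothesis lam_z : lam *m V w *m z = 1%:M.

Let i1 : 'M[k]_(rdim V, n4) := \matrix_(a, j) (V (b (enum_val j)) *m z) a 0.
Let p1 : 'M[k]_(n4, rdim V) := \matrix_(i, c) (lam *m V (b (colet (enum_val i)))) 0 c.
Let T (a : A) : k := (lam *m V a *m z) 0 0.

Let Tl : functional T.
Proof. by move=> c x y; rewrite /T linearP /= mulmxDr mulmxDl -scalemxAr -scalemxAl !mxE. Qed.

(** The element representing the functional T for the trace form [fr3]. *)
Let g : A := \sum_l T (b (colet l)) *: b l.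

Let trace_g x : fr3 fr (x * g) = T x.
Proof.
have F3 : functional (fr3 fr) by exact: (coletter_lin fr (true, true)).
rewrite /g mulr_sumr functional_sum //.
have colK l : colet (colet l) = l by case: l => [[] []].
have E l : fr3 fr (x * (T (b (colet l)) *: b l)) = co (colet l) x * T (b (colet l)).
  by rewrite -scalerAr functionalZ // coletter_trace colK (frame_mulC fr x) mulrC.
rewrite (eq_bigr _ (fun l _ => E l)) (reindex_inj (inv_inj colK)).
under eq_bigr => l _ do rewrite colK.
rewrite [in RHS](letter_expand fr x) functional_sum //.
by apply: eq_bigr => l _; rewrite functionalZ.
Qed.

(** eps g = T (uv) = 1, and in characteristic 2 the square of an element of A is the square of its
    augmentation. *)
Let gg : g * g = 1.
Proof.
have e1 : eps g = 1.
  have := coletter_trace (false, false) g; rewrite /= trace_g /T lam_z mxE eqxx => ->.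
  by [].
rewrite (comb_frE fr g) (combM fr) e1 -(comb1 u v); congr comb; try ring.
- by rewrite mul1r mulr1 addrr2.
- by rewrite mul1r mulr1 addrr2.
rewrite mul1r mulr1 addrr2 // add0r mulrC addrr2 //.
Qed.

Let i1_rep : @intertwines k A reg_rep V i1.
Proof.
move=> a; apply/matrixP => x j; rewrite [LHS]mxE [RHS]mxE.
transitivity ((V (a * b (enum_val j)) *m z) x 0).
  rewrite [in RHS](letter_expand fr (a * _)) linear_sum mulmx_suml summxE.
  rewrite -sum_enum_val; apply: eq_bigr => l _.
  by rewrite linearZ -scalemxAl !mxE mulrC.
rewrite rmorphM -[_ * _]/(V a *m V _) -mulmxA mxE; apply: eq_bigr => y _.
by congr (_ * _); rewrite [RHS]mxE.
Qed.

Let p1_rep : @intertwines k A V reg_rep p1.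
Proof.
move=> a; apply/matrixP => i y; rewrite [LHS]mxE [RHS]mxE.
transitivity ((lam *m V (b (colet (enum_val i)) * a)) 0 y).
  rewrite rmorphM -[_ * _]/(V _ *m V a) mulmxA mxE; apply: eq_bigr => x _.
  by congr (_ * _); rewrite [LHS]mxE.
have -> : b (colet (enum_val i)) * a =
    \sum_l co (enum_val i) (a * b l) *: b (colet l).
  have colK l : colet (colet l) = l by case: l => [[] []].
  rewrite [LHS](letter_expand fr) (reindex_inj (inv_inj colK)).
  apply: eq_bigr => l _; congr (_ *: _); rewrite !coletter_trace colK !mulrA.
  by congr (fr3 fr _); rewrite -!mulrA [RHS](frame_mulC fr) -mulrA;
    rewrite (frame_mulC fr (b l)) !mulrA [RHS](frame_mulC fr) !mulrA; congr (_ * _);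
    rewrite (frame_mulC fr).
rewrite linear_sum mulmx_sumr summxE -sum_enum_val; apply: eq_bigr => l _.
by rewrite linearZ -scalemxAr !mxE.
Qed.

Let p1i1 : p1 *m i1 = reg_mx g.
Proof.
apply/matrixP => i j; rewrite !mxE coletter_trace mulrA (frame_mulC fr) mulrA.
rewrite trace_g (frame_mulC fr) /T rmorphM -[_ * _]/(V _ *m V _) mulmxA -[_ *m z]mulmxA mxE.
by apply: eq_bigr => x _; rewrite !mxE.
Qed.

Let p' := reg_mx g *m p1.

Let p'_rep : @intertwines k A V reg_rep p'.
Proof.
move=> a; rewrite /p' -mulmxA p1_rep !mulmxA; congr (_ *m _).
rewrite -[LHS]/(reg_mx g * reg_mx a) -[RHS]/(reg_mx a * reg_mx g).
by rewrite -!(reg_monoid).2 (frame_mulC fr).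
Qed.

Let p'i1 : p' *m i1 = 1%:M.
Proof.
rewrite /p' -mulmxA p1i1 -[LHS]/(reg_mx g * reg_mx g) -(reg_monoid).2 gg.
exact: (reg_monoid).1.
Qed.

Lemma regular_summand_at : exists V' : rep A,
  (rdim V' < rdim V)%N /\ exists bi : biproduct V reg_rep V', True.
Proof.
apply: (split_summand i1_rep p'_rep p'i1).
by apply/card_gt0P; exists (true, true).
Qed.

End Split.

(** A is Frobenius, hence self-injective, and uv spans its socle. A nonzero entry of uv gives z and
    lam with lam (uv z) = 1, so a -> a z embeds A in V; lam and the trace form give a map back whose
    composite with it is multiplication by the unit g. *)
Lemma regular_summand (V : rep A) : V w != 0 -> exists V' : rep A,
  (rdim V' < rdim V)%N /\ exists bi : biproduct V reg_rep V', True.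
Proof.
move=> Vw; have [i [j ij]] : exists i j, V w i j != 0.
  apply: NNPP => N; case/eqP: Vw; apply/matrixP => i j; rewrite mxE.
  by apply/eqP; apply: contraT => ij; case: N; exists i, j.
apply: (@regular_summand_at V ((V w i j)^-1 *: delta_mx j 0) (delta_mx 0 i)).
apply/matrixP => a c; rewrite !ord1 -rowE -scalemxAr -colE !mxE eqxx mulVf //.
Qed.

End Regular.


Section RegularTensor.
Variables (k : fieldType) (char2 : 2%N \in [pchar k]).
Variables (A : falgType k) (eps : {lrmorphism A -> k^o}) (H : hopf eps).
Variables (u v : A) (fr : frame eps u v) (W : rep A).
Local Notation L := (bool * bool)%type.
Local Notation n4 := #|{: L}|.
Local Notation b := (letter u v).
Local Notation co := (coletter fr).
Local Notation w := (u * v).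
Local Notation reg := (reg_rep fr).
Local Notation I := (1%:M : 'M[k]_(rdim W)).
Local Notation M := (tensor_rep H reg W).

Fact reg_left_linear : linear (fun a => reg a *t I).
Proof. by move=> c x y; rewrite linearP tmx_linl. Qed.

Fact reg_left_monoid : monoid_morphism (fun a => reg a *t I).
Proof.
split=> [|x y]; first by rewrite rmorph1 tmx_11.
by rewrite rmorphM -[RHS]/(_ *m _) tensmx_mul mulmx1.
Qed.

Definition reg_left : rep A := Rep reg_left_linear reg_left_monoid.

Let e (l : L) : 'cV[k]_n4 := delta_mx (enum_rank l) 0.
Let c (l : L) : 'rV[k]_n4 := delta_mx 0 (enum_rank l).

Let c_reg l a : c l *m reg a = \sum_m co l (a * b m) *: c m.
Proof.
rewrite -rowE; apply/rowP => j; rewrite !mxE enum_rankK summxE (bigD1 (enum_val j)) //=.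
rewrite !mxE enum_valK !eqxx mulr1 big1 ?addr0 // => m mj.
rewrite !mxE eqxx /=; case: eqP => [jm|]; last by rewrite mulr0.
by rewrite jm enum_rankK eqxx in mj.
Qed.

Let c_reg_e a : c (true, true) *m reg a *m e (false, false) = (fr3 fr a)%:M.
Proof.
rewrite c_reg mulmx_suml (bigD1 (false, false)) //= big1 ?addr0 => [|m m1]; last first.
  rewrite -scalemxAl -rowE; apply/matrixP => i j; rewrite !mxE.
  by rewrite (inj_eq enum_rank_inj) (negPf m1) mulr0.
rewrite mulr1 -scalemxAl -rowE; apply/matrixP => i j; rewrite !ord1 !mxE !eqxx.
by rewrite mulr1 mulr1n.
Qed.

Let T (a : A) : 'M[k]_(1 * rdim W) := (1%:M : 'M[k]_1) *t W (left_conv H (fr3 fr) a).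

Let T_conv a : (c (true, true) *t I) *m M a *m (e (false, false) *t I) = T a.
Proof.
have F3 : functional (fr3 fr) by exact: (coletter_lin fr (true, true)).
rewrite tensor_repE /T /left_conv; move: (comul H a) => t.
elim/tprod_ind: t => [|s t IH IH'|x y].
- by rewrite /tact !linear0 ?mulmx0 ?mul0mx ?tensmx0.
- by rewrite /tact !linearD /= !mulmxDl IH IH' tmx_Dr.
rewrite tact_tens tlift_tens; last exact: conv_bil.
rewrite !tensmx_mul mul1mx mulmx1 c_reg_e linearZ /= tmx_Zr -tmx_Zl.
by rewrite scalemx1.
Qed.

(** T w is the action on W of x = (fr3 (x) id) Delta (uv), whose augmentation is fr3 (uv) = 1, so x
    x = 1. *)
Let Tw_inj (y : 'cV[k]_(1 * rdim W)) : T w *m y = 0 -> y = 0.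
Proof.
have F3 : functional (fr3 fr) by exact: (coletter_lin fr (true, true)).
set x := left_conv H (fr3 fr) w.
have xx : x * x = 1.
  have e1 : eps x = 1 by rewrite /x eps_conv // -(combw u v) (fr3_comb fr).
  rewrite (comb_frE fr x) (combM fr) e1 -(comb1 u v); congr comb; try ring.
  - by rewrite mul1r mulr1 addrr2.
  - by rewrite mul1r mulr1 addrr2.
  by rewrite mul1r mulr1 addrr2 // add0r mulrC addrr2.
move=> Ty; have TT : T w *m T w = 1%:M.
  have WW : W x *m W x = 1%:M by rewrite -[LHS]/(W x * W x) -rmorphM xx rmorph1.
  by rewrite /T tensmx_mul mulmx1 -/x WW tmx_11.
by rewrite -[y]mul1mx -TT -mulmxA Ty mulmx0.
Qed.

Let i : 'M[k]_(n4 * rdim W) := \sum_l M (b l) *m (e (false, false) *t I) *m (c l *t I).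

Let i_rep : @intertwines k A reg_left M i.
Proof.
move=> a; rewrite /i mulmx_suml mulmx_sumr /=.
transitivity (\sum_l \sum_m M (co l (a * b m) *: b l) *m (e (false, false) *t I) *m (c m *t I)).
  apply: eq_bigr => l _; rewrite -mulmxA tensmx_mul mulmx1 c_reg.
  have -> : (\sum_m co l (a * b m) *: c m) *t I = \sum_m co l (a * b m) *: (c m *t I).
    rewrite (big_morph (fun X => X *t I) (id1 := 0) (op1 := +%R)).
    - by apply: eq_bigr => m _; rewrite tmx_Zl.
    - by move=> X Y; rewrite tmx_Dl.
    - exact: tens0mx.
  by rewrite mulmx_sumr; apply: eq_bigr => m _;
    rewrite [M (_ *: _)]linearZ -!scalemxAl -scalemxAr.
rewrite exchange_big; apply: eq_bigr => m _ /=.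
have E : M a *m M (b m) = \sum_l M (co l (a * b m) *: b l).
  have -> : M a *m M (b m) = M (a * b m) by rewrite [RHS]rmorphM.
  by rewrite {1}(letter_expand fr (a * b m)) linear_sum.
by rewrite -!mulmx_suml -E !mulmxA.
Qed.

Let i_unit : i \in unitmx.
Proof.
apply: inj_unitmx => y iy; pose yl l : 'cV[k]_(1 * rdim W) := (c l *t I) *m y.
(* Act by a on i y and apply the coefficient of uv on the left factor. Taking a = uv, v, u, 1 in
   turn isolates the components of y at 1, u, v, uv. *)
have Ty a : \sum_l T (a * b l) *m yl l = 0.
  transitivity ((c (true, true) *t I) *m M a *m (i *m y)); last by rewrite iy mulmx0.
  rewrite /i mulmx_suml mulmx_sumr; apply: eq_bigr => l _.
  rewrite -T_conv rmorphM -[M a * M _]/(M a *m M _) /yl !mulmxA //.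
have T0 : T 0 = 0 by rewrite /T /left_conv !linear0 tensmx0.
have mE := fr_mulE fr.
have y1 : yl (false, false) = 0.
  apply: Tw_inj; have := Ty w; rewrite big_letter /= mulr1 !mE T0 !mul0mx !addr0 //.
have yu : yl (true, false) = 0.
  apply: Tw_inj; have := Ty v; rewrite big_letter /= y1 !mE T0 mulmx0 !mul0mx !addr0 add0r //.
have yv : yl (false, true) = 0.
  apply: Tw_inj; have := Ty u; rewrite big_letter /= y1 yu !mE T0 !mulmx0 !mul0mx !addr0 !add0r //.
have yw : yl (true, true) = 0.
  apply: Tw_inj; have := Ty 1; rewrite big_letter /= y1 yu yv !mulmx0 !add0r mul1r //.
have y0 l : yl l = 0 by case: l => [[] []].
have one : 1%:M = \sum_l (e l *t I) *m (c l *t I) :> 'M[k]_(n4 * rdim W).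
  have -> : \sum_l (e l *t I) *m (c l *t I) = (\sum_l e l *m c l) *t I.
    rewrite (big_morph (fun X => X *t I) (id1 := 0) (op1 := +%R)).
    - by apply: eq_bigr => m _; rewrite tensmx_mul mulmx1.
    - by move=> X Y; rewrite tmx_Dl.
    - exact: tens0mx.
  rewrite -tmx_11; congr (_ *t _); apply/matrixP => x z; rewrite summxE mxE.
  rewrite (bigD1 (enum_val x)) //= big1 ?addr0 => [|l lx]; last first.
    rewrite mul_delta_mx mxE; case: eqP => //= xl.
    by rewrite xl enum_rankK eqxx in lx.
  by rewrite mul_delta_mx mxE enum_valK eqxx eq_sym.
rewrite -[y]mul1mx one mulmx_suml big1 // => l _.
by rewrite -mulmxA -/(yl l) y0 mulmx0.
Qed.

(** The map sends a (x) y to Delta(a) (1 (x) y). Its source, with A acting on the left factor only,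
    does not involve the Hopf structure, so the products of A with W for two structures are
    isomorphic. *)
Lemma regular_tensor : rep_iso reg_left M.
Proof.
exists i, (invmx i); split; [exact: mulmxV i_unit|exact: mulVmx i_unit|exact: i_rep].
Qed.

End RegularTensor.


(** * Comparison of the tensor products *)

Section Compare.
Variables (k : closedFieldType) (char2 : 2%N \in [pchar k]).
Variables (A : falgType k) (eps : {lrmorphism A -> k^o}).
Variables (u v : A) (fr : frame eps u v).
Local Notation co := (coletter fr).
Local Notation w := (u * v).

Lemma tensor_rep_expand (H : hopf eps) (V W : rep A) a :
  tensor_rep H V W a = \sum_l \sum_m
    pairing (co l) (co m) (comul H a) *: (V (letter u v l) *t W (letter u v m)).
Proof.
rewrite tensor_repE {1}(letter_tens_expand fr (comul H a)) /tact linear_sum.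
apply: eq_bigr => l _; rewrite linear_sum; apply: eq_bigr => m _.
by rewrite linearZ /= -/(tact _ _ _) tact_tens.
Qed.

(** When uv acts by 0, only the terms of Delta(a) in 1, u, v on both sides survive; the counit
    determines those with a factor 1. *)
Lemma tensor_rep_quadratic (H : hopf eps) (V W : rep A) a :
  eps a = 0 -> fr3 fr a = 0 -> V w = 0 -> W w = 0 ->
  tensor_rep H V W a = V a *t 1%:M + 1%:M *t W a
    + pairing (fr1 fr) (fr1 fr) (comul H a) *: (V u *t W u)
    + pairing (fr1 fr) (fr2 fr) (comul H a) *: (V u *t W v + V v *t W u)
    + pairing (fr2 fr) (fr2 fr) (comul H a) *: (V v *t W v).
Proof.
move=> a0 a3 Vw Ww.
have F1 := functional1 fr; have F2 := functional2 fr; have F3 := functional3 fr.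
have Fe := functional_eps eps.
have Pe phi : functional phi -> pairing eps phi (comul H a) = phi a.
  by move=> fp; rewrite -(conv_pairing H eps a fp) conv_eps.
have Ma (X : rep A) : X w = 0 -> X a = fr1 fr a *: X u + fr2 fr a *: X v.
  move=> Xw; rewrite {1}(frE fr a) a0 a3 !scale0r add0r addr0.
  by rewrite linearD !linearZ.
rewrite tensor_rep_expand !big_letter /= Vw Ww !tens0mx !tensmx0 !scaler0 !addr0.
rewrite !Pe // a0 !rmorph1 scale0r add0r.
rewrite (pairingC H a F1 Fe) (pairingC H a F2 Fe) !Pe // (pairingC H a F2 F1).
rewrite (Ma V Vw) (Ma W Ww) tmx_Dl tmx_Dr !tmx_Zl !tmx_Zr scalerDr.
by rewrite [LHS](AC (2*3*3) ((3*6)*(1*2)*4*(5*7)*8)).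
Qed.

Section Core.
Variables (H H0 : hopf eps).
Hypothesis H0u : comul H0 u = tens u 1 + tens 1 u.
Hypothesis H0v : comul H0 v = tens v 1 + tens 1 v.
Hypothesis tw : twist H fr = 0.
Variables (V W : rep A).
Hypotheses (Vw : V w = 0) (Ww : W w = 0).
Hypothesis exV : forall c, exact_mx (V v + c *: V u).
Hypothesis exW : forall c, exact_mx (W v + c *: W u).

Let mul0 (X : rep A) a b : X w = 0 -> a * b = 0 \/ a * b = w -> X a *m X b = 0.
Proof.
move=> Xw E; have -> : X a *m X b = X (a * b) by rewrite [RHS]rmorphM.
by case: E => -> //; rewrite linear0.
Qed.

(** Writing u = v N on each factor makes every quadratic term a multiple of w = v (x) v, which puts
    both actions in the form of [twisted_conjugate]; the operator E comes from V. *)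
Lemma tensor_core : rep_iso (tensor_rep H V W) (tensor_rep H0 V W).
Proof.
have vvV := mul0 Vw (or_introl (fr_vv fr)); have vvW := mul0 Ww (or_introl (fr_vv fr)).
have uvV := mul0 Vw (or_intror (erefl w)); have uvW := mul0 Ww (or_intror (erefl w)).
have vuV := mul0 Vw (or_intror (fr_vu fr)); have vuW := mul0 Ww (or_intror (fr_vu fr)).
have [s1 [N1 [E1 [vs1 vN1 Nv1 sN1 [Ev1 EN1]]]]] := exact_pair_structure char2 vvV uvV vuV exV.
have [s2 [N2 [E2 [vs2 vN2 Nv2 sN2 _]]]] := exact_pair_structure char2 vvW uvW vuW exW.
pose R := 'M[k]_(rdim V * rdim W).
pose cl (X : 'M[k]_(rdim V)) : R := X *t 1%:M.
pose cr (X : 'M[k]_(rdim W)) : R := 1%:M *t X.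
have clM X Y : cl X * cl Y = cl (X *m Y) by rewrite -[LHS]/(_ *m _) tensmx_mul mulmx1.
have crM X Y : cr X * cr Y = cr (X *m Y) by rewrite -[LHS]/(_ *m _) tensmx_mul mulmx1.
have clr X Y : cl X * cr Y = X *t Y by rewrite -[LHS]/(_ *m _) tensmx_mul mulmx1 mul1mx.
have crl X Y : cr Y * cl X = X *t Y by rewrite -[LHS]/(_ *m _) tensmx_mul mulmx1 mul1mx.
have C X Y : cl X * cr Y = cr Y * cl X by rewrite clr crl.
have addrr (x : R) : x + x = 0 by rewrite -[x]scale1r -scalerDl addrr2 // scale0r.
have Z a (x : R) : a%:M * x = a *: x by rewrite -[LHS]/(_ *m _) mul_scalar_mx.
have ZC a (x : R) : a%:M * x = x * a%:M by rewrite -[RHS]/(_ *m _) scalar_mxC.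
have EN1' : E1 *m N1 + N1 *m E1 = N1.
  rewrite -{3}EN1; congr (_ + _); apply: (addrI (N1 *m E1)); rewrite subrr.
  by rewrite -[N1 *m E1]scale1r -scalerDl addrr2 // scale0r.
pose pr a i j := pairing i j (comul H a).
pose a0 := pr u (fr1 fr) (fr1 fr); pose a1 := pr u (fr1 fr) (fr2 fr).
pose b0 := pr v (fr1 fr) (fr1 fr); pose b1 := pr v (fr1 fr) (fr2 fr).
pose b2 := pr v (fr2 fr) (fr2 fr).
pose g : R := b0%:M * (cl N1 * cr N2) + b1%:M * (cl N1 + cr N2) + b2%:M.
have gC (x : R) : x * cl N1 = cl N1 * x -> x * cr N2 = cr N2 * x -> g * x = x * g.
  move=> x1 x2; apply/commr_sym/commrD; last by apply/commr_sym; exact: ZC.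
  apply: commrD; apply: commrM; try by apply/commr_sym; exact: ZC.
    exact: commrM.
  exact: commrD.
have NvV : N1 *m V v = V v *m N1 by rewrite Nv1 vN1.
have NvW : N2 *m W v = W v *m N2 by rewrite Nv2 vN2.
have cN : cl N1 * cl (V v) = cl (V v) * cl N1 by rewrite !clM NvV.
have crN : cr N2 * cr (W v) = cr (W v) * cr N2 by rewrite !crM NvW.
have csN : cl N1 * cl s1 = cl s1 * cl N1 by rewrite !clM sN1.
have csN2 : cr N2 * cr s2 = cr s2 * cr N2 by rewrite !crM sN2.
have [Phi [Psi [PP1 PP2 Phiv Phiu]]] := @twisted_conjugate R addrr
  (cl (V v)) (cr (W v)) (cl s1) (cr s2) (cl N1) (cr N2) (cl E1) a0%:M a1%:M g
  ltac:(by rewrite clM vvV /cl tens0mx) ltac:(by rewrite crM vvW /cr tensmx0) (C _ _)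
  ltac:(by rewrite !clM -tmx_Dl vs1 /cl tmx_11) ltac:(by rewrite !crM -tmx_Dr vs2 /cr tmx_11)
  (C _ _) (esym (C _ _)) cN (C _ _) (esym (C _ _)) crN csN (C _ _) (esym (C _ _)) csN2
  (C _ _) ltac:(by rewrite !clM Ev1) (C _ _) (C _ _)
  ltac:(by rewrite !clM -tmx_Dl EN1')
  ltac:(by apply: gC; rewrite ?C) ltac:(by apply: gC; rewrite ?C)
  ltac:(by apply: gC; rewrite ?C) ltac:(by apply: gC; rewrite ?C)
  ltac:(by apply: gC; rewrite ?C) (ZC _) (ZC _)
  _ _ _ _ _ _ _ _ _ erefl erefl erefl erefl erefl erefl erefl erefl erefl.
pose M := tensor_rep H V W; pose M0 := tensor_rep H0 V W.
have tactD s t : tact V W (s + t) = tact V W s + tact V W t by rewrite /tact linearD.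
have eps_u : eps u = 0 by rewrite -(combu u v) (eps_comb fr).
have eps_v : eps v = 0 by rewrite -(combv u v) (eps_comb fr).
have [fr3_u fr3_v] : fr3 fr u = 0 /\ fr3 fr v = 0.
  split; [exact: (coletter_letter fr (true, true) (true, false))
    |exact: (coletter_letter fr (true, true) (false, true))].
have M0u : M0 u = cl (V v) * cl N1 + cr (W v) * cr N2.
  rewrite /M0 tensor_repE H0u tactD !tact_tens !rmorph1.
  by rewrite !clM !crM vN1 vN2.
have M0v : M0 v = cl (V v) + cr (W v).
  by rewrite /M0 tensor_repE H0v tactD !tact_tens !rmorph1.
have ZR (x y : R) c : x * (c *: y) = c *: (x * y).
  by rewrite -[LHS]/(_ *m _) -scalemxAr.
have quad c0 c1 : cl (V v) * cr (W v) * (c0%:M * (cl N1 * cr N2) + c1%:M * (cl N1 + cr N2)) =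
    c0 *: (V u *t W u) + c1 *: (V u *t W v + V v *t W u) :> R.
  rewrite !Z !clr mulrDr !ZR mulrDr; congr (_ *: _ + _ *: (_ + _)).
  - by rewrite -[LHS]/(_ *m _) tensmx_mul vN1 vN2.
  - by rewrite -[LHS]/(_ *m _) tensmx_mul vN1 mulmx1.
  - by rewrite -[LHS]/(_ *m _) tensmx_mul vN2 mulmx1.
have Mu : M u = cl (V v) * cl N1 + cr (W v) * cr N2 +
    cl (V v) * cr (W v) * (a0%:M * cl N1 * cr N2 + a1%:M * (cl N1 + cr N2)).
  rewrite -[a0%:M * cl N1 * cr N2]mulrA quad // clM crM vN1 vN2 /M tensor_rep_quadratic //.
  (* The v (x) v term of Delta(u), the one not divisible by N1 or N2, is the twist. *)
  by rewrite -(twistE H fr) tw scale0r addr0 -!addrA.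
have Mv : M v = cl (V v) + cr (W v) + cl (V v) * cr (W v) * g.
  rewrite /g [cl (V v) * cr (W v) * (_ + b2%:M)]mulrDr quad // -ZC Z clr /M tensor_rep_quadratic // -!addrA //.
apply: rep_iso_sym; exists Phi, Psi; split=> // a.
have Eu : Phi *m M0 u = M u *m Phi by rewrite M0u Mu; exact: Phiu.
have Ev : Phi *m M0 v = M v *m Phi by rewrite M0v Mv; exact: Phiv.
have Ew : Phi *m M0 w = M w *m Phi.
  have -> : M0 w = M0 u *m M0 v by rewrite [LHS]rmorphM.
  have -> : M w = M u *m M v by rewrite [LHS]rmorphM.
  by rewrite mulmxA Eu -[M u *m Phi *m M0 v]mulmxA Ev mulmxA.
have E1' : Phi *m M0 1 = M 1 *m Phi by rewrite !rmorph1 mulmx1 mul1mx.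
rewrite -/M -/M0 (frE fr a) !linearD !linearZ /=.
by rewrite !mulmxDl -!scalemxAl -Eu -Ev -Ew -E1'.
Qed.

End Core.
End Compare.


(** * Agreement at noble points *)

Section NobleCompare.
Variables (k : closedFieldType) (char2 : 2%N \in [pchar k]).
Variables (A : falgType k) (eps : {lrmorphism A -> k^o}).
Variables (H H0 : hopf eps).
Variables (u v : A) (fr : frame eps u v).
Hypothesis H0u : comul H0 u = tens u 1 + tens 1 u.
Hypothesis H0v : comul H0 v = tens v 1 + tens 1 v.
Hypothesis tw : twist H fr = 0.
Local Notation exact_lines V := (forall c, exact_mx (V v + c *: V u)).

Let same_tensor (V W : rep A) := rep_iso (tensor_rep H V W) (tensor_rep H0 V W).

Let regular_same_tensor W : same_tensor (reg_rep fr) W.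
Proof.
apply: rep_iso_trans (rep_iso_sym (regular_tensor char2 H fr W)) _.
exact: regular_tensor.
Qed.

Let same_tensor_sym V W : same_tensor V W -> same_tensor W V.
Proof.
move=> E; apply: rep_iso_trans (tensor_flip H W V) _.
exact: rep_iso_trans E (tensor_flip H0 V W).
Qed.

Let exact_summand (V X V' : rep A) : biproduct V X V' -> exact_lines V -> exact_lines V'.
Proof.
move=> bi ex c; have E (Y : rep A) : Y v + c *: Y u = Y (v + c *: u).
  by rewrite linearD linearZ.
by rewrite E; apply: (biproduct_exact bi); rewrite -E; exact: ex.
Qed.

(** Induction on the total dimension: regular summands are split off V, and by the flip off W, until
    uv kills both and [tensor_core] applies. *)
Lemma twist0_same_tensor (V W : rep A) : exact_lines V -> exact_lines W -> same_tensor V W.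
Proof.
have [n] := ubnP (rdim V + rdim W)%N; elim: n V W => // n IH V W.
rewrite ltnS => VWn exV exW.
have [Vw|Vw] := eqVneq (V (u * v)) 0; last first.
  have [V' [lt [bi _]]] := regular_summand char2 fr Vw.
  apply: biproduct_iso (biproduct_tensorl H W bi) (biproduct_tensorl H0 W bi) _ _.
    exact: regular_same_tensor.
  apply: IH => //; last exact: exact_summand bi exV.
  by apply: leq_trans VWn; rewrite ltn_add2r.
have [Ww|Ww] := eqVneq (W (u * v)) 0; first exact: (tensor_core char2 H0u H0v tw Vw Ww exV exW).
have [W' [lt [bi _]]] := regular_summand char2 fr Ww.
apply: same_tensor_sym.
apply: biproduct_iso (biproduct_tensorl H V bi) (biproduct_tensorl H0 V bi) _ _.
  exact: regular_same_tensor.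
apply: IH => //; last exact: exact_summand bi exW.
by apply: leq_trans VWn; rewrite addnC ltn_add2l.
Qed.

(** The class dual to v lies in P but takes the value 1 at v + c u, so v + c u generates a different
    point, where V is projective. *)
Lemma supported_exact_lines (P : point eps) (V : rep A) :
  same_point P (frame_point char2 fr) -> supported_at 2 H P V -> exact_lines V.
Proof.
move=> PE sV c; have [frs Es1 Es2] := frame_swap fr.
have [frc [Ec1 Ec2]] := frame_lin char2 frs c 0 (oner_neq0 k).
have E : V v + c *: V u = V (1 *: v + c *: u + 0 *: (v * u)).
  by rewrite scale1r scale0r addr0 linearD linearZ.
rewrite E => x; move: x; apply: (@supported_exact _ char2 _ _ _ _ _ frc _ _ sV) => PQ.
have /PE/PQ[_ /eqP] : frame_point char2 fr 1%N (coch1 (fr2 fr)).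
  by split; [exact: cocycle_fr2|rewrite /coch1 ffunE fr2u].
have fv : fr2 fr v = 1 by exact: (coletter_letter fr (false, true) (false, true)).
rewrite /coch1 ffunE scale1r scale0r addr0 addrC (functional2 fr) fr2u fv.
by rewrite mulr0 add0r oner_eq0.
Qed.

End NobleCompare.

(** * Disagreement at ignoble points *)

Section IgnobleCompare.
Variables (k : closedFieldType) (char2 : 2%N \in [pchar k]).
Variables (A : falgType k) (eps : {lrmorphism A -> k^o}).
Variables (u v : A) (fr : frame eps u v).

(* A / (u) *)
Definition quot_mx (a : A) : 'M[k]_2 :=
  \matrix_(i, j) (if i == j then eps a else if j == 0 then fr2 fr a else 0).

Fact quot_linear : linear quot_mx.
Proof.
move=> c x y; apply/matrixP => i j; rewrite !mxE.
case: (i == j); first by rewrite linearP.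
case: (j == 0); last by rewrite mulr0 addr0.
exact: (coletter_lin fr (false, true)).
Qed.

Fact quot_monoid : monoid_morphism quot_mx.
Proof.
have f1 : fr2 fr 1 = 0 by exact: (coletter_letter fr (false, true) (false, false)).
split=> [|x y]; apply/matrixP => i j.
  by rewrite !mxE f1 rmorph1 if_same; case: eqP.
rewrite [RHS]mxE big_ord_recl big_ord1 !mxE rmorphM fr2_derivation.
by case: i j => [[|[|//]] ?] [[|[|//]] ?]; rewrite /= ?mulr0 ?mul0r ?addr0 ?add0r // addrC.
Qed.

Definition quot_rep : rep A := Rep quot_linear quot_monoid.

Lemma quot_u : quot_rep u = 0.
Proof.
have eu : eps u = 0 by exact: (coletter_letter fr (false, false) (true, false)).
by apply/matrixP => i j; rewrite !mxE eu fr2u !if_same.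
Qed.

Lemma quot_w : quot_rep (u * v) = 0.
Proof.
have u0 : quot_mx u = 0 by exact: quot_u.
by rewrite [LHS](quot_monoid.2 u v) u0 mul0r.
Qed.

Lemma quot_v i j : quot_rep v i j = ((i != 0) && (j == 0))%:R.
Proof.
have ev : eps v = 0 by exact: (coletter_letter fr (false, false) (false, true)).
have fv : fr2 fr v = 1 by exact: (coletter_letter fr (false, true) (false, true)).
by rewrite mxE ev fv; case: i j => [[|[|//]] ?] [[|[|//]] ?].
Qed.

Lemma bc_quot (K : fieldType) (iota : {rmorphism k -> K}) (y : bchange iota A) (i j : 'I_2) :
  bc_rep iota quot_rep y i j =
  if i == j then bc_eps iota eps y else if j == 0 then bc_fun (fr2 fr) y else 0.
Proof.
have sl : semilin iota (fun a => map_mx iota (quot_rep a)).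
  by move=> c a b; rewrite linearP map_mxD map_mxZ.
have F2 := functional2 fr.
elim/bc_ind: y => [|y y' IH IH'|c a].
- by rewrite !linear0 /bc_fun linear0 mxE !if_same.
- rewrite linearD mxE IH IH' /bc_fun !linearD /=; case: (i == j) => //.
  by case: (j == 0); rewrite ?addr0.
rewrite linearZ mxE /= /bc_rmx bc_liftE // /bc_fun !linearZ /= -/(bc_fun (fr2 fr) _).
rewrite bc_fun_bc // bc_epsE !mxE; case: (i == j) => //.
by case: (j == 0); rewrite ?rmorph0 ?mulr0.
Qed.

Variables (H H0 : hopf eps).

(** If c2 (alpha t) = 0, alpha represents P by [point_frameE]. Otherwise t acts by a nonzero
    multiple of v and the module is free of rank one over K[t]/t^2. *)
Lemma quot_supported (P : point eps) : same_point P (frame_point char2 fr) ->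
  supported_at 2 H P quot_rep.
Proof.
move=> PE Q [K [iota [alpha [pa ra np]]]].
pose y := alpha (trunc_t K); pose b := bc_fun (fr2 fr) y.
have [b0|b0] := eqVneq b 0.
  move=> n f; apply: iff_trans (PE n f) _; apply: iff_sym.
  apply: (point_frameE char2 (fr := fr)); apply/ra.
  by apply/(pi_ideal_coch1 char2 fr alpha (cocycle_fr2 char2 fr)).
case: np; pose M := restr alpha (rep_mod (bc_rep iota quot_rep)).
have sc (c : K) (x : M) : (c *: 1 : trunc_poly K 2) *: x = c *: (x : 'cV[K]_2) :> 'cV_2.
  rewrite -[LHS]/(bc_rep iota quot_rep (alpha (c *: 1)) *m x) !linearZ /= !rmorph1.
  by have [m1 _] := bc_rmx_monoid iota quot_rep; rewrite -scalemxAl m1 mul1mx.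
have ts (x : M) : trunc_t K *: x = b *: ((delta_mx 1 0 : 'M[K]_2) *m (x : 'cV[K]_2)) :> 'cV_2.
  rewrite -[LHS]/(bc_rep iota quot_rep y *m x) scalemxAl; congr (_ *m _).
  apply/matrixP => i j; rewrite bc_quot !mxE (bc_eps_alpha eps alpha) trunc_eps_t.
  by case: i j => [[|[|//]] ?] [[|[|//]] ?]; rewrite /= ?mulr0 ?mulr1.
have ts0 (x : M) : (trunc_t K *: x : 'cV[K]_2) 0 0 = 0.
  by rewrite ts !mxE big_ord_recl big_ord1 !mxE /= !mul0r addr0 mulr0.
have ts1 (x : M) : (trunc_t K *: x : 'cV[K]_2) 1 0 = b * (x : 'cV[K]_2) 0 0.
  by rewrite ts !mxE big_ord_recl big_ord1 !mxE /= mul1r mul0r addr0.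
pose m (_ : 'I_1) : M := (delta_mx 0 0 : 'cV[K]_2).
apply: (@trunc_free_projective K M 1 m (fun _ x => (x : 'cV[K]_2) 0 0)
  (fun _ x => (x : 'cV[K]_2) 1 0 / b)).
- by move=> j c x x'; rewrite -[(_ + _ : M)]/(_ + _ : 'cV[K]_2) sc !mxE.
- by move=> j c x x'; rewrite -[(_ + _ : M)]/(_ + _ : 'cV[K]_2) sc !mxE mulrDl mulrA.
- by move=> j x; exact: ts0.
- by move=> j x; rewrite ts1 mulrC mulKf.
move=> x; rewrite big_ord1 -[RHS]/(_ + _ : 'cV[K]_2) !sc.
apply/colP => i; rewrite mxE [in RHS]mxE [X in _ + X]mxE.
case: i => [[|[|//]] lti].
- have -> : Ordinal lti = 0 by exact: val_inj.
  by rewrite ts0 mulr0 addr0 !mxE eqxx mulr1.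
have -> : Ordinal lti = 1 by exact: val_inj.
by rewrite ts1 !mxE /= mulr0 add0r mulr1 divfK.
Qed.

Lemma twist_not_same_tensor : comul H0 u = tens u 1 + tens 1 u -> twist H fr <> 0 ->
  ~ rep_iso (tensor_rep H quot_rep quot_rep) (tensor_rep H0 quot_rep quot_rep).
Proof.
move=> H0u tw [P [Q [PQ QP PM]]]; apply: tw.
have eu : eps u = 0 by exact: (coletter_letter fr (false, false) (true, false)).
have u3 : fr3 fr u = 0 by exact: (coletter_letter fr (true, true) (true, false)).
have M0u : tensor_rep H0 quot_rep quot_rep u = 0.
  have u0 : quot_mx u = 0 by exact: quot_u.
  rewrite tensor_repE H0u /tact linearD /= !tlift_tens.
  - by rewrite u0 tens0mx tensmx0 addr0.
  - exact: (tact_bil quot_rep quot_rep).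
  exact: (tact_bil quot_rep quot_rep).
have : tensor_rep H quot_rep quot_rep u = 0.
  by rewrite -[LHS]mul1mx -QP -mulmxA PM M0u mul0mx mulmx0.
rewrite (tensor_rep_quadratic H eu u3 quot_w quot_w) quot_u.
rewrite !tens0mx !tensmx0 !addr0 !scaler0 !add0r -(twistE H fr).
move=> /matrixP/(_ (mxtens_index (1, 1)) (mxtens_index (0, 0))).
by rewrite mxE tensmxE !quot_v /= !mulr1 mxE.
Qed.

End IgnobleCompare.


(** * The enveloping algebra *)

(** The map j corestricted to U extends to F : A -> U; followed by the inclusion it agrees with the
    identity on j, hence everywhere by uniqueness. *)
Lemma enveloping_generated (k : fieldType) p (g : vectType k) (L : restricted_lie p g)
    (A : falgType k) (j : g -> A) (U : {aspace A}) :
  restricted_enveloping L j -> 1 \in U -> (forall x, j x \in U) -> forall a, a \in U.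
Proof.
move=> [[jl jb jp] univ] U1 Uj a; have a1 : algid U = 1 by apply/eqP; rewrite algid_eq1.
pose f x := vsproj U (j x).
have fE x : vsval (f x) = j x by rewrite vsprojK.
have vM (b c : subvs_of U) : vsval (b * c) = vsval b * vsval c by [].
have v1 : vsval (1 : subvs_of U) = 1 by exact: a1.
have vP c (b d : subvs_of U) : vsval (c *: b + d) = c *: vsval b + vsval d by [].
have vB (b d : subvs_of U) : vsval (b - d) = vsval b - vsval d by [].
have vI : injective (vsval : subvs_of U -> A) by exact: val_inj.
have fh : restricted_hom L f.
  split=> [c x y|x y|x]; apply: vI.
  - by rewrite vP !fE jl.
  - by rewrite vB !vM !fE jb.
  rewrite fE jp; elim: (p) => [|n IH]; first by rewrite !expr0 v1.
  by rewrite !exprS vM -IH fE.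
have [F [FE _]] := univ _ f fh; have [h [_ huniq]] := univ _ j (And3 jl jb jp).
have mon : monoid_morphism (vsval \o F).
  by split=> [|b c]; rewrite /= ?rmorph1 ?v1 ?rmorphM.
have lin : linear (vsval \o F) by move=> c b d; rewrite /= linearP.
pose F' : {lrmorphism A -> A} := HB.pack (vsval \o F : A -> A)
  (GRing.isLinear.Build k A A *:%R (vsval \o F) lin)
  (GRing.isMonoidMorphism.Build A A (vsval \o F) mon).
have E1 : F' =1 h by apply: huniq => x; exact: etrans (congr1 vsval (FE x)) (fE x).
have E2 : (idfun : {lrmorphism A -> A}) =1 h by apply: huniq => x.
have -> : a = vsval (F a) by exact: etrans (E2 a) (esym (E1 a)).
exact: subvsP.
Qed.

Section ExteriorModel.
Variable k : fieldType.

(* Left multiplication by the generators of k[x,y]/(x^2,y^2) on 1, x, y, xy. *)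
Definition model_x : 'M[k]_4 :=
  \matrix_(i, j) (((i, j) == (1, 0) :> 'I_4 * 'I_4) || ((i, j) == (3%:R, 2%:R) :> 'I_4 * 'I_4))%:R.

Definition model_y : 'M[k]_4 :=
  \matrix_(i, j) (((i, j) == (2%:R, 0) :> 'I_4 * 'I_4) || ((i, j) == (3%:R, 1) :> 'I_4 * 'I_4))%:R.

Ltac model := apply/matrixP; rewrite /model_x /model_y;
  do 2!case=> [[|[|[|[|//]]]] ?]; rewrite !mxE ?big_ord_recl ?big_ord0 ?mxE /=;
  rewrite ?(mulr0, mul0r, mulr1, addr0, add0r).

Lemma model_xx : model_x * model_x = 0. Proof. by model. Qed.
Lemma model_yy : model_y * model_y = 0. Proof. by model. Qed.
Lemma model_yx : model_y * model_x = model_x * model_y. Proof. by model. Qed.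

(** Column 0 is the image of the basis vector 1, from which the coefficients are read. *)
Lemma model_col0 x0 x1 x2 x3 i :
  (x0 *: 1 + x1 *: model_x + x2 *: model_y + x3 *: (model_x * model_y) : 'M[k]_4) i 0 =
  nth 0 [:: x0; x1; x2; x3] i.
Proof.
rewrite /model_x /model_y; case: i => [[|[|[|[|//]]]] ?];
rewrite !mxE ?big_ord_recl ?big_ord0 ?mxE /=;
by rewrite ?(mulr0, mul0r, mulr1, addr0, add0r).
Qed.

End ExteriorModel.

Section EnvelopingFrame.
Variables (k : fieldType) (char2 : 2%N \in [pchar k]) (g : vectType k) (L : restricted_lie 2 g).
Hypothesis dim_g : \dim {:g} = 2%N.
Hypothesis abelian_g : forall x y, bracket L x y = 0.
Hypothesis ppow_g : forall x, ppow L x = 0.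
Variables (A : falgType k) (j : g -> A) (eps : {lrmorphism A -> k^o}).
Hypothesis env : restricted_enveloping L j.
Hypothesis epsj : forall x, eps (j x) = 0.

Let i0 : 'I_(\dim {:g}) := cast_ord (esym dim_g) 0.
Let i1 : 'I_(\dim {:g}) := cast_ord (esym dim_g) 1.
Let x := j (sbasis i0).
Let y := j (sbasis i1).

Let i01 : (i0 == i1) = false. Proof. by []. Qed.

Let expand z : z = crd z i0 *: sbasis i0 + crd z i1 *: sbasis i1.
Proof.
rewrite [LHS]sbasisE (bigD1 i0) //= (bigD1 i1) //= big1 ?addr0 // => i /andP[n0 n1].
have := ltn_ord i; rewrite {2}dim_g; move: n0 n1; rewrite -!val_eqE /=.
by case: (nat_of_ord i) => [|[|]].
Qed.

Let jl : linear j. Proof. by case: env => -[]. Qed.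

Let j0 : j 0 = 0.
Proof. by have := jl (-1) 0 0; rewrite scaler0 addr0 scaleN1r addNr. Qed.

Let jM z z' : j z * j z' = j z' * j z.
Proof. by case: env => -[_ jb _] _; apply/eqP; rewrite -subr_eq0 -jb abelian_g j0. Qed.

Let jz2 z : j z * j z = 0.
Proof. by case: env => -[_ _ jp] _; rewrite -expr2 -jp ppow_g. Qed.

Let span4 : {vspace A} := span [:: 1; x; y; x * y]%R.

Let mem4 z : z \in [:: 1; x; y; x * y] -> z \in span4. Proof. exact: memv_span. Qed.

Let span4_aspace : is_aspace span4.
Proof.
have m1 := mem4 (mem_head 1 _).
have mx : x \in span4 by rewrite mem4 // !inE eqxx !orbT.
have my : y \in span4 by rewrite mem4 // !inE eqxx !orbT.
have mw : x * y \in span4 by rewrite mem4 // !inE eqxx !orbT.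
have xx : x * x = 0 := jz2 _. have yy : y * y = 0 := jz2 _. have yx : y * x = x * y := jM _ _.
have xw : x * (x * y) = 0 by rewrite mulrA xx mul0r.
have yw : y * (x * y) = 0 by rewrite mulrA yx -mulrA yy mulr0.
have wx : x * y * x = 0 by rewrite -mulrA yx xw.
have wy : x * y * y = 0 by rewrite -mulrA yy mulr0.
have ww : x * y * (x * y) = 0 by rewrite mulrA wx mul0r.
rewrite /is_aspace has_algid1 //= {1 2}/span4 !span_cons span_nil addv0.
rewrite !(prodvDl, prodvDr) !prodv_line !subv_add -!memvE.
by rewrite !(mul1r, mulr1) xx yy yx xw yw wx wy ww m1 mx my mw mem0v.
Qed.

Let jE z : j z = crd z i0 *: x + crd z i1 *: y.
Proof. by rewrite {1}[z]expand -[_ *: sbasis i1]addr0 !jl j0 addr0. Qed.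

Let spanA (a : A) : a \in span4.
Proof.
apply: (enveloping_generated (U := ASpace span4_aspace) env) => [|z].
  by apply: mem4; rewrite mem_head.
by rewrite jE; apply: memvD; apply: memvZ; apply: mem4; rewrite !inE eqxx !orbT.
Qed.

Let comb4 (a : A) : exists x0 x1 x2 x3, a = x0 *: 1 + x1 *: x + x2 *: y + x3 *: (x * y).
Proof.
have := spanA a; rewrite /span4 !span_cons span_nil addv0.
case/memv_addP=> _ /vlineP[x0 ->] [_ /memv_addP[_ /vlineP[x1 ->] [_ /memv_addP[_ /vlineP[x2 ->]
  [_ /vlineP[x3 ->] ->]] ->]] ->].
by exists x0, x1, x2, x3; rewrite !addrA.
Qed.

(** 1, x, y, xy span a subalgebra containing the image of j, hence all of A. The universal map F to
    the 4 x 4 model shows that they are independent, and column 0 of F gives the coordinates. *)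
Lemma enveloping_frame : exists z1 z2, inhabited (frame eps (j z1) (j z2)).
Proof.
exists (sbasis i0), (sbasis i1); rewrite -/x -/y.
pose f z : 'M[k]_4 := crd z i0 *: model_x k + crd z i1 *: model_y k.
have fh : restricted_hom L f.
  have fl : linear f.
    by move=> c z z'; rewrite /f !crdP !scalerDl !scalerDr !scalerA addrACA.
  split=> // [z z'|z].
    rewrite abelian_g (_ : f 0 = 0); last first.
      by have := fl (-1) 0 0; rewrite scaler0 addr0 scaleN1r addNr.
    rewrite /f !(mulrDl, mulrDr, =^~ scalerAl, =^~ scalerAr) model_xx model_yy model_yx.
    rewrite !scaler0 !addr0 !add0r !scalerA ![crd z' _ * _]mulrC.
    by rewrite [X in _ - X]addrC subrr.
  rewrite ppow_g (_ : f 0 = 0); last first.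
    by have := fl (-1) 0 0; rewrite scaler0 addr0 scaleN1r addNr.
  rewrite /f expr2 !(mulrDl, mulrDr, =^~ scalerAl, =^~ scalerAr) model_xx model_yy model_yx.
  rewrite !scaler0 !addr0 !add0r !scalerA [crd z i1 * _]mulrC -scalerDl.
  by rewrite -mulr2n -mulr_natl (pcharf0 char2) mul0r scale0r.
have [F [FE _]] := env.2 _ f fh.
have fx : F x = model_x k.
  by rewrite [LHS]FE /f !crd_sbasis eqxx i01 scale1r scale0r addr0.
have fy : F y = model_y k.
  by rewrite [LHS]FE /f !crd_sbasis eqxx [i1 == i0]eq_sym i01 scale1r scale0r add0r.
have Fxy : F (x * y) = model_x k * model_y k by rewrite -fx -fy; exact: rmorphM.
have exy : eps (x * y) = 0 by apply: etrans (rmorphM eps x y) _; rewrite /= [eps x]epsj mul0r.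
pose c (i : 'I_4) a := F a i 0.
have K x0 x1 x2 x3 : let a := x0 *: 1 + x1 *: x + x2 *: y + x3 *: (x * y) in
    [/\ eps a = x0, c 1 a = x1, c 2%:R a = x2 & c 3%:R a = x3].
  move=> a; rewrite /c; have -> : F a = x0 *: 1 + x1 *: model_x k + x2 *: model_y k
      + x3 *: (model_x k * model_y k).
    by rewrite /a !linearD !linearZ /= Fxy rmorph1 fx fy.
  rewrite !model_col0 /=; split=> //; rewrite /a !linearD !linearZ /= rmorph1 exy !epsj.
  by rewrite !scaler0 !addr0; exact: mulr1.
have E a : a = eps a *: 1 + c 1 a *: x + c 2%:R a *: y + c 3%:R a *: (x * y).
  have [x0 [x1 [x2 [x3 aE]]]] := comb4 a; have := K x0 x1 x2 x3.
  by rewrite /= -aE => -[-> -> -> ->].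
split; exact: Frame E K (jz2 _) (jz2 _) (jM _ _).
Qed.

End EnvelopingFrame.

(** Primitive elements form a subspace, so the frame found for P can be kept primitive. *)
Lemma closed_point_primitive_frame (k : closedFieldType) (char2 : 2%N \in [pchar k])
    (g : vectType k) (L : restricted_lie 2 g) (dim_g : \dim {:g} = 2%N)
    (abelian_g : forall x y, bracket L x y = 0) (ppow_g : forall x, ppow L x = 0)
    (A : falgType k) (j : g -> A) (eps : {lrmorphism A -> k^o}) (H0 : hopf eps) (P : point eps) :
  primitive_enveloping L j H0 -> closed_point P ->
  exists u v (fr : frame eps u v),
    [/\ comul H0 u = tens u 1 + tens 1 u, comul H0 v = tens v 1 + tens 1 v
      & same_point P (frame_point char2 fr)].
Proof.
move=> [env epsj jprim] cP.
have [z1 [z2 [fr]]] := enveloping_frame char2 dim_g abelian_g ppow_g env epsj.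
pose S a := comul H0 a = tens a 1 + tens 1 a.
apply: (closed_point_frame char2 fr (S := S) (jprim z1) (jprim z2) _ cP) => l a b Sa Sb.
have [tl tr] := tens_bilin A A.
have tl' c (x y z : A) : tens (c *: x + y) z = c *: tens x z + tens y z.
  exact: (tl z c x y).
have tr' c (x y z : A) : tens z (c *: x + y) = c *: tens z x + tens z y.
  exact: (tr z c x y).
rewrite /S addrC tl' tr'; apply: etrans (linearP (comul H0) l b a) _.
by rewrite /= [comul H0 b]Sb [comul H0 a]Sa scalerDr addrACA.
Qed.

Theorem theorem1p1p2 (k : closedFieldType) (char2 : 2%N \in [pchar k])
    (g : vectType k) (L : restricted_lie 2 g)
    (dim_g : \dim {:g} = 2%N)
    (abelian_g : forall x y, bracket L x y = 0)
    (ppow_g : forall x, ppow L x = 0) :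
  property_PC L.
Proof.
split=> A j eps H0 env H P cP;
  have [u [v [fr [pu pv PE]]]] :=
    closed_point_primitive_frame char2 dim_g abelian_g ppow_g env cP.
  move=> nP V W sV sW; have tw := twist_of_noble PE nP.
  apply: (twist0_same_tensor char2 pu pv tw).
    exact: supported_exact_lines PE sV.
  exact: supported_exact_lines PE sW.
move=> nP; exists (quot_rep fr), (quot_rep fr).
split; [exact: quot_supported PE|exact: quot_supported PE|].
by apply: twist_not_same_tensor => // tw; apply: nP; apply: noble_of_twist PE tw.
Qed.
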